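(* Let $w<0$ and let $P(t)=\sum_{k=0}^{\infty}a_k e^{2\pi i b_k t}$, where $a_k\in\mathbb{C}$, $a_0=1$, $b_0=0$, and $b_k>0$ for every $k\geq 1$. Suppose that $$\sum_{k=1}^{\infty}|a_k|e^{2\pi |w| b_k}<1 .$$ Let $g(t)=\dfrac{P(t)}{t-iw}$. Then the frame set of $g$ is $$\mathcal{F}_g=\{(\alpha,\beta)\,:\,\alpha,\beta>0,\ \alpha\beta\leq 1\}.$$
   Context: For $g\in L^2(\mathbb{R})$ and $(x,\omega)\in\mathbb{R}^2$ put $\pi_{x,\omega}g(t)=e^{2\pi i\omega t}g(t-x)$. For $\alpha,\beta>0$ the Gabor system is $\mathcal{G}(g;\alpha,\beta)=\{\pi_{\alpha n,\beta m}g\}_{m,n\in\mathbb{Z}}$. It is a (Gabor) frame if there are constants $A,B>0$ with $A\|f\|_2^2\leq\sum_{m,n\in\mathbb{Z}}|(f,\pi_{\alpha n,\beta m}g)|^2\leq B\|f\|_2^2$ for all $f\in L^2(\mathbb{R})$. The frame set of $g$ is $\mathcal{F}_g=\{(\alpha,\beta):\alpha,\beta>0,\ \mathcal{G}(g;\alpha,\beta)\text{ is a frame}\}$. *)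

(* Defs.v *)
From mathcomp Require Import all_boot all_order all_algebra.
From mathcomp Require Import all_classical all_reals all_analysis.
From mathcomp Require Import complex.
Set Implicit Arguments. Unset Strict Implicit. Unset Printing Implicit Defensive.
Import Order.TTheory GRing.Theory Num.Theory.
Import numFieldNormedType.Exports.
Local Open Scope classical_set_scope.
Local Open Scope ring_scope.

(* Complex numbers are mathcomp-real-closed's [R[i]] (R : realType is an rcfType).
   Complex-valued functions on the real line are [R -> R[i]]. *)

(* squared modulus and modulus of a complex number *)
Definition cabs2 (R : realType) (z : R[i]) : R := complex.Re z ^+ 2 + complex.Im z ^+ 2.
Definition cabs (R : realType) (z : R[i]) : R := Num.sqrt (cabs2 z).

(* e^{i x} *)
Definition cexpi (R : realType) (x : R) : R[i] := (cos x +i* sin x)%C.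

(* time-frequency shift: (pi_{x,omega} g)(t) = e^{2 pi i omega t} g(t - x) *)
Definition tfshift (R : realType) (x omega : R) (g : R -> R[i]) : R -> R[i] :=
  fun t => cexpi (2 * pi * omega * t) * g (t - x).

(* g belongs to L^2(R): real and imaginary parts Lebesgue measurable and
   int |g|^2 < +oo *)
Definition L2 (R : realType) (g : R -> R[i]) : Prop :=
  measurable_fun [set: R] (fun t => complex.Re (g t)) /\
  measurable_fun [set: R] (fun t => complex.Im (g t)) /\
  (\int[@lebesgue_measure R]_t (cabs2 (g t))%:E < +oo)%E.

(* ||g||_2^2 as an extended real *)
Definition L2norm2 (R : realType) (g : R -> R[i]) : \bar R :=
  (\int[@lebesgue_measure R]_t (cabs2 (g t))%:E)%E.

(* L^2 inner product (f, h) = int f(t) conj(h(t)) dt *)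
Definition L2inner (R : realType) (f h : R -> R[i]) : R[i] :=
  (Rintegral (@lebesgue_measure R) [set: R] (fun t => complex.Re (f t * (h t)^*))
   +i* Rintegral (@lebesgue_measure R) [set: R] (fun t => complex.Im (f t * (h t)^*)))%C.

(* G(g; alpha, beta) = {pi_{alpha n, beta m} g}_{m,n in Z} is a frame *)
Definition gabor_frame (R : realType) (g : R -> R[i]) (alpha beta : R) : Prop :=
  exists A B : R, 0 < A /\ 0 < B /\
    forall f : R -> R[i], L2 f ->
      ((A%:E * L2norm2 f <=
        \esum_(mn in [set: int * int])
          (cabs2 (L2inner f (tfshift (alpha * mn.2%:~R) (beta * mn.1%:~R) g)))%:E)
       /\
       (\esum_(mn in [set: int * int])
          (cabs2 (L2inner f (tfshift (alpha * mn.2%:~R) (beta * mn.1%:~R) g)))%:E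
        <= B%:E * L2norm2 f))%E.

(* frame set F_g *)
Definition frame_set (R : realType) (g : R -> R[i]) : set (R * R) :=
  [set ab | 0 < ab.1 /\ 0 < ab.2 /\ gabor_frame g ab.1 ab.2].

(* P(t) = sum_{k>=0} a_k e^{2 pi i b_k t}, the series of complex numbers being
   summed componentwise (real and imaginary parts) as limits of partial sums. *)
Definition Pser (R : realType) (a : nat -> R[i]) (b : nat -> R) (t : R) : R[i] :=
  (limn (fun n => \sum_(0 <= k < n) complex.Re (a k * cexpi (2 * pi * b k * t)))
   +i* limn (fun n => \sum_(0 <= k < n) complex.Im (a k * cexpi (2 * pi * b k * t))))%C.

(* Main.v *)
(* With theta = 2 pi |w|, the Fourier transform of 1/(t - iw) is a constant times
   e^(- theta y) 1_(y >= 0), so up to reflection and a constant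
   g^(y) = sum_k a_k e^(- theta (y - b_k)) 1_(y >= b_k).
   Parseval on intervals of length T = 1/alpha turns the Gabor sum of f into
     sum_m int_0^T |v_m(x)|^2 dx,   v_m(x) = sum_j f^(x + j T) g^(x + j T - beta m),
   so everything happens in the fibers x + T Z. Schur's test gives the upper bound.
   Lower bound for alpha beta <= 1: let S(y) = sum_(x + j T >= y) f^(x + j T) e^(- theta (x + j T)).
   Then v_m e^(- theta beta m) = S(beta m) + sum_(k >= 1) a_k e^(theta b_k) S(beta m + b_k). Since
   beta <= T, the step function S takes each of its values at some beta m, and the
   hypothesis on rho = sum_(k >= 1) |a_k| e^(theta b_k) gives
   sup |S| <= sup_m |v_m e^(- theta beta m)| + rho sup |S|. Differences of S recover f^ on the fiber.
   Failure for alpha beta > 1: among n consecutive j only about n T / beta < n indices m interact; a nonzero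
   vector on these j orthogonal to all of them but those with m <= - m0 exists by counting dimensions, and the
   remaining v_m are exponentially small in m0.
   The infinite series P and general f are limits of finite sums and of inverse Fourier
   transforms of compactly supported functions. *)
Require Import Defs.
From mathcomp Require Import all_boot all_order all_algebra.
From mathcomp Require Import all_classical all_reals all_analysis.
From mathcomp Require Import complex.
From mathcomp Require Import measurable_realfun ring lra zify.
Import Order.TTheory GRing.Theory Num.Theory.
Import numFieldNormedType.Exports.
Local Open Scope classical_set_scope.
Local Open Scope ring_scope.
Set Implicit Arguments. Unset Strict Implicit. Unset Printing Implicit Defensive.

(** * Complex numbers and integrals *)

(** The lower bound is an l^2 estimate, whereas absorption by rho < 1 works for a supremum. The
    hypothesis b_k > 0 reconciles the two: the points beta m + b_k lie to the right of beta m, so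
    the supremum may be restricted to y >= beta m0 and then involves only the v_m with m >= m0.
    Taking m0 next to x_j bounds |f^(x_j)|^2 by a constant times the sum over m >= m0 of e^(2 theta
    (x_j - beta m)) |v_m|^2, and summing over j costs only a geometric series. The weight e^(theta
    b_k) is the price of a shift by b_k once the exponential is divided out.

    The bounds depend neither on the number of terms of P nor on the support of f^ nor on the index
    box, so limits can be taken one after the other on finite sums. For alpha beta > 1 the tail of P
    is cut first, with a bound valid for all f, and the bad f is chosen afterwards for the remaining
    finite sum.

    The Fourier transform is an integral over a bounded interval throughout. Plancherel comes from
    Parseval for Fourier series averaged over modulations, and a duality between the two transforms
    replaces an inversion formula. *)

Section complex_algebra.
Context {R : realType}.
Implicit Types x y z : R[i].

Lemma eqCP x y : complex.Re x = complex.Re y -> complex.Im x = complex.Im y -> x = y.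
Proof. by case: x => a b; case: y => c d /= -> ->. Qed.

Lemma ReM x y : complex.Re (x * y) = complex.Re x * complex.Re y - complex.Im x * complex.Im y.
Proof. by case: x => a b; case: y. Qed.

Lemma ImM x y : complex.Im (x * y) = complex.Re x * complex.Im y + complex.Im x * complex.Re y.
Proof. by case: x => a b; case: y. Qed.

Lemma ReD x y : complex.Re (x + y) = complex.Re x + complex.Re y.
Proof. by case: x => a b; case: y. Qed.

Lemma ImD x y : complex.Im (x + y) = complex.Im x + complex.Im y.
Proof. by case: x => a b; case: y. Qed.

Lemma ReN x : complex.Re (- x) = - complex.Re x.
Proof. by case: x. Qed.

Lemma ImN x : complex.Im (- x) = - complex.Im x.
Proof. by case: x. Qed.

Lemma Re_conj x : complex.Re (x^*) = complex.Re x.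
Proof. by case: x. Qed.

Lemma Im_conj x : complex.Im (x^*) = - complex.Im x.
Proof. by case: x. Qed.

Lemma Re_sum (I : Type) (r : seq I) (P : pred I) (F : I -> R[i]) :
  complex.Re (\sum_(i <- r | P i) F i) = \sum_(i <- r | P i) complex.Re (F i).
Proof. by apply: (big_morph _ ReD). Qed.

Lemma Im_sum (I : Type) (r : seq I) (P : pred I) (F : I -> R[i]) :
  complex.Im (\sum_(i <- r | P i) F i) = \sum_(i <- r | P i) complex.Im (F i).
Proof. by apply: (big_morph _ ImD). Qed.

Definition ReIm := (ReM, ImM, ReD, ImD, ReN, ImN, Re_conj, Im_conj).

Lemma cabs2_ge0 x : 0 <= cabs2 x.
Proof. by rewrite addr_ge0 ?sqr_ge0. Qed.

Lemma cabs2_0 : cabs2 (0 : R[i]) = 0.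
Proof. by rewrite /cabs2 /= expr0n addr0. Qed.

Lemma cabs2M x y : cabs2 (x * y) = cabs2 x * cabs2 y.
Proof. by rewrite /cabs2 !ReIm; ring. Qed.

Lemma cabs2_conj x : cabs2 (x^*) = cabs2 x.
Proof. by rewrite /cabs2 !ReIm; ring. Qed.

Lemma cabs2N x : cabs2 (- x) = cabs2 x.
Proof. by rewrite /cabs2 !ReIm; ring. Qed.

Lemma cabs2D x y : cabs2 (x + y) = cabs2 x + 2 * complex.Re (x * y^*) + cabs2 y.
Proof. by rewrite /cabs2 !ReIm; ring. Qed.

Lemma cabs2D_le x y : cabs2 (x + y) <= 2 * cabs2 x + 2 * cabs2 y.
Proof.
suff : 0 <= cabs2 (x - y) by rewrite /cabs2 !ReIm; nra.
exact: cabs2_ge0.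
Qed.

Lemma cabs2_real (r : R) : cabs2 (r%:C)%C = r ^+ 2.
Proof. by rewrite /cabs2 /= expr0n addr0. Qed.

Lemma mul_conjE x : x * x^* = ((cabs2 x)%:C)%C.
Proof. by apply: eqCP; rewrite !ReIm /= /cabs2; ring. Qed.

Lemma cabs_ge0 x : 0 <= cabs x. Proof. exact: sqrtr_ge0. Qed.

Lemma sqr_cabs x : cabs x ^+ 2 = cabs2 x.
Proof. by rewrite sqr_sqrtr// cabs2_ge0. Qed.

Lemma cabsM x y : cabs (x * y) = cabs x * cabs y.
Proof. by rewrite /cabs cabs2M sqrtrM// cabs2_ge0. Qed.

Lemma cabsD x y : cabs (x + y) <= cabs x + cabs y.
Proof.
have /= h := @le_normcD R x y.
by case: x y h => [a b] [c d] /=; rewrite /cabs /cabs2.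
Qed.

Lemma cabsN x : cabs (- x) = cabs x. Proof. by rewrite /cabs cabs2N. Qed.

Lemma cabs_conj x : cabs (x^*) = cabs x. Proof. by rewrite /cabs cabs2_conj. Qed.

Lemma cabs0 : cabs (0 : R[i]) = 0.
Proof. by rewrite /cabs cabs2_0 sqrtr0. Qed.

Lemma cabs_real (r : R) : cabs (r%:C)%C = `|r|.
Proof. by rewrite /cabs cabs2_real sqrtr_sqr. Qed.

Lemma cabs_sum (I : Type) (r : seq I) (P : pred I) (F : I -> R[i]) :
  cabs (\sum_(i <- r | P i) F i) <= \sum_(i <- r | P i) cabs (F i).
Proof.
elim/big_ind2 : _ => [|x1 x2 y1 y2 h1 h2|//]; first by rewrite cabs0.
by rewrite (le_trans (cabsD _ _))// lerD.
Qed.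

Lemma Re_le_cabs x : `|complex.Re x| <= cabs x.
Proof.
by rewrite -(ler_pXn2r (n:=2))// ?nnegrE ?cabs_ge0// sqr_cabs real_normK ?num_real// lerDl sqr_ge0.
Qed.

Lemma Im_le_cabs x : `|complex.Im x| <= cabs x.
Proof.
by rewrite -(ler_pXn2r (n:=2))// ?nnegrE ?cabs_ge0// sqr_cabs real_normK ?num_real// lerDr sqr_ge0.
Qed.

Lemma cabs2_eq0 x : cabs2 x = 0 -> x = 0.
Proof.
case: x => a b /eqP; rewrite paddr_eq0 ?sqr_ge0//= !sqrf_eq0.
by move=> /andP[/eqP -> /eqP ->].
Qed.

Lemma cabs2_cexpi (r : R) : cabs2 (cexpi r) = 1.
Proof. by rewrite /cabs2 /= cos2Dsin2. Qed.

Lemma cabs_cexpi (r : R) : cabs (cexpi r) = 1.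
Proof. by rewrite /cabs cabs2_cexpi sqrtr1. Qed.

Lemma cexpiD (r s : R) : cexpi (r + s) = cexpi r * cexpi s.
Proof. by apply: eqCP; rewrite !ReIm /= ?cosD ?sinD; ring. Qed.

Lemma cexpi0 : cexpi (0 : R) = 1.
Proof. by rewrite /cexpi cos0 sin0. Qed.

Lemma cexpi_conj (r : R) : (cexpi r)^* = cexpi (- r).
Proof. by apply: eqCP; rewrite !ReIm /= ?cosN ?sinN. Qed.

Lemma cexpi_period (r : R) (n : int) : cexpi (r + 2 * pi * n%:~R) = cexpi r.
Proof.
have nat_period (s : R) (k : nat) : cexpi (s + 2 * pi * k%:R) = cexpi s.
  elim: k s => [|k ih] s; first by rewrite mulr0 addr0.
  rewrite -[RHS](ih s) -[k.+1]addn1 natrD mulrDr mulr1 addrA /cexpi.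
  by rewrite [2 * pi]mulr_natl cosD2pi sinD2pi.
case: n => k; first exact: nat_period.
by rewrite NegzE mulrNz mulrN -{2}(subrK (2 * pi * k.+1%:~R) r) nat_period.
Qed.

End complex_algebra.

Section real_integrals.
Context {R : realType}.
Notation mu := (@lebesgue_measure R).
Implicit Types u v : R -> R.

Definition rint u := mu.-integrable [set: R] (EFin \o u).

Lemma rint_meas u : rint u -> measurable_fun [set: R] u.
Proof. by move/measurable_int/measurable_EFinP. Qed.

Lemma rint_le u v : measurable_fun [set: R] u -> (forall x, `|u x| <= v x) ->
  rint v -> rint u.
Proof.
move=> mu_ uv iv; apply: (le_integrable measurableT _ _ iv); first exact/measurable_EFinP.
by move=> x _ /=; rewrite lee_fin (le_trans (uv x))// ler_norm.
Qed.

Lemma rint_ltP u : measurable_fun [set: R] u -> (forall x, 0 <= u x) ->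
  (\int[mu]_x (u x)%:E < +oo)%E -> rint u.
Proof.
move=> mu_ u0 h; apply/integrableP; split; first exact/measurable_EFinP.
by under eq_integral => x _ do rewrite /= ger0_norm//.
Qed.

Lemma rint_fin u : rint u -> (\int[mu]_x (u x)%:E)%E = (\int[mu]_x u x)%:E.
Proof. by move=> iu; rewrite /Rintegral fineK//; exact: integrable_fin_num. Qed.

Lemma rintD u v : rint u -> rint v -> rint (fun x => u x + v x).
Proof. by move=> iu iv; exact: (integrableD measurableT iu iv). Qed.

Lemma rintB u v : rint u -> rint v -> rint (fun x => u x - v x).
Proof. by move=> iu iv; exact: (integrableB measurableT iu iv). Qed.

Lemma rintZ k u : rint u -> rint (fun x => k * u x).
Proof. by move=> iu; exact: (integrableZl measurableT k iu). Qed.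

Lemma rint0 : rint (fun=> 0).
Proof. exact: integrable0. Qed.

Lemma rint_sum (J : Type) (s : seq J) (P : pred J) (h : J -> R -> R) :
  (forall j, P j -> rint (h j)) -> rint (fun x => \sum_(j <- s | P j) h j x).
Proof.
move=> ih; elim: s => [|j s ih'].
  by under [X in rint X]eq_fun => x do rewrite big_nil; exact: rint0.
under [X in rint X]eq_fun => x do rewrite big_cons.
by case: (boolP (P j)) => // Pj; apply: rintD => //; exact: ih.
Qed.

Lemma Rintegral_sum (J : Type) (s : seq J) (P : pred J) (h : J -> R -> R) :
  (forall j, P j -> rint (h j)) ->
  \int[mu]_x (\sum_(j <- s | P j) h j x) = \sum_(j <- s | P j) \int[mu]_x h j x.
Proof.
move=> ih; elim: s => [|j s ih'].
  by rewrite big_nil; under eq_Rintegral => x _ do rewrite big_nil; rewrite Rintegral_cst// mul0r.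
rewrite big_cons -ih'; under eq_Rintegral => x _ do rewrite big_cons.
case: (boolP (P j)) => // Pj.
by rewrite RintegralD//; [exact: ih|exact: rint_sum].
Qed.

Lemma Rintegral_ge0T u : (forall x, 0 <= u x) -> 0 <= \int[mu]_x u x.
Proof. by move=> u0; exact: Rintegral_ge0. Qed.

Lemma le_RintegralT u v : rint u -> rint v -> (forall x, u x <= v x) ->
  \int[mu]_x u x <= \int[mu]_x v x.
Proof. by move=> iu iv uv; exact: le_Rintegral. Qed.

(** Lebesgue measure is determined by its values on half-open intervals, and these are translation
    invariant. *)
Lemma lebesgue_measure_shift (a : R) (A : set R) : measurable A ->
  pushforward mu ((fun x => x - a) : _ -> measurableTypeR R) A = mu A.
Proof.
move=> mA; have ms : measurable_fun [set: R] ((fun x => x - a) : R -> R).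
  exact: measurable_funB.
apply/esym.
apply: lebesgue_measure_unique => //= _ [[b c]] _ <-.
rewrite /pushforward.
rewrite (_ : _ @^-1` _ = `]b + a, c + a]%classic); last first.
  by apply/seteqP; split=> x /=; rewrite !in_itv/= ltrBrDr lerBlDr.
by rewrite !lebesgue_measure_itv/= !lte_fin ltrD2r; case: ifP => // _; congr (_%:E); ring.
Qed.

Lemma ge0_integral_shift (a : R) (f : R -> \bar R) :
  measurable_fun [set: R] f -> (forall x, (0 <= f x)%E) ->
  (\int[mu]_x f (x - a)%R = \int[mu]_x f x)%E.
Proof.
move=> mf f0.
have ms : measurable_fun [set: R] ((fun x => x - a) : R -> R) by exact: measurable_funB.
transitivity (\int[pushforward mu ((fun x : R => x - a)%R : _ -> measurableTypeR R)]_y f y)%E.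
  by rewrite ge0_integral_pushforward//= => y _; exact: f0.
by apply: eq_measure_integral => //= A mA _; rewrite lebesgue_measure_shift.
Qed.

Lemma rint_shift (a : R) u : rint u -> rint (fun x => u (x - a)).
Proof.
move=> iu; have mu_ := rint_meas iu; apply/integrableP; split.
  by apply/measurable_EFinP; apply: (measurableT_comp mu_); exact: measurable_funB.
rewrite (@ge0_integral_shift a (fun x => `|(u x)%:E|%E))//.
- by case/integrableP : iu.
- by apply: measurableT_comp => //; apply/measurable_EFinP.
Qed.

Lemma Rintegral_shift (a : R) u : rint u -> \int[mu]_x u (x - a) = \int[mu]_x u x.
Proof.
move=> iu; have mu_ := rint_meas iu.
have ms : measurable_fun [set: R] ((fun x => x - a) : R -> R) by exact: measurable_funB.
rewrite /Rintegral; congr fine.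
transitivity (\int[pushforward mu ((fun x : R => x - a)%R : _ -> measurableTypeR R)]_y (u y)%:E)%E.
  rewrite integral_pushforward//=; first exact/measurable_EFinP.
  exact: rint_shift.
by apply: eq_measure_integral => //= A mA _; rewrite lebesgue_measure_shift.
Qed.

Lemma dominated_cvgR (u_ : nat -> R -> R) u g :
  (forall n, measurable_fun [set: R] (u_ n)) ->
  (forall x, u_ n x @[n --> \oo] --> u x) ->
  rint g -> (forall n x, `|u_ n x| <= g x) ->
  rint u /\ \int[mu]_x u_ n x @[n --> \oo] --> \int[mu]_x u x.
Proof.
move=> mu_ cu ig ug.
have mu' : measurable_fun [set: R] u by apply: (measurable_fun_cvg mu_) => x _; exact: cu.
have [] := @dominated_convergence _ _ _ mu setT measurableT (fun n => EFin \o u_ n) (EFin \o u) (EFin \o g).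
- by move=> n; apply/measurable_EFinP; exact: mu_.
- by apply/measurable_EFinP; exact: mu'.
- by apply/aeW => x _; apply/cvg_EFin; [apply/nearW|exact: cu].
- exact: ig.
- by apply/aeW => x n _ /=; rewrite lee_fin.
move=> iu _ h; split=> //.
have iu_ n : rint (u_ n) by apply: rint_le ig.
apply: fine_cvg; rewrite -rint_fin//.
Qed.

End real_integrals.

Section L2_theory.
Context {R : realType}.
Notation mu := (@lebesgue_measure R).
Implicit Types f g h : R -> R[i].

Definition cmeas f := measurable_fun [set: R] (fun t => complex.Re (f t)) /\
  measurable_fun [set: R] (fun t => complex.Im (f t)).

Definition cintble f := rint (fun t => complex.Re (f t)) /\ rint (fun t => complex.Im (f t)).

Definition cint f : R[i] :=
  ((\int[mu]_t complex.Re (f t)) +i* (\int[mu]_t complex.Im (f t)))%C.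

Definition nrm2 f : R := \int[mu]_t cabs2 (f t).

Lemma cmeas_cabs2 f : cmeas f -> measurable_fun [set: R] (fun t => cabs2 (f t)).
Proof. by case=> mr mi; apply: measurable_funD; apply: measurable_funX. Qed.

Lemma cmeas_cst (c : R[i]) : cmeas (fun=> c).
Proof. by split; exact: measurable_cst. Qed.

Lemma cmeasD f g : cmeas f -> cmeas g -> cmeas (fun t => f t + g t).
Proof.
move=> [fr fi] [gr gi]; split.
- by under eq_fun => t do rewrite ReD; apply: measurable_funD.
- by under eq_fun => t do rewrite ImD; apply: measurable_funD.
Qed.

Lemma cmeasM f g : cmeas f -> cmeas g -> cmeas (fun t => f t * g t).
Proof.
move=> [fr fi] [gr gi]; split.
- by under eq_fun => t do rewrite ReM; apply: measurable_funB; apply: measurable_funM.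
- by under eq_fun => t do rewrite ImM; apply: measurable_funD; apply: measurable_funM.
Qed.

Lemma cmeas_conj f : cmeas f -> cmeas (fun t => (f t)^*).
Proof.
move=> [fr fi]; split.
- by under eq_fun => t do rewrite Re_conj.
- by under eq_fun => t do rewrite Im_conj; apply: measurable_funN.
Qed.

Lemma cmeas_comp f (p : R -> R) : measurable_fun [set: R] p -> cmeas f -> cmeas (fun t => f (p t)).
Proof.
by move=> mp [fr fi]; split; [exact: (measurableT_comp fr mp)|exact: (measurableT_comp fi mp)].
Qed.

Lemma cmeas_real (u : R -> R) : measurable_fun [set: R] u -> cmeas (fun t => (u t)%:C%C).
Proof. by move=> mu_; split=> //=; exact: measurable_cst. Qed.

Lemma cmeas_cexpi (u : R -> R) : measurable_fun [set: R] u -> cmeas (fun t => cexpi (u t)).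
Proof.
move=> mu_; split=> /=.
- by apply: measurableT_comp mu_; apply: continuous_measurable_fun => x; exact: continuous_cos.
- by apply: measurableT_comp mu_; apply: continuous_measurable_fun => x; exact: continuous_sin.
Qed.

Lemma cmeas_indic (A : set R) : measurable A -> cmeas (fun t => (\1_A t)%:C%C).
Proof. by move=> mA; apply: cmeas_real; exact: measurable_indic. Qed.

Lemma L2P f : L2 f <-> cmeas f /\ rint (fun t => cabs2 (f t)).
Proof.
split=> [[fr [fi fl]]|[[fr fi] /integrableP[_]]].
  have mf : cmeas f by [].
  by split=> //; apply: rint_ltP => //; [exact: cmeas_cabs2|move=> t; exact: cabs2_ge0].
move=> h; split=> //; split=> //; apply: le_lt_trans h.
by under [X in (_ <= X)%E]eq_integral => x _ do rewrite /= ger0_norm ?cabs2_ge0//.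
Qed.

Lemma L2_meas f : L2 f -> cmeas f. Proof. by case/L2P. Qed.
Lemma L2_rint f : L2 f -> rint (fun t => cabs2 (f t)). Proof. by case/L2P. Qed.

Lemma L2norm2E f : L2 f -> L2norm2 f = (nrm2 f)%:E.
Proof. by move=> /L2_rint /rint_fin. Qed.

Lemma nrm2_ge0 f : 0 <= nrm2 f.
Proof. by apply: Rintegral_ge0T => x; exact: cabs2_ge0. Qed.

Lemma L2_le f (v : R -> R) : cmeas f -> (forall t, cabs2 (f t) <= v t) -> rint v -> L2 f.
Proof.
move=> mf fv iv; apply/L2P; split=> //; apply: rint_le iv; first exact: cmeas_cabs2.
by move=> x; rewrite ger0_norm ?cabs2_ge0.
Qed.

Lemma L2D f g : L2 f -> L2 g -> L2 (fun t => f t + g t).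
Proof.
move=> /L2P[mf lf] /L2P[mg lg].
apply: (@L2_le _ (fun t => 2 * cabs2 (f t) + 2 * cabs2 (g t))); first exact: cmeasD.
  by move=> t; exact: cabs2D_le.
by apply: rintD; apply: rintZ.
Qed.

Lemma L2_bddM f (m : R -> R[i]) (C : R) : cmeas m -> (forall t, cabs2 (m t) <= C) ->
  L2 f -> L2 (fun t => m t * f t).
Proof.
move=> mm mC /L2P[mf lf].
apply: (@L2_le _ (fun t => C * cabs2 (f t))); first exact: cmeasM.
  by move=> t; rewrite cabs2M ler_wpM2r// cabs2_ge0.
exact: rintZ.
Qed.

Lemma L2Z f (c : R[i]) : L2 f -> L2 (fun t => c * f t).
Proof. by apply: (@L2_bddM _ _ (cabs2 c)) => //; exact: cmeas_cst. Qed.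

Lemma L2N f : L2 f -> L2 (fun t => - f t).
Proof. by move=> /(@L2Z _ (-1)); under eq_fun => t do rewrite mulN1r. Qed.

Lemma L2B f g : L2 f -> L2 g -> L2 (fun t => f t - g t).
Proof. by move=> lf lg; apply: L2D => //; exact: L2N. Qed.

Lemma L2_0 : L2 (fun=> 0 : R[i]).
Proof.
apply/L2P; split; first exact: cmeas_cst.
by under [X in rint X]eq_fun => t do rewrite cabs2_0; exact: rint0.
Qed.

Lemma L2_sum (J : Type) (s : seq J) (P : pred J) (F : J -> R -> R[i]) :
  (forall j, P j -> L2 (F j)) -> L2 (fun t => \sum_(j <- s | P j) F j t).
Proof.
move=> lF; elim: s => [|j s ih].
  by under eq_fun => t do rewrite big_nil; exact: L2_0.
under eq_fun => t do rewrite big_cons.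
by case: (boolP (P j)) => // Pj; apply: L2D => //; exact: lF.
Qed.

Lemma L2_shift f (a : R) : L2 f -> L2 (fun t => f (t - a)).
Proof.
move=> /L2P[mf lf]; apply/L2P; split; last exact: (rint_shift a lf).
by apply: cmeas_comp => //; exact: measurable_funB.
Qed.

Lemma L2_indic f (A : set R) : measurable A -> L2 f -> L2 (fun t => (\1_A t)%:C%C * f t).
Proof.
move=> mA; apply: (@L2_bddM _ _ 1); first exact: cmeas_indic.
by move=> t; rewrite cabs2_real indicE; case: (_ \in _); rewrite ?expr1n ?expr0n.
Qed.

Lemma cintbleM f g : L2 f -> L2 g -> cintble (fun t => f t * (g t)^*).
Proof.
move=> /L2P[mf lf] /L2P[mg lg].
have [mr mi] := cmeasM mf (cmeas_conj mg).
have bnd := rintD lf lg.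
(* The right-hand side becomes |f|^2 + |g|^2, which thus dominates both the real and the imaginary
   part of f conj(g). *)
have h a b c d : `|a * b| + `|c * d| <= (a ^+ 2 + c ^+ 2) + (b ^+ 2 + d ^+ 2) :> R.
  have : (`|a| - `|b|) ^+ 2 >= 0 by exact: sqr_ge0.
  have : (`|c| - `|d|) ^+ 2 >= 0 by exact: sqr_ge0.
  rewrite !sqrrB !real_normK ?num_real// !normrM.
  have := sqr_ge0 a; have := sqr_ge0 b; have := sqr_ge0 c; have := sqr_ge0 d.
  by move: (`|a| * `|b|) (`|c| * `|d|) => x y; lra.
split; apply: (rint_le _ _ bnd) => // x; rewrite !ReIm /cabs2.
- by rewrite mulrN opprK (le_trans (ler_normD _ _)).
- rewrite mulrN addrC (le_trans (ler_normB _ _))// addrC.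
  by apply: le_trans (h _ _ _ _) _; rewrite lerD2l addrC.
Qed.

Lemma L2innerE f g : L2inner f g = cint (fun t => f t * (g t)^*).
Proof. by []. Qed.

Lemma cintD f g : cintble f -> cintble g -> cint (fun t => f t + g t) = cint f + cint g.
Proof.
move=> [fr fi] [gr gi]; apply: eqCP; rewrite ?ReIm /cint /=.
- by rewrite -RintegralD//; apply: eq_Rintegral => x _; rewrite ReD.
- by rewrite -RintegralD//; apply: eq_Rintegral => x _; rewrite ImD.
Qed.

Lemma cintbleZ f (c : R[i]) : cintble f -> cintble (fun t => c * f t).
Proof.
move=> [fr fi]; split.
- by under [X in rint X]eq_fun => t do rewrite ReM; apply: rintB; exact: rintZ.
- by under [X in rint X]eq_fun => t do rewrite ImM; apply: rintD; exact: rintZ.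
Qed.

Lemma cintZ f (c : R[i]) : cintble f -> cint (fun t => c * f t) = c * cint f.
Proof.
move=> [fr fi]; apply: eqCP; rewrite ?ReIm /cint /=.
- rewrite -!RintegralZl// -RintegralB//; try exact: rintZ.
  by apply: eq_Rintegral => x _; rewrite ReM.
- rewrite -!RintegralZl// -RintegralD//; try exact: rintZ.
  by apply: eq_Rintegral => x _; rewrite ImM.
Qed.

Lemma cint_conj f : cintble f -> cint (fun t => (f t)^*) = (cint f)^*.
Proof.
move=> [fr fi]; apply: eqCP; rewrite ?ReIm /cint /=.
- by apply: eq_Rintegral => x _; rewrite Re_conj.
- by rewrite -mulN1r -RintegralZl//; apply: eq_Rintegral => x _; rewrite Im_conj mulN1r.
Qed.

Lemma eq_cint f g : f =1 g -> cint f = cint g.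
Proof. by move=> /funext ->. Qed.

Lemma cint_shift f (a : R) : cintble f -> cint (fun t => f (t - a)) = cint f.
Proof.
move=> [fr fi]; apply: eqCP; rewrite /cint /=.
- exact: (Rintegral_shift a fr).
- exact: (Rintegral_shift a fi).
Qed.

Lemma ipDl f g h : L2 f -> L2 g -> L2 h ->
  L2inner (fun t => f t + g t) h = L2inner f h + L2inner g h.
Proof.
move=> lf lg lh; rewrite !L2innerE -cintD; try exact: cintbleM.
by apply: eq_cint => t; rewrite mulrDl.
Qed.

Lemma ipZl f h (c : R[i]) : L2 f -> L2 h -> L2inner (fun t => c * f t) h = c * L2inner f h.
Proof.
move=> lf lh; rewrite !L2innerE -cintZ; last exact: cintbleM.
by apply: eq_cint => t; rewrite mulrA.
Qed.

Lemma ipC f h : L2 f -> L2 h -> L2inner h f = (L2inner f h)^*.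
Proof.
move=> lf lh; rewrite !L2innerE -cint_conj; last exact: cintbleM.
by apply: eq_cint => t; rewrite rmorphM /= conjCK mulrC.
Qed.

Lemma ipDr f g h : L2 f -> L2 g -> L2 h ->
  L2inner h (fun t => f t + g t) = L2inner h f + L2inner h g.
Proof.
move=> lf lg lh; rewrite ipC; [|exact: L2D|exact: lh].
by rewrite ipDl// rmorphD /= -(ipC lf lh) -(ipC lg lh).
Qed.

Lemma ipZr f h (c : R[i]) : L2 f -> L2 h -> L2inner h (fun t => c * f t) = c^* * L2inner h f.
Proof.
move=> lf lh; rewrite ipC; [|exact: L2Z|exact: lh].
by rewrite ipZl// rmorphM /= -(ipC lf lh).
Qed.

Lemma ip0l h : L2inner (fun=> 0) h = 0.
Proof.
rewrite L2innerE /cint; under eq_Rintegral => t _ do rewrite mul0r /=.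
under [X in (_ +i* X)%C]eq_Rintegral => t _ do rewrite mul0r /=.
by rewrite Rintegral_cst// mul0r.
Qed.

Lemma ip_suml (J : Type) (s : seq J) (P : pred J) (F : J -> R -> R[i]) h :
  (forall j, P j -> L2 (F j)) -> L2 h ->
  L2inner (fun t => \sum_(j <- s | P j) F j t) h = \sum_(j <- s | P j) L2inner (F j) h.
Proof.
move=> lF lh; elim: s => [|j s ih].
  by rewrite big_nil; under [X in L2inner X]eq_fun => t do rewrite big_nil; exact: ip0l.
rewrite big_cons -ih; under [X in L2inner X]eq_fun => t do rewrite big_cons.
case: (boolP (P j)) => // Pj.
by rewrite ipDl//; [exact: lF|exact: L2_sum].
Qed.

Lemma ip_sumr (J : Type) (s : seq J) (P : pred J) (F : J -> R -> R[i]) h :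
  (forall j, P j -> L2 (F j)) -> L2 h ->
  L2inner h (fun t => \sum_(j <- s | P j) F j t) = \sum_(j <- s | P j) L2inner h (F j).
Proof.
move=> lF lh; rewrite ipC ?ip_suml//; last exact: L2_sum.
by rewrite rmorph_sum; apply: eq_bigr => j Pj; rewrite (ipC (lF _ Pj) lh).
Qed.

Lemma ipff f : L2 f -> L2inner f f = (nrm2 f)%:C%C.
Proof.
move=> lf; apply: eqCP; rewrite /L2inner /=.
- by apply: eq_Rintegral => t _; rewrite mul_conjE.
- rewrite -[RHS](mul0r (fine (mu setT))) -Rintegral_cst//.
  by apply: eq_Rintegral => t _; rewrite mul_conjE.
Qed.

Lemma nrm2D f g : L2 f -> L2 g ->
  nrm2 (fun t => f t + g t) = nrm2 f + 2 * complex.Re (L2inner f g) + nrm2 g.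
Proof.
move=> lf lg; have [ir _] := cintbleM lf lg.
have lf' := L2_rint lf; have lg' := L2_rint lg.
rewrite /nrm2 /= -RintegralZl// -RintegralD//; last exact: rintZ.
rewrite -RintegralD//; last by apply: rintD => //; exact: rintZ.
by apply: eq_Rintegral => t _; rewrite cabs2D.
Qed.

Lemma nrm2Z f (c : R[i]) : L2 f -> nrm2 (fun t => c * f t) = cabs2 c * nrm2 f.
Proof.
move=> lf; rewrite /nrm2 -RintegralZl//; last exact: L2_rint.
by apply: eq_Rintegral => t _; rewrite cabs2M.
Qed.

Lemma nrm2N f : nrm2 (fun t => - f t) = nrm2 f.
Proof. by apply: eq_Rintegral => t _; rewrite cabs2N. Qed.

Lemma ipNr f g : L2 f -> L2 g -> L2inner f (fun t => - g t) = - L2inner f g.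
Proof.
move=> lf lg; under [X in L2inner f X]eq_fun => t do rewrite -mulN1r.
by rewrite ipZr// rmorphN1 mulN1r.
Qed.

Lemma nrm2B f g : L2 f -> L2 g ->
  nrm2 (fun t => f t - g t) = nrm2 f - 2 * complex.Re (L2inner f g) + nrm2 g.
Proof.
move=> lf lg; rewrite nrm2D//; last exact: L2N.
by rewrite nrm2N ipNr// ReN mulrN.
Qed.

Lemma nrm2D_le f g : L2 f -> L2 g -> nrm2 (fun t => f t + g t) <= 2 * nrm2 f + 2 * nrm2 g.
Proof.
move=> lf lg; rewrite /nrm2 -!RintegralZl//; try exact: L2_rint.
rewrite -RintegralD//; try by apply: rintZ; exact: L2_rint.
apply: le_RintegralT; [exact/L2_rint/L2D| |by move=> t; exact: cabs2D_le].
by apply: rintD; apply: rintZ; exact: L2_rint.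
Qed.

Lemma cauchy_schwarz f g : L2 f -> L2 g -> cabs2 (L2inner f g) <= nrm2 f * nrm2 g.
Proof.
move=> lf lg; set z := L2inner f g.
(* Subtracting s z g with s real and z = (f, g) makes the cross term the real number s |z|^2. *)
have H (s : R) : 0 <= nrm2 f - 2 * (s * cabs2 z) + s ^+ 2 * cabs2 z * nrm2 g.
  have := nrm2_ge0 (fun t => f t - (s%:C%C * z) * g t).
  rewrite nrm2B//; last exact: L2Z.
  rewrite ipZr// nrm2Z// cabs2M cabs2_real -/z.
  suff -> : complex.Re ((s%:C%C * z)^* * z) = s * cabs2 z by [].
  by rewrite !ReIm /cabs2 /=; ring.
have g0 := nrm2_ge0 g; have z0 := cabs2_ge0 z; have f0 := nrm2_ge0 f.
have [g1|g1] := ltrP 0 (nrm2 g).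
  have := H (nrm2 g)^-1.
  rewrite (_ : _ + _ = nrm2 f - cabs2 z / nrm2 g); last first.
    by field; rewrite gt_eqF.
  by rewrite subr_ge0 ler_pdivrMr.
have -> : nrm2 g = 0 by apply/le_anti; rewrite g1 g0.
have {}H s : 0 <= nrm2 f - 2 * (s * cabs2 z).
  have := H s; suff -> : nrm2 g = 0 by rewrite mulr0 addr0.
  by apply/le_anti; rewrite g1 g0.
rewrite mulr0; have [//|z1] := lerP (cabs2 z) 0.
(* For ||g|| = 0 the inequality is affine in s, and this s would turn it into ||f||^2 - 2 (||f||^2 +
   1) >= 0. *)
have := H ((nrm2 f + 1) / cabs2 z).
by rewrite mulfVK ?gt_eqF//; lra.
Qed.

End L2_theory.

Section exponential_integral.
Context {R : realType}.
Notation mu := (@lebesgue_measure R).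

(** Half-open intervals are chosen so that translates tile the line without overlap, see
    [itv1_tile]. *)
Definition itv1 (p q : R) : R -> R := \1_(`[p, q[%classic).

Lemma itv1E (p q t : R) : itv1 p q t = ((p <= t) && (t < q))%:R.
Proof.
rewrite /itv1 indicE; congr ((nat_of_bool _)%:R); apply/idP/idP => [/set_mem /=|h].
  by rewrite in_itv.
by apply/mem_set; rewrite /= in_itv.
Qed.

Lemma itv1_in (p q t : R) : p <= t < q -> itv1 p q t = 1.
Proof. by rewrite itv1E => ->. Qed.

Lemma itv1_out (p q t : R) : ~~ (p <= t < q) -> itv1 p q t = 0.
Proof. by rewrite itv1E => /negbTE ->. Qed.

Lemma measurable_itv1 (p q : R) : measurable_fun [set: R] (itv1 p q).
Proof. exact: measurable_indic (measurable_itv _). Qed.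

Lemma rint_itv1 (p q : R) : rint (itv1 p q).
Proof. exact: (integrable_indic_itv p q true true). Qed.

Lemma Rintegral_itv1 (p q : R) : p <= q -> \int[mu]_t itv1 p q t = q - p.
Proof.
move=> pq; rewrite /Rintegral integral_indic//.
rewrite setIT; change (fine (mu `[p, q[%classic) = q - p); rewrite lebesgue_measure_itv/= lte_fin.
case: ifPn => [_|]; first by rewrite -EFinB.
by rewrite -leNgt => qp; have -> : p = q by [apply/le_anti; rewrite pq qp]; rewrite subrr.
Qed.

Lemma Rintegral_FTC (F f : R -> R) (p q : R) : p < q ->
  continuous f -> (forall t : R, is_derive t (1:R) F (f t)) ->
  \int[mu]_t (itv1 p q t * f t) = F q - F p.
Proof.
move=> pq cf dF.
have : (\int[mu]_(x in `[p, q]) (f x)%:E = (F q)%:E - (F p)%:E)%E.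
  apply: continuous_FTC2 => //; first exact: continuous_subspaceT.
    have cF : continuous F.
      by move=> x; apply: differentiable_continuous; apply/derivable1_diffP; have [] := dF x.
    split; first by move=> x _; have [] := dF x.
    - exact/cvg_at_right_filter/cF.
    - exact/cvg_at_left_filter/cF.
  by move=> x _; rewrite derive1E; exact: derive_val.
rewrite -EFinB => h.
have -> : \int[mu]_t (itv1 p q t * f t) = \int[mu]_(t in `[p, q[) f t.
  rewrite [RHS]Rintegral_mkcond; apply: eq_Rintegral => t _.
  rewrite patchE /itv1 indicE; case: ifP => _; rewrite ?mul1r ?mul0r//.
rewrite Rintegral_itv_bndo_bndc /Rintegral ?h//.
have : mu.-integrable `[p, q] (EFin \o f).
  apply: continuous_compact_integrable; first exact: segment_compact.
  exact: continuous_subspaceT.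
apply: integrableS => //.
by move=> x /=; rewrite !in_itv/= => /andP[-> /ltW].
Qed.

Lemma rint_itv1_continuous (p q : R) (f : R -> R) :
  continuous f -> rint (fun t => itv1 p q t * f t).
Proof.
move=> cf.
have : mu.-integrable `[p, q] (EFin \o f).
  apply: continuous_compact_integrable; first exact: segment_compact.
  exact: continuous_subspaceT.
move=> /integrable_mkcond - /(_ (measurable_itv _)) h.
apply: (rint_le (v := fun t => `|(f \_ `[p, q]) t|)).
- apply: measurable_funM; first exact: measurable_itv1.
  exact: continuous_measurable_fun.
- move=> t; rewrite patchE itv1E.
  case: (boolP (t \in _)) => [_|].
    by rewrite normrM ler_piMl// ger0_norm// lern1 leq_b1.
  move/negP => h'; case: (boolP (_ && _)) => [/andP[pt tq]|]; last by rewrite mul0r.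
  by exfalso; apply: h'; apply/mem_set; rewrite /= in_itv /= pt ltW.
- apply: (@integrable_norm _ _ _ mu setT (f \_ `[p, q])).
  by move: h; rewrite /rint; congr (_.-integrable _ _); apply/funext => t; rewrite /= !patchE; case: ifP.
Qed.

(* [cint] of [e^{(r + i s) t}] over an interval, multiplied by [r + i s] to avoid dividing *)
Lemma cint_expi (r s p q : R) : p < q ->
  (r +i* s)%C * cint (fun t => ((itv1 p q t * expR (r * t))%:C * cexpi (s * t))%C) =
  (expR (r * q))%:C%C * cexpi (s * q) - (expR (r * p))%:C%C * cexpi (s * p).
Proof.
move=> pq.
pose C t := expR (r * t) * cos (s * t); pose S t := expR (r * t) * sin (s * t).
have dC (t : R) : is_derive t (1:R) C (r * C t - s * S t).
  rewrite /C; apply: is_derive_eq; rewrite /S /GRing.scale /=; ring.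
have dS (t : R) : is_derive t (1:R) S (s * C t + r * S t).
  rewrite /S; apply: is_derive_eq; rewrite /C /GRing.scale /=; ring.
have cC : continuous C.
  by move=> x; apply: differentiable_continuous; apply/derivable1_diffP; have [] := dC x.
have cS : continuous S.
  by move=> x; apply: differentiable_continuous; apply/derivable1_diffP; have [] := dS x.
have cdC : continuous (fun t => r * C t - s * S t).
  by move=> x; apply: cvgB; apply: cvgM; [exact: cvg_cst|exact: cC|exact: cvg_cst|exact: cS].
have cdS : continuous (fun t => s * C t + r * S t).
  by move=> x; apply: cvgD; apply: cvgM; [exact: cvg_cst|exact: cC|exact: cvg_cst|exact: cS].
have iC := rint_itv1_continuous p q cC; have iS := rint_itv1_continuous p q cS.
have -> : cint (fun t => ((itv1 p q t * expR (r * t))%:C * cexpi (s * t))%C) =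
    ((\int[mu]_t (itv1 p q t * C t)) +i* (\int[mu]_t (itv1 p q t * S t)))%C.
  apply: eqCP; rewrite /cint /=; apply: eq_Rintegral => t _; rewrite /C /S /=; ring.
apply: eqCP; rewrite !ReIm /= ?mul0r ?subr0 ?addr0.
- rewrite -[RHS]/(C q - C p) -(Rintegral_FTC pq cdC dC) -!RintegralZl// -?RintegralB//; try exact: rintZ.
  by apply: eq_Rintegral => t _; ring.
- rewrite -[RHS]/(S q - S p) -(Rintegral_FTC pq cdS dS) -!RintegralZl// -?RintegralD//; try exact: rintZ.
  by apply: eq_Rintegral => t _; ring.
Qed.

End exponential_integral.

(** * Fourier series and the Plancherel theorem *)

Section fourier_series.
Context {R : realType}.
Notation mu := (@lebesgue_measure R).
Variables (a T : R).
Hypothesis T_gt0 : 0 < T.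

(** Exponentials of period T cut off to the single period [a, a + T). They are orthogonal but not
    normalised: the squared norm is T, the source of the factors T and T^-1 below. Since the
    indicator is idempotent, products stay in the system ([emM]). *)
Definition em (n : int) (t : R) : R[i] :=
  ((itv1 a (a + T) t)%:C * cexpi (2 * pi * (n%:~R / T) * t))%C.

Lemma cmeas_em n : cmeas (em n).
Proof.
apply: cmeasM; first by apply: cmeas_real; exact: measurable_itv1.
apply: cmeas_cexpi; apply: measurable_funM; [exact: measurable_cst|exact: measurable_id].
Qed.

Lemma itv1_sqr (p q t : R) : itv1 p q t * itv1 p q t = itv1 p q t.
Proof. by rewrite itv1E; case: (_ && _); rewrite ?mulr1 ?mulr0. Qed.

Lemma cabs2_itv1 (p q t : R) : cabs2 (itv1 p q t)%:C%C = itv1 p q t.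
Proof. by rewrite cabs2_real expr2 itv1_sqr. Qed.

Lemma cabs2_em n t : cabs2 (em n t) = itv1 a (a + T) t.
Proof. by rewrite cabs2M cabs2_cexpi mulr1 cabs2_itv1. Qed.

Lemma L2_em n : L2 (em n).
Proof.
apply: (L2_le (cmeas_em n) (v := itv1 a (a + T))); last exact: rint_itv1.
by move=> t; rewrite cabs2_em.
Qed.

Lemma emM n m t : em n t * em m t = em (n + m) t.
Proof.
rewrite /em mulrACA -rmorphM /= itv1_sqr -cexpiD; congr (_ * cexpi _).
by rewrite intrD; ring.
Qed.

Lemma em_conj n t : (em n t)^* = em (- n) t.
Proof.
rewrite /em rmorphM /= cexpi_conj; congr (_ * cexpi _); last by rewrite mulrNz; ring.
by apply: eqCP; rewrite ReIm //= oppr0.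
Qed.

Lemma cint_em n : cint (em n) = (if n == 0 then T else 0)%:C%C.
Proof.
case: eqP => [->|/eqP n0].
  apply: eqCP; rewrite /cint /=.
  - transitivity (\int[mu]_t itv1 a (a + T) t).
      by apply: eq_Rintegral => t _; rewrite mul0r mulr0 mul0r cos0 sin0; ring.
    by rewrite Rintegral_itv1 ?lerDl ?ltW//= addrC addKr.
  - rewrite -[RHS](mul0r (fine (mu setT))) -Rintegral_cst//.
    by apply: eq_Rintegral => t _; rewrite mul0r mulr0 mul0r cos0 sin0; ring.
have lt : a < a + T by rewrite ltrDl.
have := cint_expi 0 (2 * pi * (n%:~R / T)) lt.
rewrite !mul0r expR0 !mul1r.
have -> : 2 * pi * (n%:~R / T) * (a + T) = 2 * pi * (n%:~R / T) * a + 2 * pi * n%:~R :> R.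
  by field; rewrite gt_eqF.
rewrite cexpi_period subrr => /eqP; rewrite mulf_eq0 => /orP[|/eqP h].
  rewrite eq_complex /= eqxx /= (_ : (_ == 0) = false)//; apply/negbTE.
  by rewrite !mulf_neq0// ?invr_neq0 ?intr_eq0// ?(gt_eqF (pi_gt0 R)) ?(gt_eqF T_gt0) ?pnatr_eq0//.
rewrite -[RHS]h; apply: eq_cint => t.
by rewrite mul0r expR0 mulr1.
Qed.

Lemma ip_em n m : L2inner (em n) (em m) = (if n == m then T else 0)%:C%C.
Proof.
rewrite -subr_eq0 -cint_em L2innerE; apply: eq_cint => t.
by rewrite em_conj emM.
Qed.

(** Trigonometric polynomials are lists of pairs (frequency, coefficient) in which frequencies may
    repeat, so that sums and products are list operations. [tp_uniq] collects equal frequencies when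
    orthogonality is needed. *)
Definition tp (l : seq (int * R[i])) (t : R) : R[i] := \sum_(x <- l) x.2 * em x.1 t.

Lemma L2_tp l : L2 (tp l).
Proof. by apply: L2_sum => x _; apply: L2Z; exact: L2_em. Qed.

Lemma tp_cat l1 l2 t : tp (l1 ++ l2) t = tp l1 t + tp l2 t.
Proof. by rewrite /tp big_cat. Qed.

Definition tp_scale (c : R[i]) (l : seq (int * R[i])) := [seq (x.1, c * x.2) | x <- l].

Lemma tp_scaleE c l t : tp (tp_scale c l) t = c * tp l t.
Proof. by rewrite /tp big_map mulr_sumr; apply: eq_bigr => x _; rewrite mulrA. Qed.

Definition tp_mul (l1 l2 : seq (int * R[i])) := [seq (x.1 + y.1, x.2 * y.2) | x <- l1, y <- l2].

Lemma tp_mulE l1 l2 t : tp (tp_mul l1 l2) t = tp l1 t * tp l2 t.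
Proof.
rewrite /tp big_allpairs_dep mulr_suml; apply: eq_bigr => x _.
rewrite mulr_sumr; apply: eq_bigr => y _ /=.
by rewrite -emM; ring.
Qed.

Definition tp1 := [:: (0 : int, 1 : R[i])].

Lemma tp1E t : tp tp1 t = (itv1 a (a + T) t)%:C%C.
Proof. by rewrite /tp big_seq1 mul1r /em mul0r mulr0 mul0r cexpi0 mulr1. Qed.

Definition tp_exp l k := iter k (tp_mul l) tp1.

Lemma tp_expE l k t : tp (tp_exp l k) t = (itv1 a (a + T) t)%:C%C * tp l t ^+ k.
Proof.
elim: k => [|k ih]; first by rewrite expr0 mulr1 /= tp1E.
by rewrite /= tp_mulE ih exprS; ring.
Qed.

(* best approximation: the defect of Bessel's inequality is a distance *)
Lemma bessel_defect f (c : int -> R[i]) (s : seq int) : L2 f -> uniq s ->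
  nrm2 (fun t => f t - \sum_(n <- s) c n * em n t) =
  nrm2 f - T^-1 * (\sum_(n <- s) cabs2 (L2inner f (em n)))
    + T * \sum_(n <- s) cabs2 (c n - T^-1%:C%C * L2inner f (em n)).
Proof.
move=> lf us.
have lc n : L2 (fun t => c n * em n t) by apply: L2Z; exact: L2_em.
have ls : L2 (fun t => \sum_(n <- s) c n * em n t) by apply: L2_sum => n _; exact: lc.
rewrite nrm2B//.
have -> : complex.Re (L2inner f (fun t => \sum_(n <- s) c n * em n t)) =
    \sum_(n <- s) complex.Re ((c n)^* * L2inner f (em n)).
  rewrite ip_sumr// Re_sum; apply: eq_bigr => n _.
  by rewrite ipZr//; exact: L2_em.
have -> : nrm2 (fun t => \sum_(n <- s) c n * em n t) = \sum_(n <- s) T * cabs2 (c n).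
  have := ipff ls; rewrite ip_suml// => /(congr1 (@complex.Re R)) /= <-.
  rewrite Re_sum big_seq [RHS]big_seq; apply: eq_bigr => n ns.
  rewrite ip_sumr// (bigD1_seq n)//= big1 ?addr0 => [|m mn].
    rewrite ipZr ?ipZl//; try exact: L2_em.
    by rewrite ip_em eqxx !ReIm /cabs2 /=; ring.
  rewrite ipZr ?ipZl//; try exact: L2_em.
  by rewrite ip_em eq_sym (negbTE mn) /= mulr0 mulr0.
rewrite -addrA -[RHS]addrA; congr (_ + _).
rewrite !mulr_sumr -!sumrN -!big_split /=; apply: eq_bigr => n _.
rewrite /cabs2 !ReIm /=.
by field; rewrite gt_eqF.
Qed.

Lemma bessel f (s : seq int) : L2 f -> uniq s ->
  \sum_(n <- s) cabs2 (L2inner f (em n)) <= T * nrm2 f.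
Proof.
move=> lf us.
have := nrm2_ge0 (fun t => f t - \sum_(n <- s) (T^-1%:C%C * L2inner f (em n)) * em n t).
rewrite bessel_defect// [X in _ + T * X]big1 => [|n _]; last by rewrite subrr cabs2_0.
by rewrite mulr0 addr0 subr_ge0 ler_pdivrMl.
Qed.

(** Membership in the L^2 closure of the trigonometric polynomials. Completeness of the exponentials
    on one period is [apx_L2]. *)
Definition apx (f : R -> R[i]) := L2 f /\
  forall e, 0 < e -> exists l, nrm2 (fun t => f t - tp l t) < e.

Lemma tp_uniq l : exists s c, uniq s /\ (forall t, tp l t = \sum_(n <- s) c n * em n t).
Proof.
exists (undup (map fst l)), (fun n => \sum_(x <- l | x.1 == n) x.2); split; first exact: undup_uniq.
move=> t; under eq_bigr => n _ do rewrite mulr_suml.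
rewrite (exchange_big_dep xpredT)//= /tp big_seq [RHS]big_seq; apply: eq_bigr => x xl.
rewrite -big_filter (perm_big [:: x.1]) ?big_seq1//.
apply: uniq_perm => //; first by rewrite filter_uniq// undup_uniq.
move=> n; rewrite mem_filter mem_undup inE eq_sym; case: eqP => // ->.
by apply/mapP; exists x.
Qed.

(** By [bessel_defect], the squared distance from f to any polynomial with frequencies in s is at
    least the defect in Bessel's inequality over s; a good approximation therefore makes the defect
    small. *)
Lemma apx_parseval f e : apx f -> 0 < e ->
  exists2 s, uniq s & T * nrm2 f <= \sum_(n <- s) cabs2 (L2inner f (em n)) + e.
Proof.
move=> [lf af] e0; have [|l hl] := af (T^-1 * e); first by rewrite mulr_gt0 ?invr_gt0.
have [s [c [us tE]]] := tp_uniq l; exists s => //.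
move: hl; under [X in nrm2 X]eq_fun => t do rewrite tE.
rewrite bessel_defect// => hl.
have c0 : 0 <= \sum_(n <- s) cabs2 (c n - T^-1%:C%C * L2inner f (em n)).
  by apply: sumr_ge0 => n _; exact: cabs2_ge0.
rewrite -ler_pdivlMl// mulrDr -lerBlDl; apply/ltW/le_lt_trans/hl.
by rewrite lerDl mulr_ge0// ltW.
Qed.

Lemma apx_close f : L2 f ->
  (forall e, 0 < e -> exists2 h, apx h & nrm2 (fun t => f t - h t) < e) -> apx f.
Proof.
move=> lf H; split=> // e e0; have [|h [lh ah] fh] := H (e / 4); first by rewrite divr_gt0.
have [|l hl] := ah (e / 4); first by rewrite divr_gt0.
exists l; have -> : (fun t => f t - tp l t) = (fun t => (f t - h t) + (h t - tp l t)).
  by apply/funext => t; ring.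
apply: le_lt_trans (nrm2D_le _ _) _; [exact: L2B|by apply: L2B => //; exact: L2_tp|lra].
Qed.

Lemma apx_tp l : apx (tp l).
Proof.
split=> [|e e0]; first exact: L2_tp.
exists l; rewrite (_ : (fun t => _) = (fun=> 0)); last by apply/funext => t; rewrite subrr.
by rewrite /nrm2 Rintegral_cst// cabs2_0 mul0r.
Qed.

Lemma apxD f g : apx f -> apx g -> apx (fun t => f t + g t).
Proof.
move=> [lf af] [lg ag]; split=> [|e e0]; first exact: L2D.
have [|l hl] := af (e / 4); first by rewrite divr_gt0.
have [|k hk] := ag (e / 4); first by rewrite divr_gt0.
exists (l ++ k).
have -> : (fun t => f t + g t - tp (l ++ k) t) = (fun t => (f t - tp l t) + (g t - tp k t)).
  by apply/funext => t; rewrite tp_cat; ring.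
apply: le_lt_trans (nrm2D_le _ _) _; [| |lra]; by apply: L2B => //; exact: L2_tp.
Qed.

Lemma apxZ f (c : R[i]) : apx f -> apx (fun t => c * f t).
Proof.
move=> [lf af]; split=> [|e e0]; first exact: L2Z.
have c0 := cabs2_ge0 c.
have [|l hl] := af (e / (cabs2 c + 1)); first by rewrite divr_gt0//; lra.
exists (tp_scale c l).
have -> : (fun t => c * f t - tp (tp_scale c l) t) = (fun t => c * (f t - tp l t)).
  by apply/funext => t; rewrite tp_scaleE; ring.
rewrite nrm2Z; last by apply: L2B => //; exact: L2_tp.
rewrite ltr_pdivlMr in hl; last lra.
have := nrm2_ge0 (fun t => f t - tp l t); nra.
Qed.

Lemma apxB f g : apx f -> apx g -> apx (fun t => f t - g t).
Proof.
move=> af /(@apxZ _ (-1)) ag; have := apxD af ag.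
by under eq_fun => t do rewrite mulN1r.
Qed.

Lemma apx0 : apx (fun=> 0).
Proof.
have := apx_tp [::].
by rewrite (_ : tp [::] = fun=> 0)//; apply/funext => t; rewrite /tp big_nil.
Qed.

Lemma apx_sum (J : Type) (s : seq J) (P : pred J) (F : J -> R -> R[i]) :
  (forall j, P j -> apx (F j)) -> apx (fun t => \sum_(j <- s | P j) F j t).
Proof.
move=> aF; elim: s => [|j s ih].
  by under eq_fun => t do rewrite big_nil; exact: apx0.
under eq_fun => t do rewrite big_cons.
by case: (boolP (P j)) => // Pj; apply: apxD => //; exact: aF.
Qed.

(** A common integrable majorant turns pointwise convergence into L^2 convergence, because |f -
    h_k|^2 <= 4 g. *)
Lemma apx_dominated f (h : nat -> R -> R[i]) (g : R -> R) : cmeas f ->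
  (forall k, apx (h k)) -> (forall k t, cabs2 (h k t) <= g t) ->
  (forall t, cabs2 (f t) <= g t) -> rint g ->
  (forall t, cabs2 (f t - h k t) @[k --> \oo] --> (0 : R)) -> apx f.
Proof.
move=> mf ah hg fg ig fh.
have lf : L2 f by exact: (L2_le mf fg).
apply: apx_close => // e e0.
have := @dominated_cvgR R (fun k t => cabs2 (f t - h k t)) (fun=> 0) (fun t => 4 * g t).
case=> //.
- by move=> k; apply: cmeas_cabs2; apply: L2_meas; apply: L2B => //; have [] := ah k.
- exact: rintZ.
- move=> k t; rewrite ger0_norm ?cabs2_ge0// (le_trans (cabs2D_le _ _))// cabs2N.
  by have := hg k t; have := fg t; lra.
move=> _; rewrite Rintegral_cst// mul0r => /(@cvgrPdist_lt _ R^o) /(_ _ e0) [N _ /(_ N (leqnn _))].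
rewrite /= sub0r normrN => hN; exists (h N) => //.
by apply: le_lt_trans hN; rewrite ler_norm.
Qed.

End fourier_series.

(** * Polynomial approximation of a step function *)

Section step_polynomials.
Context {R : realType}.
Implicit Types x y : R.

Lemma bernoulli_ineq x (k : nat) : -1 <= x -> 1 + k%:R * x <= (1 + x) ^+ k.
Proof.
move=> x1; elim: k => [|k ih]; first by rewrite mul0r addr0 expr0.
rewrite exprS -natr1.
have k0 : 0 <= k%:R :> R by exact: ler0n.
have x2 : 0 <= x ^+ 2 by exact: sqr_ge0.
have : 0 <= (1 + x) * ((1 + x) ^+ k - (1 + k%:R * x)) by rewrite mulr_ge0 ?subr_ge0//; lra.
nra.
Qed.

Lemma cvg_natXr x : 0 <= x < 1 -> k%:R * x ^+ k @[k --> \oo] --> (0 : R).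
Proof.
move=> /andP[]; rewrite le_eqVlt => /predU1P[<- _|x0 x1].
  apply: cvg_near_cst; exists 1%N => // k /= k0.
  by rewrite expr0n; case: k k0 => // k _; rewrite mulr0.
(* Bernoulli's inequality for 1/s = 1 + d gives (1 + k d) s^k <= 1. Squaring it bounds k x^k by a
   constant over k + 1; without the square the factor k would not be beaten. *)
pose s := Num.sqrt x; have s0 : 0 < s by rewrite sqrtr_gt0.
have ss : s ^+ 2 = x by rewrite sqr_sqrtr// ltW.
have s1 : s < 1 by rewrite -(ltr_pXn2r (n:=2))// ?nnegrE ?ltW// ss expr1n.
pose d := s^-1 - 1.
have d0 : 0 < d by rewrite subr_gt0 invf_gt1.
pose C := d^-1 + d^-1 ^+ 2.
have bnd k : k%:R * x ^+ k <= C * (k.+1%:R)^-1.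
  have h : (1 + k%:R * d) * s ^+ k <= 1.
    rewrite -ler_pdivlMr ?exprn_gt0// mul1r -exprVn.
    have := @bernoulli_ineq d k; rewrite (_ : 1 + d = s^-1); last by rewrite /d; ring.
    by apply; lra.
  have k0 : 0 <= k%:R :> R by exact: ler0n.
  rewrite ler_pdivlMr ?ltr0n// -ss exprAC -natr1.
  have sk0 : 0 <= s ^+ k by rewrite exprn_ge0// ltW.
  have h2 : ((1 + k%:R * d) * s ^+ k) ^+ 2 <= 1.
    by rewrite expr_le1// mulr_ge0//; nra.
  rewrite -[C]mulr1; apply: le_trans (ler_wpM2l _ h2); last first.
    by rewrite /C addr_ge0// ?exprn_ge0// invr_ge0 ltW.
  have -> : k%:R * (s ^+ k) ^+ 2 * (k%:R + 1) = k%:R * (k%:R + 1) * (s ^+ k) ^+ 2 by ring.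
  rewrite exprMn [leRHS]mulrA; apply: ler_wpM2r; first exact: sqr_ge0.
  rewrite (_ : C * _ = d^-1 + d^-1 ^+ 2 + 2 * k%:R + 2 * k%:R * d^-1 + k%:R ^+ 2 * d + k%:R ^+ 2); last first.
    by rewrite /C; field; rewrite gt_eqF.
  have : 0 < d^-1 by rewrite invr_gt0.
  have : 0 <= k%:R ^+ 2 * d by rewrite mulr_ge0 ?sqr_ge0// ltW.
  have : 0 <= d^-1 ^+ 2 by exact: sqr_ge0.
  nra.
apply: (squeeze_cvgr (f := fun=> 0) (h := fun k => C * (k.+1%:R)^-1)).
- by apply: nearW => k; rewrite bnd andbT mulr_ge0// exprn_ge0// ltW.
- exact: cvg_cst.
- by rewrite -[0 in X in _ --> X](mulr0 C); apply: cvgM; [exact: cvg_cst|exact: cvg_harmonic].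
Qed.

(* Stone's polynomials [(1 - y^k)^(k 2^k)] converge on [0, 1] to the indicator
   of [y < 1/2]; the extra factor [k] settles the value at [1/2] *)
Definition stone (k : nat) y := (1 - y ^+ k) ^+ (k * 2 ^ k).

Lemma stone_itv k y : 0 <= y <= 1 -> 0 <= stone k y <= 1.
Proof.
move=> /andP[y0 y1]; have yk : 0 <= y ^+ k <= 1 by rewrite exprn_ge0//= exprn_ile1.
by rewrite /stone exprn_ge0 ?exprn_ile1//; lra.
Qed.

Lemma cvg_stone y : 0 <= y <= 1 -> stone k y @[k --> \oo] --> ((y < 2^-1)%R%:R : R).
Proof.
move=> y01; have [y0 y1] := andP y01.
have [yh|yh] := ltrP y 2^-1.
  (* For y < 1/2, Bernoulli's inequality bounds [stone k y] below by 1 - k 2^k y^k. *)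
  apply: (squeeze_cvgr (f := fun k => 1 - k%:R * (2 * y) ^+ k) (h := fun=> 1)).
  - apply: nearW => k; have /andP[_ ->] := stone_itv k y01; rewrite andbT.
    have := @bernoulli_ineq (- y ^+ k) (k * 2 ^ k).
    rewrite exprMn natrM natrX /stone; have h1 : y ^+ k <= 1 by exact: exprn_ile1.
    by move=> h2; have := h2 _; rewrite lerN2 => /(_ h1); lra.
  - rewrite -[X in _ --> X]subr0; apply: cvgB; first exact: cvg_cst.
    by apply: cvg_natXr; lra.
  - exact: cvg_cst.
(* For y >= 1/2: since (1 - y^k) (1 + y^k) <= 1, [stone k y] is at most the inverse of (1 + y^k)^(k
   2^k), and this power is at least 1 + k (2 y)^k >= k + 1. *)
apply: (squeeze_cvgr (f := fun=> 0) (h := fun k => k.+1%:R^-1)).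
- apply: nearW => k; have /andP[-> _] := stone_itv k y01; rewrite /=.
  have yk0 : 0 <= y ^+ k by exact: exprn_ge0.
  have yk1 : y ^+ k <= 1 by exact: exprn_ile1.
  rewrite -[_^-1]mul1r ler_pdivlMr ?ltr0n//.
  have h : 1 <= 2 ^+ k * y ^+ k by rewrite -exprMn exprn_ege1//; lra.
  have b := @bernoulli_ineq (y ^+ k) (k * 2 ^ k).
  have : k.+1%:R <= (1 + y ^+ k) ^+ (k * 2 ^ k).
    apply: le_trans (b _); last lra.
    rewrite -natr1 natrM natrX -mulrA addrC lerD2l ler_peMr ?ler0n//.
  move=> /(ler_wpM2l (_ : 0 <= stone k y)) => /(_ _)/le_trans; apply.
    by have /andP[] := stone_itv k y01.
  rewrite /stone -exprMn exprn_ile1//; nra.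
- exact: cvg_cst.
- exact: cvg_harmonic.
Qed.

End step_polynomials.

Import HBSimple HBNNSimple.

(** * Completeness of the exponentials on one period *)

Section fourier_density.
Context {R : realType}.
Notation mu := (@lebesgue_measure R).
Variables (a T : R).
Hypothesis T_gt0 : 0 < T.

Let T0 : 0 < T. Proof. exact: T_gt0. Qed.

Notation ind := (itv1 a (a + T)).
Notation apx := (apx a T).

Lemma cvg_cabs2B (u_ : nat -> R[i]) (u : R[i]) :
  complex.Re (u_ k) @[k --> \oo] --> complex.Re u ->
  complex.Im (u_ k) @[k --> \oo] --> complex.Im u ->
  cabs2 (u - u_ k) @[k --> \oo] --> (0 : R).
Proof.
move=> hr hi.
have -> : (fun k => cabs2 (u - u_ k)) = (fun k =>
    (complex.Re u - complex.Re (u_ k)) * (complex.Re u - complex.Re (u_ k)) +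
    (complex.Im u - complex.Im (u_ k)) * (complex.Im u - complex.Im (u_ k))).
  by apply/funext => k; rewrite /cabs2 !ReIm; ring.
have h (v_ : nat -> R) (v : R) : v_ k @[k --> \oo] --> v ->
    (v - v_ k) * (v - v_ k) @[k --> \oo] --> (0 : R).
  move=> hv; rewrite -(mul0r (0 : R)); apply: cvgM; rewrite -(subrr v);
    by apply: cvgB => //; exact: cvg_cst.
by rewrite -(addr0 (0:R)); apply: cvgD; exact: h.
Qed.

(* [y t = 1/2 - 1/2 sin(pi (t - x)/T) sin(pi (t - a)/T)] is a trigonometric
   polynomial of period [T] with values in [0, 1], and [y t < 1/2] iff [t > x] *)
Let lev x t := 2^-1 - 2^-1 * (sin (pi * ((t - x) / T)) * sin (pi * ((t - a) / T))).

Let lev01 x t : 0 <= lev x t <= 1.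
Proof.
rewrite /lev; move: (pi * _) (pi * _) => u v.
have := sin_max u; have := sin_max v.
rewrite !ler_norml => /andP[? ?] /andP[? ?]; apply/andP; split; nra.
Qed.

Let lev_lt x t : a <= x < a + T -> a <= t < a + T -> (lev x t < 2^-1) = (x < t).
Proof.
move=> /andP[ax xT] /andP[at_ tT]; rewrite /lev ltrBlDr ltrDl pmulr_rgt0 ?invr_gt0//.
have pos s : 0 < s < T -> 0 < sin (pi * (s / T)).
  move=> /andP[s0 sT]; apply: sin_gt0_pi.
  by rewrite mulr_gt0 ?pi_gt0 ?divr_gt0//= -[ltRHS]mulr1 ltr_pM2l ?pi_gt0// ltr_pdivrMr// mul1r.
have [xt|tx] := ltrP x t.
  by apply: mulr_gt0; apply: pos; apply/andP; split; lra.
apply/negbTE; rewrite -leNgt; apply: mulr_le0_ge0.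
  move: tx; rewrite le_eqVlt => /predU1P[->|tx]; first by rewrite subrr mul0r mulr0 sin0.
  rewrite -oppr_ge0 -sinN -mulrN -mulNr opprB ltW//.
  by apply: pos; apply/andP; split; lra.
move: at_; rewrite le_eqVlt => /predU1P[->|at_]; first by rewrite subrr mul0r mulr0 sin0.
by apply/ltW/pos; apply/andP; split; lra.
Qed.

(** Product to sum: the two angles differ by a constant and add up to 2 pi t / T minus a constant,
    so only the frequencies 0, 1 and -1 occur. The coefficient 1/8 is 1/2 (in [lev]) times 1/2
    (product formula) times 1/2 (cosine as two exponentials). *)
Let lev_tp x : exists l, forall t, tp a T l t = (ind t * lev x t)%:C%C.
Proof.
pose c := cos (pi * ((x - a) / T)).
pose z := cexpi (- (pi * ((x + a) / T))).
exists [:: (0, (2^-1 - 4^-1 * c)%:C%C); (1, (8^-1)%:C%C * z); (-1, (8^-1)%:C%C * z^*)].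
move=> t; rewrite /tp !big_cons big_nil addr0 /= /em.
rewrite !mulr1z !mul0r !mulr0 !mul0r cexpi0 mulr1.
have -> : (ind t * lev x t)%:C%C = (ind t)%:C%C * (lev x t)%:C%C :> R[i] by rewrite rmorphM.
rewrite mulrC !(mulrCA _ (ind t)%:C%C) -!mulrDr; congr (_ * _).
rewrite /z cexpi_conj -!mulrA -!cexpiD.
set A := - (pi * _) + _; set B := - - _ + _.
have -> : B = - A.
  by rewrite /A /B mulN1r; field; rewrite gt_eqF.
rewrite /lev.
have -> : sin (pi * ((t - x) / T)) * sin (pi * ((t - a) / T)) = 2^-1 * (c - cos A).
  have -> : A = pi * ((t - x) / T) + pi * ((t - a) / T) by rewrite /A; field; rewrite gt_eqF.
  have -> : c = cos (pi * ((t - a) / T) - pi * ((t - x) / T)).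
    by rewrite /c; congr cos; field; rewrite gt_eqF.
  by rewrite !cosD cosN sinN; field.
by apply: eqCP; rewrite !ReIm /= ?cosN ?sinN; field.
Qed.

Let apx_ray x : apx (fun t => (ind t * \1_(`]x, +oo[%classic) t)%:C%C).
Proof.
have indE t : \1_(`]x, +oo[%classic) t = (x < t)%R%:R :> R.
  rewrite indicE; congr ((nat_of_bool _)%:R); apply/idP/idP => [/set_mem /=|h].
    by rewrite in_itv /= andbT.
  by apply/mem_set; rewrite /= in_itv /= andbT.
have [xa|ax] := ltrP x a.
  rewrite (_ : (fun t => _) = tp a T tp1); first exact: apx_tp.
  apply/funext => t; rewrite tp1E indE itv1E; case: (boolP (_ && _)); last by rewrite mul0r.
  by move=> /andP[h _]; rewrite (lt_le_trans xa h) mulr1.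
have [xT|Tx] := ltrP x (a + T); last first.
  rewrite (_ : (fun t => _) = (fun=> 0)); first exact: apx0.
  apply/funext => t; rewrite indE itv1E; case: (boolP (_ && _)); last by rewrite mul0r.
  by move=> /andP[_ h]; rewrite ltNge (le_trans (ltW h) Tx) mulr0.
have [l lE] := lev_tp x.
(* The polynomial (1 - lev^k)^(k 2^k), that is, [stone k] composed with [lev]. *)
pose q k := tp_exp (tp_scale (-1) (tp_exp l k) ++ tp1) (k * 2 ^ k).
have qE k t : tp a T (q k) t = (ind t * stone k (lev x t))%:C%C.
  rewrite /q tp_expE tp_cat tp_scaleE tp_expE tp1E lE itv1E; case: (_ && _).
    by rewrite /stone !mul1r addrC mulN1r -rmorphXn -rmorphB -rmorphXn.
  by rewrite !mul0r.
apply: (@apx_dominated _ a T _ (fun k => tp a T (q k)) (itv1 a (a + T))).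
- apply: cmeas_real; apply: measurable_funM; first exact: measurable_itv1.
  exact: measurable_indic.
- by move=> k; exact: apx_tp.
- move=> k t; rewrite qE cabs2_real exprMn expr2 itv1_sqr.
  have /andP[s0 s1] := stone_itv k (lev01 x t).
  apply: ler_piMr; first by rewrite itv1E ler0n.
  by rewrite exprn_ile1.
- move=> t; rewrite cabs2_real exprMn expr2 itv1_sqr indE.
  apply: ler_piMr; first by rewrite itv1E ler0n.
  by case: (_ < _); rewrite ?expr1n ?expr0n.
- exact: rint_itv1.
- move=> t; apply: cvg_cabs2B => /=; last first.
    by under eq_fun => k do rewrite qE; exact: cvg_cst.
  under eq_fun => k do rewrite qE /=.
  rewrite indE; have := cvg_stone (lev01 x t).
  rewrite itv1E; case: (boolP (_ && _)) => tI.
    by rewrite lev_lt ?ax//; rewrite mul1r; under [X in _ -> X @ _ --> _]eq_fun => k do rewrite mul1r.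
  by rewrite mul0r => _; under eq_fun => k do rewrite mul0r; exact: cvg_cst.
Qed.

Let setA := [set A : set R | measurable A /\ apx (fun t => (ind t * \1_A t)%:C%C)].

(** A pi-lambda argument: the rays ]x, +oo[ are stable under intersection and generate the Borel
    sets, while [apxB] and [apx_dominated] give the closure properties of a lambda-system. *)
Let apx_measurable (A : set R) : measurable A -> apx (fun t => (ind t * \1_A t)%:C%C).
Proof.
suff : @measurable _ (measurableTypeR R) `<=` setA by move=> h /h[].
rewrite -[X in X `<=` _]/(((R.-ocitv).-measurable).-sigma.-measurable) RGenOInfty.measurableE.
apply: lambda_system_subset => //.
- move=> B C [x ->] [y ->]; exists (Num.max x y).
  by apply/seteqP; split=> t /=; rewrite !in_itv /= !andbT gt_max => /andP.
- split => //.
  + split; first exact: measurableT.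
    rewrite (_ : (fun t => _) = tp a T tp1); first exact: apx_tp.
    by apply/funext => t; rewrite tp1E indicT mulr1.
  + move=> B C CB [mB aB] [mC aC]; split; first exact: measurableD.
    have := apxB aB aC; congr (apx _); apply/funext => t.
    rewrite -rmorphB -mulrBr; congr ((_ * _)%:C%C); rewrite !indicE in_setD.
    case: (boolP (t \in C)) => tC; last by rewrite andbT subr0.
    by rewrite (mem_set (CB _ (set_mem tC))) subrr.
  + move=> F ndF FA; have mF k : measurable (F k) by have [] := FA k.
    split; first by apply: bigcupT_measurable => k; exact: mF.
    apply: (@apx_dominated _ a T _ (fun k t => (ind t * \1_(F k) t)%:C%C) (itv1 a (a + T))).
    * apply: cmeas_real; apply: measurable_funM; first exact: measurable_itv1.
      by apply: measurable_indic; apply: bigcupT_measurable => k; exact: mF.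
    * by move=> k; have [] := FA k.
    * move=> k t; rewrite cabs2_real exprMn expr2 itv1_sqr; apply: ler_piMr; first by rewrite itv1E ler0n.
      by rewrite indicE; case: (_ \in _); rewrite ?expr1n ?expr0n.
    * move=> t; rewrite cabs2_real exprMn expr2 itv1_sqr; apply: ler_piMr; first by rewrite itv1E ler0n.
      by rewrite indicE; case: (_ \in _); rewrite ?expr1n ?expr0n.
    * exact: rint_itv1.
    * move=> t; apply: cvg_cabs2B => /=; last exact: cvg_cst.
      apply: cvgM; first exact: cvg_cst.
      rewrite indicE; case: (boolP (t \in _)) => [/set_mem[k _ Fkt]|tF].
        apply: cvg_near_cst; exists k => // m /= km.
        by rewrite indicE mem_set//; have /subsetPset := ndF _ _ km; exact.
      apply: cvg_near_cst; apply: nearW => k; rewrite indicE memNset// => Fkt.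
      by move/negP: tF; apply; apply/mem_set; exists k.
- move=> B [x ->]; split; first exact: measurable_itv.
  exact: apx_ray.
Qed.

Let apx_nonneg (u : R -> R) : measurable_fun [set: R] u -> (forall t, 0 <= u t) ->
  rint (fun t => u t ^+ 2) -> apx (fun t => (ind t * u t)%:C%C).
Proof.
move=> mu_ u0 iu.
have mE : measurable_fun [set: R] (EFin \o u) by exact/measurable_EFinP.
pose h k : {nnsfun R >-> R} := nnsfun_approx measurableT mE k.
have hu k t : 0 <= h k t <= u t.
  rewrite fun_ge0 /= /h nnsfun_approxE -lee_fin.
  by apply: (@le_approx _ _ _ setT (EFin \o u)) => // x _; rewrite lee_fin.
apply: (@apx_dominated _ a T _ (fun k t => (ind t * h k t)%:C%C) (fun t => u t ^+ 2)) => //.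
- by apply: cmeas_real; apply: measurable_funM => //; exact: measurable_itv1.
- move=> k; rewrite (_ : (fun t => _) = (fun t => \sum_(y <- finmap.enum_fset (fset_set (range (h k))))
     y%:C%C * (ind t * \1_(h k @^-1` [set y]) t)%:C%C)).
    apply: apx_sum => // y _; apply: apxZ => //; apply: apx_measurable.
    exact: measurable_sfunP.
  apply/funext => t; rewrite fimfunE fsbig_finite//= mulr_sumr rmorph_sum; apply: eq_bigr => y _.
  by rewrite -rmorphM; congr (_%:C%C); ring.
- move=> k t; rewrite cabs2_real exprMn expr2 itv1_sqr.
  have /andP[h0 h1] := hu k t.
  rewrite -[leRHS]mul1r; apply: ler_pM.
  - by rewrite itv1E ler0n.
  - exact: sqr_ge0.
  - by rewrite itv1E lern1 leq_b1.
  - by rewrite ler_pXn2r// nnegrE.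
- move=> t; rewrite cabs2_real exprMn expr2 itv1_sqr; apply: ler_piMl; first exact: sqr_ge0.
  by rewrite itv1E lern1 leq_b1.
- move=> t; apply: cvg_cabs2B => /=; last exact: cvg_cst.
  apply: cvgM; first exact: cvg_cst.
  rewrite /h; under eq_fun => k do rewrite nnsfun_approxE.
  by have := @cvg_approx _ _ R setT (EFin \o u) t; apply => // [x _|]; rewrite ?lee_fin ?ltry.
Qed.

Let apx_real (u : R -> R) : measurable_fun [set: R] u ->
  rint (fun t => u t ^+ 2) -> apx (fun t => (ind t * u t)%:C%C).
Proof.
move=> mu_ iu.
have pn t : u t = u^\+ t - u^\- t.
  rewrite /funrpos /funrneg /=; case: (lerP 0 (u t)) => u0.
    by rewrite max_r ?oppr_le0// subr0.
  by rewrite max_l ?oppr_ge0 ?ltW// sub0r opprK.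
rewrite (_ : (fun t => _) = (fun t => (ind t * u^\+ t)%:C%C - (ind t * u^\- t)%:C%C)).
  apply: apxB => //; apply: apx_nonneg.
  - exact: measurable_funrpos.
  - by move=> t; exact: funrpos_ge0.
  - apply: (rint_le _ _ iu); first by apply: measurable_funX; exact: measurable_funrpos.
    move=> t; rewrite ger0_norm ?sqr_ge0//= /funrpos /Order.max; case: ifP => // _.
    by rewrite expr0n sqr_ge0.
  - exact: measurable_funrneg.
  - by move=> t; exact: funrneg_ge0.
  - apply: (rint_le _ _ iu); first by apply: measurable_funX; exact: measurable_funrneg.
    move=> t; rewrite ger0_norm ?sqr_ge0//= /funrneg /Order.max; case: ifP => _.
      by rewrite expr0n sqr_ge0.
    by rewrite sqrrN.
by apply/funext => t; rewrite -rmorphB -mulrBr -pn.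
Qed.

(** The class grows from measurable sets to simple functions, to nonnegative and then real
    functions, and finally to f through its real and imaginary parts. *)
Lemma apx_L2 f : L2 f -> apx (fun t => (ind t)%:C%C * f t).
Proof.
move=> /L2P[[mr mi] lf].
have ar : apx (fun t => (ind t * complex.Re (f t))%:C%C).
  apply: apx_real => //; apply: (rint_le _ _ lf); first exact: measurable_funX.
  by move=> t; rewrite ger0_norm ?sqr_ge0// lerDl sqr_ge0.
have ai : apx (fun t => (ind t * complex.Im (f t))%:C%C).
  apply: apx_real => //; apply: (rint_le _ _ lf); first exact: measurable_funX.
  by move=> t; rewrite ger0_norm ?sqr_ge0// lerDr sqr_ge0.
have := apxD ar (apxZ ('i)%C ai); congr (apx _); apply/funext => t.
by apply: eqCP; rewrite !ReIm /=; ring.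
Qed.

End fourier_density.

Section symmetric_ranges.

Definition zrange (K : nat) : seq int := [seq (i%:Z - K%:Z) | i <- iota 0 (2 * K).+1].

Lemma zrange_uniq K : uniq (zrange K).
Proof.
rewrite map_inj_uniq ?iota_uniq// => i j /eqP.
by rewrite (inj_eq (addIr _)) => /eqP[].
Qed.

Lemma mem_zrange K (n : int) : (n \in zrange K) = (`|n| <= K%:Z).
Proof.
apply/mapP/idP => [[i ii ->] | nK].
  by move: ii; rewrite mem_iota add0n => /andP[_ iK]; lia.
exists (absz (n + K%:Z)); last by lia.
by rewrite mem_iota add0n; lia.
Qed.

Lemma sub_zrange (s : seq int) : exists K, {subset s <= zrange K}.
Proof.
elim: s => [|n s [K sK]]; first by exists 0%N.
exists (maxn (absz n) K) => m; rewrite inE => /predU1P[->|/sK]; rewrite !mem_zrange; lia.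
Qed.

Context {R : numDomainType}.

Lemma ler_sum_subset (J : eqType) (s1 s2 : seq J) (F : J -> R) : uniq s1 -> uniq s2 ->
  {subset s1 <= s2} -> (forall j, 0 <= F j) -> \sum_(j <- s1) F j <= \sum_(j <- s2) F j.
Proof.
move=> u1 u2 s12 F0.
rewrite [leRHS](bigID (mem s1))/= -[leLHS]addr0; apply: lerD; last by apply: sumr_ge0.
suff -> : \sum_(j <- s1) F j = \sum_(j <- s2 | mem s1 j) F j by [].
rewrite -[RHS]big_filter; apply: perm_big.
apply: uniq_perm; rewrite ?filter_uniq// => x.
by rewrite mem_filter /=; case: (boolP (x \in s1)) => //= xs; rewrite s12.
Qed.

Lemma le_zrange (K L : nat) (F : int -> R) : (K <= L)%N -> (forall n, 0 <= F n) ->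
  \sum_(n <- zrange K) F n <= \sum_(n <- zrange L) F n.
Proof.
move=> KL F0; apply: ler_sum_subset => //; try exact: zrange_uniq.
by move=> n; rewrite !mem_zrange; lia.
Qed.

End symmetric_ranges.

(** * Parseval's identity, and integrals over tiled windows *)

Section parseval.
Context {R : realType}.
Notation mu := (@lebesgue_measure R).

Lemma parseval (a T : R) (f : R -> R[i]) : 0 < T -> L2 f ->
  (forall t, ~~ (a <= t < a + T) -> f t = 0) ->
  \sum_(n <- zrange K) cabs2 (L2inner f (em a T n)) @[K --> \oo] --> T * nrm2 f.
Proof.
move=> T0 lf fa.
have af : apx a T f.
  have := apx_L2 a T0 lf; congr (apx _ _ _); apply/funext => t.
  by rewrite itv1E; case: (boolP (_ && _)) => [_|/fa ->]; rewrite ?mul1r ?mulr0.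
apply/(@cvgrPdist_le _ R^o) => e e0; have [s us hs] := apx_parseval T0 af e0.
have [K0 sK] := sub_zrange s.
exists K0 => // K /= K0K.
have b := bessel a T0 lf (zrange_uniq K).
rewrite ger0_norm ?subr_ge0//.
have : \sum_(n <- s) cabs2 (L2inner f (em a T n)) <= \sum_(n <- zrange K) cabs2 (L2inner f (em a T n)).
  apply: ler_sum_subset => //; first exact: zrange_uniq.
    by move=> n /sK; rewrite !mem_zrange; lia.
  by move=> n; exact: cabs2_ge0.
by lra.
Qed.

Lemma itv1_diff (p q x : R) : p <= q -> itv1 p q x = (p <= x)%R%:R - (q <= x)%R%:R.
Proof.
move=> pq; rewrite itv1E; case: (lerP q x) => qx.
  by rewrite (le_trans pq qx) subrr.
by rewrite andbT subr0.
Qed.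

(** The cells [jT, (j + 1)T) with |j| <= K fill a window that reaches one cell further to the right
    than to the left; this asymmetric window recurs below. The sum telescopes. *)
Lemma itv1_tile (T : R) (K : nat) (x : R) : 0 < T ->
  \sum_(j <- zrange K) itv1 0 T (x - j%:~R * T) = itv1 (- (K%:R * T)) (K.+1%:R * T) x.
Proof.
move=> T0; rewrite itv1_diff; last first.
  by rewrite (@le_trans _ _ 0)// ?oppr_le0 ?mulr_ge0 ?ler0n// ltW.
rewrite /zrange big_map -[iota 0 _]/(index_iota 0 (2 * K).+1).
pose u i : R := - (i%:R * T - K%:R * T <= x)%R%:R.
rewrite (eq_bigr (fun i => u i.+1 - u i)) => [|i _].
  rewrite telescope_sumr// /u opprK addrC mul0r sub0r; congr (_ - (_ <= _)%R%:R).
  by rewrite -mulrBl -natrB; [congr (_%:R * _); lia|lia].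
rewrite (itv1_diff _ (ltW T0)) /u opprK addrC; congr (_ + _).
  by congr (- (_ %:R)); rewrite intrD intrN /= -natr1; congr nat_of_bool; apply/idP/idP; lra.
by congr (_ %:R); rewrite intrD intrN /=; congr nat_of_bool; apply/idP/idP; lra.
Qed.

Lemma rint_itv1M (p q : R) (h : R -> R) : rint h -> rint (fun x => itv1 p q x * h x).
Proof.
move=> ih; have mh := rint_meas ih.
have ia : rint (fun x => `|h x|).
  exact: (@integrable_norm _ _ _ mu setT h).
apply: (rint_le _ _ ia); first by apply: measurable_funM => //; exact: measurable_itv1.
by move=> x; rewrite normrM ler_piMl// itv1E; case: (_ && _); rewrite ?normr1 ?normr0.
Qed.

Lemma Rintegral_tile (T : R) (K : nat) (h : R -> R) : 0 < T -> rint h ->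
  \int[mu]_x (itv1 (- (K%:R * T)) (K.+1%:R * T) x * h x) =
  \int[mu]_x (itv1 0 T x * \sum_(j <- zrange K) h (x + j%:~R * T)).
Proof.
move=> T0 ih.
have is_ j : rint (fun x => itv1 0 T (x - j%:~R * T) * h x).
  have -> : (fun x => itv1 0 T (x - j%:~R * T) * h x) = (fun x => itv1 (j%:~R * T) (T + j%:~R * T) x * h x).
    by apply/funext => x; congr (_ * _); rewrite !itv1E subr_ge0 ltrBlDr.
  exact: rint_itv1M.
have ish j : rint (fun x => itv1 0 T x * h (x + j%:~R * T)).
  have := rint_shift (- (j%:~R * T)) (is_ j); congr rint; apply/funext => x.
  by rewrite opprK addrK.
transitivity (\sum_(j <- zrange K) \int[mu]_x (itv1 0 T (x - j%:~R * T) * h x)).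
  rewrite -Rintegral_sum//; apply: eq_Rintegral => x _.
  by rewrite -itv1_tile// mulr_suml.
transitivity (\sum_(j <- zrange K) \int[mu]_x (itv1 0 T x * h (x + j%:~R * T))).
  apply: eq_bigr => j _; rewrite -(Rintegral_shift (- (j%:~R * T)))//.
  by apply: eq_Rintegral => x _; rewrite opprK addrK.
by rewrite -Rintegral_sum//; apply: eq_Rintegral => x _; rewrite mulr_sumr.
Qed.

Lemma cint_tile (T : R) (K : nat) (h : R -> R[i]) : 0 < T -> cintble h ->
  cint (fun x => (itv1 (- (K%:R * T)) (K.+1%:R * T) x)%:C%C * h x) =
  cint (fun x => (itv1 0 T x)%:C%C * \sum_(j <- zrange K) h (x + j%:~R * T)).
Proof.
move=> T0 [hr hi]; apply: eqCP; rewrite /cint /=.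
- transitivity (\int[mu]_x (itv1 (- (K%:R * T)) (K.+1%:R * T) x * complex.Re (h x))).
    by apply: eq_Rintegral => x _; rewrite ReM /= mul0r subr0.
  by rewrite Rintegral_tile//; apply: eq_Rintegral => x _; rewrite ReM /= mul0r subr0 Re_sum.
- transitivity (\int[mu]_x (itv1 (- (K%:R * T)) (K.+1%:R * T) x * complex.Im (h x))).
    by apply: eq_Rintegral => x _; rewrite ImM /= mul0r addr0.
  by rewrite Rintegral_tile//; apply: eq_Rintegral => x _; rewrite ImM /= mul0r addr0 Im_sum.
Qed.

Lemma itv1_exhaust (T : R) (x : R) : 0 < T ->
  \forall K \near \oo, itv1 (- (K%:R * T)) (K.+1%:R * T) x = 1.
Proof.
move=> T0; pose B := Num.bound (`|x| / T); exists B => // K /= hK.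
have xB : `|x| / T < B%:R by rewrite archi_boundP// divr_ge0// ltW.
have xK : `|x| < K%:R * T.
  by rewrite -ltr_pdivrMr//; apply: (lt_le_trans xB); rewrite ler_nat.
apply: itv1_in; move: xK; rewrite ltr_norml -natr1 => /andP[h1 h2].
by apply/andP; split; lra.
Qed.

(** Monotone convergence over the growing windows. It supplies integrability where only uniformly
    bounded window integrals are known: for |ft f|^2 and for |ck|^2. *)
Lemma rint_exhaust (T : R) (u : R -> R) (C : R) : 0 < T ->
  measurable_fun [set: R] u -> (forall x, 0 <= u x) ->
  (forall K, rint (fun x => itv1 (- (K%:R * T)) (K.+1%:R * T) x * u x)) ->
  (forall K, \int[mu]_x (itv1 (- (K%:R * T)) (K.+1%:R * T) x * u x) <= C) -> rint u.
Proof.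
move=> T0 mu_ u0 iK iC; apply: rint_ltP => //.
pose g K x := (itv1 (- (K%:R * T)) (K.+1%:R * T) x * u x)%:E.
have mg K : measurable_fun [set: R] (g K).
  by apply/measurable_EFinP; apply: measurable_funM => //; exact: measurable_itv1.
have ndg x : {homo g ^~ x : n m / (n <= m)%N >-> (n <= m)%E}.
  move=> n m nm; rewrite lee_fin ler_wpM2r// !itv1E ler_nat.
  case: (boolP (_ && _)) => // /andP[h1 h2]; rewrite lt0b.
  have nm1 : n%:R <= m%:R :> R by rewrite ler_nat.
  apply/andP; split; first by apply: le_trans h1; rewrite lerN2 ler_pM2r.
  by apply: (lt_le_trans h2); rewrite ler_pM2r// ler_nat.
have g0 K x : setT x -> (0 <= g K x)%E.
  by move=> _; rewrite lee_fin mulr_ge0// itv1E ler0n.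
have := @cvg_monotone_convergence _ _ R mu setT measurableT g mg g0 (fun x _ => ndg x).
have -> : (fun x => limn (g ^~ x)) = EFin \o u.
  apply/funext => x; apply/cvg_lim => //; apply: cvg_near_cst.
  have [N _ hN] := itv1_exhaust x T0; exists N => // K /hN /= e.
  by rewrite /g e mul1r.
move=> h; have hle : (\int[mu]_x (EFin \o u) x <= C%:E)%E.
  rewrite -(cvg_lim (@ereal_hausdorff R) h); apply: lime_le; first by apply/cvg_ex; eexists; exact: h.
  by apply: nearW => K; rewrite /g rint_fin// lee_fin.
by apply: le_lt_trans hle _; rewrite ltry.
Qed.

Lemma cvg_exhaust (T : R) (u : R -> R) : 0 < T -> rint u -> (forall x, 0 <= u x) ->
  \int[mu]_x (itv1 (- (K%:R * T)) (K.+1%:R * T) x * u x) @[K --> \oo] --> \int[mu]_x u x.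
Proof.
move=> T0 iu u0.
have [] // := @dominated_cvgR R (fun (K : nat) x => itv1 (- (K%:R * T)) (K.+1%:R * T) x * u x) u u.
- by move=> K; apply: measurable_funM; [exact: measurable_itv1|exact: rint_meas].
- move=> x; apply: cvg_near_cst; have [N _ hN] := itv1_exhaust x T0.
  by exists N => // K /hN /= ->; rewrite mul1r.
- move=> K x; rewrite normrM (ger0_norm (u0 x)) ler_piMl// itv1E.
  by case: (_ && _); rewrite ?normr1 ?normr0.
Qed.

End parseval.

(** * The Fourier transform on functions of bounded support *)

Section fourier_transform.
Context {R : realType}.
Notation mu := (@lebesgue_measure R).
Implicit Types f g : R -> R[i].

(** On a bounded interval square integrable functions are integrable, so on this class the Fourier
    transform is a genuine integral and has a value at every point. *)
Definition L2c (N : R) f := L2 f /\ forall t, ~~ (- N <= t < N) -> f t = 0.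

Definition ft f (xi : R) : R[i] := cint (fun t => f t * cexpi (- (2 * pi * xi * t))).

Lemma L2c_itv1 N f t : L2c N f -> (itv1 (- N) N t)%:C%C * f t = f t.
Proof.
by move=> [_ h]; rewrite itv1E; case: (boolP (_ && _)) => [_|/h ->]; rewrite ?mul1r ?mulr0.
Qed.

Lemma L2_itv1M (N : R) (m : R -> R[i]) (C : R) : cmeas m -> (forall t, cabs2 (m t) <= C) ->
  L2 (fun t => (itv1 (- N) N t)%:C%C * m t).
Proof.
move=> mm mC; apply: (@L2_le _ _ (fun t => C * itv1 (- N) N t)).
- by apply: cmeasM => //; apply: cmeas_real; exact: measurable_itv1.
- move=> t; rewrite cabs2M cabs2_itv1 mulrC; apply: ler_wpM2r; last exact: mC.
  by rewrite itv1E ler0n.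
- by apply: rintZ; exact: rint_itv1.
Qed.

Lemma L2c_cintble N f (m : R -> R[i]) (C : R) : L2c N f -> cmeas m ->
  (forall t, cabs2 (m t) <= C) -> cintble (fun t => f t * m t).
Proof.
move=> cf mm mC; have lf := cf.1.
have mC' t : cabs2 ((m t)^*) <= C by rewrite cabs2_conj.
have := cintbleM lf (@L2_itv1M N (fun t => (m t)^*) C (cmeas_conj mm) mC').
congr cintble; apply/funext => t.
rewrite rmorphM /= conjCK mulrA [f t * _]mulrC.
have -> : ((itv1 (- N) N t)%:C%C)^* = (itv1 (- N) N t)%:C%C.
  by apply: eqCP; rewrite !ReIm //= oppr0.
by rewrite L2c_itv1.
Qed.

Lemma cmeas_expi (x : R) : cmeas (fun t => cexpi (x * t)).
Proof.
by apply: cmeas_cexpi; apply: measurable_funM; [exact: measurable_cst|exact: measurable_id].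
Qed.

Lemma cabs2_cexpi_le (u : R) : cabs2 (cexpi u) <= 1.
Proof. by rewrite cabs2_cexpi. Qed.

Lemma L2c_rint_Re N f : L2c N f -> rint (fun t => complex.Re (f t)) /\ rint (fun t => complex.Im (f t)).
Proof.
have h1 (t : R) : cabs2 (1 : R[i]) <= 1 by rewrite /cabs2 /= expr1n expr0n addr0.
move=> cf; have := @L2c_cintble N f (fun=> 1) 1 cf (cmeas_cst _) h1.
by under eq_fun => t do rewrite mulr1.
Qed.

Lemma continuous_oscillating (p q : R -> R) : rint p -> rint q ->
  continuous (fun xi : R => \int[mu]_t (p t * cos (- (2 * pi * xi * t)) + q t * sin (- (2 * pi * xi * t)))).
Proof.
move=> ip iq x0.
have mc (s : R) : measurable_fun [set: R] (fun t => cos (- (2 * pi * s * t))).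
  have [+ _] := cmeas_expi (- (2 * pi * s)).
  by under eq_fun => t do rewrite /= mulNr.
have ms (s : R) : measurable_fun [set: R] (fun t => sin (- (2 * pi * s * t))).
  have [_ +] := cmeas_expi (- (2 * pi * s)).
  by under eq_fun => t do rewrite /= mulNr.
have ig : rint (fun t => `|p t| + `|q t|).
  by apply: rintD; [exact: (@integrable_norm _ _ _ mu setT p)|exact: (@integrable_norm _ _ _ mu setT q)].
have bnd (s : R) t : `|p t * cos (- (2 * pi * s * t)) + q t * sin (- (2 * pi * s * t))| <= `|p t| + `|q t|.
  apply: le_trans (ler_normD _ _) _; rewrite !normrM; apply: lerD; rewrite ler_piMr//.
  - exact: cos_max.
  - exact: sin_max.
apply: (@continuity_under_integral _ _ _ mu (fun xi t => p t * cos (- (2 * pi * xi * t)) + q t * sin (- (2 * pi * xi * t)))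
   setT measurableT (x0 - 1) (x0 + 1) _ _ _ ig).
- move=> s _; apply: (rint_le _ _ ig) => //.
  apply: measurable_funD; apply: measurable_funM => //; exact: rint_meas.
- apply: aeW => t _ s _.
  have cl : continuous (fun xi : R => - (2 * pi * xi * t)).
    move=> y; apply: cvgN; apply: cvgM; last exact: cvg_cst.
    by apply: cvgM; [exact: cvg_cst|exact: cvg_id].
  apply: cvgD; apply: cvgM; try exact: cvg_cst.
  - apply: (continuous_comp (cl s)); exact: continuous_cos.
  - apply: (continuous_comp (cl s)); exact: continuous_sin.
- by move=> s _; apply: aeW => t _.
- by apply/mem_set; rewrite /= in_itv /=; apply/andP; split; lra.
Qed.

Lemma ft_continuous N f : L2c N f ->
  continuous (fun xi => complex.Re (ft f xi)) /\ continuous (fun xi => complex.Im (ft f xi)).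
Proof.
move=> cf; have [ir ii] := L2c_rint_Re cf.
have eqc (u v : R -> R) : continuous u -> u =1 v -> continuous v by move=> cu /funext <-.
split.
- have iN : rint (fun t => - complex.Im (f t)).
    by have := rintZ (-1) ii; under eq_fun => t do rewrite mulN1r.
  apply: (eqc _ _ (continuous_oscillating ir iN)) => xi.
  by apply: eq_Rintegral => t _; rewrite ReM /= mulNr.
- apply: (eqc _ _ (continuous_oscillating ii ir)) => xi.
  by apply: eq_Rintegral => t _; rewrite ImM /= addrC.
Qed.

Lemma ft_cmeas N f : L2c N f -> cmeas (ft f).
Proof.
by move=> /ft_continuous[cr ci]; split; apply: continuous_measurable_fun => x; [exact: cr|exact: ci].
Qed.

Lemma L2c_modulate N f (s : R) : L2c N f -> L2c N (fun t => cexpi (- (2 * pi * s * t)) * f t).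
Proof.
move=> [lf f0]; split; last by move=> t /f0 ->; rewrite mulr0.
apply: (@L2_bddM _ _ _ 1) => // [|t]; last exact: cabs2_cexpi_le.
have := cmeas_expi (- (2 * pi * s)).
by under eq_fun => t do rewrite mulNr.
Qed.

Lemma nrm2_modulate f (s : R) : nrm2 (fun t => cexpi (- (2 * pi * s * t)) * f t) = nrm2 f.
Proof. by apply: eq_Rintegral => t _; rewrite cabs2M cabs2_cexpi mul1r. Qed.

(** Fourier coefficients for the period 2N are samples of the transform on a lattice of step 1/(2N);
    the modulation by s moves that lattice by s. *)
Lemma ft_em N f (s : R) (n : int) : 0 < N -> L2c N f ->
  L2inner (fun t => cexpi (- (2 * pi * s * t)) * f t) (em (- N) (N + N) n) =
  ft f (s + n%:~R * (N + N)^-1).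
Proof.
move=> N0 cf; rewrite L2innerE; apply: eq_cint => t.
rewrite em_conj /em addKr.
transitivity ((itv1 (- N) N t)%:C%C * f t *
    (cexpi (- (2 * pi * s * t)) * cexpi (2 * pi * ((- n)%:~R / (N + N)) * t))); first by ring.
rewrite -cexpiD.
rewrite (L2c_itv1 _ cf); congr (_ * cexpi _).
by rewrite mulrNz; field; rewrite gt_eqF// addr_gt0.
Qed.

(** Parseval for the function modulated by s says that |ft f|^2 sums to 2N ||f||^2 over the lattice
    s + Z/(2N), for every s. Integrating over s in one cell [0, 1/(2N)) unfolds the lattice sums
    into the integral over the line. *)
Lemma plancherel N f : 0 < N -> L2c N f -> L2 (ft f) /\ nrm2 (ft f) = nrm2 f.
Proof.
move=> N0 cf; pose T := N + N; have T0 : 0 < T by rewrite addr_gt0.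
have lf := cf.1; have [cr ci] := ft_continuous cf.
have Ti0 : 0 < T^-1 by rewrite invr_gt0.
pose u xi := cabs2 (ft f xi).
have cu : continuous u.
  have -> : u = (fun xi => complex.Re (ft f xi) * complex.Re (ft f xi) +
                         complex.Im (ft f xi) * complex.Im (ft f xi)) by [].
  move=> x; apply: cvgD.
  - by apply: cvgM; exact: cr.
  - by apply: cvgM; exact: ci.
have u0 x : 0 <= u x by exact: cabs2_ge0.
have mu_ : measurable_fun [set: R] u by exact: continuous_measurable_fun.
have iK (p q : R) : rint (fun x => itv1 p q x * u x) by exact: rint_itv1_continuous.
pose S K s := \sum_(n <- zrange K) u (s + n%:~R * T^-1).
have SE K s : S K s = \sum_(n <- zrange K)
    cabs2 (L2inner (fun t => cexpi (- (2 * pi * s * t)) * f t) (em (- N) T n)).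
  by apply: eq_bigr => n _; rewrite ft_em.
have S_le K s : S K s <= T * nrm2 f.
  rewrite SE -(nrm2_modulate f s); apply: bessel => //; last exact: zrange_uniq.
  by have [] := L2c_modulate s cf.
have S_cvg s : S K s @[K --> \oo] --> T * nrm2 f.
  under eq_fun => K do rewrite SE.
  rewrite -(nrm2_modulate f s); have [l0 v0] := L2c_modulate s cf.
  by apply: parseval => // t; rewrite /T addKr; exact: v0.
have S0 K s : 0 <= S K s by apply: sumr_ge0.
have tile K : \int[mu]_x (itv1 (- (K%:R * T^-1)) (K.+1%:R * T^-1) x * u x) =
    \int[mu]_x (itv1 0 T^-1 x * S K x).
  rewrite -[LHS]/(\int[mu]_x _).
  (* Integrability of [u] is still unknown at this point, so tiling is applied to its cut-off; the
     extra indicator equals 1 on all the cells concerned. *)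
  have -> : \int[mu]_x (itv1 (- (K%:R * T^-1)) (K.+1%:R * T^-1) x * u x) =
     \int[mu]_x (itv1 (- (K%:R * T^-1)) (K.+1%:R * T^-1) x *
       (itv1 (- (K%:R * T^-1)) (K.+1%:R * T^-1) x * u x)).
    by apply: eq_Rintegral => x _; rewrite mulrA itv1_sqr.
  rewrite Rintegral_tile//; apply: eq_Rintegral => x _.
  rewrite itv1E; case: (boolP (_ && _)) => [/andP[x0 xT]|]; last by rewrite !mul0r.
  rewrite !mul1r big_seq [RHS]big_seq; apply: eq_bigr => j; rewrite mem_zrange => jK.
  rewrite itv1_in ?mul1r//; apply/andP; split.
    rewrite (@le_trans _ _ (j%:~R * T^-1))// ?lerDr// -mulNr ler_pM2r// -[_%:R]/(K%:Z%:~R) -intrN ler_int; lia.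
  apply: (@lt_le_trans _ _ (T^-1 + j%:~R * T^-1)); first by rewrite ltrD2r.
  rewrite -natr1 mulrDl mul1r addrC lerD2r ler_pM2r// -[_%:R]/(K%:Z%:~R) ler_int; lia.
have iS : rint (fun x => (T * nrm2 f) * itv1 0 T^-1 x) by apply: rintZ; exact: rint_itv1.
have [] := @dominated_cvgR R (fun K x => itv1 0 T^-1 x * S K x) (fun x => itv1 0 T^-1 x * (T * nrm2 f)) _ _ _ iS.
- move=> K; apply: measurable_funM; first exact: measurable_itv1.
  apply: measurable_sum => n; apply: (measurableT_comp mu_).
  by apply: measurable_funD => //; exact: measurable_cst.
- by move=> x; apply: cvgM; [exact: cvg_cst|exact: S_cvg].
- move=> K x; rewrite mulrC normrM (ger0_norm (S0 K x)).
  have i0 : 0 <= itv1 0 T^-1 x by rewrite itv1E ler0n.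
  by rewrite (ger0_norm i0) ler_wpM2r.
move=> _ hcvg.
have lim_val : \int[mu]_x (itv1 0 T^-1 x * (T * nrm2 f)) = nrm2 f.
  transitivity ((T * nrm2 f) * \int[mu]_x itv1 0 T^-1 x).
    rewrite -(@RintegralZl _ _ _ mu setT (itv1 0 T^-1) (T * nrm2 f))//; last exact: rint_itv1.
    by apply: eq_Rintegral => x _; rewrite mulrC.
  by rewrite Rintegral_itv1 ?ltW// subr0; field; rewrite gt_eqF.
rewrite lim_val in hcvg.
have iu : rint u.
  apply: (@rint_exhaust R T^-1 u (nrm2 f)) => // K; rewrite tile.
  have -> : nrm2 f = (T * nrm2 f) * \int[mu]_x itv1 0 T^-1 x.
    by rewrite Rintegral_itv1 ?ltW// subr0; field; rewrite gt_eqF.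
  rewrite -(@RintegralZl _ _ _ mu setT (itv1 0 T^-1) (T * nrm2 f))//; last exact: rint_itv1.
  apply: le_RintegralT => //.
    apply: (rint_le _ _ iS).
      apply: measurable_funM; first exact: measurable_itv1.
      apply: measurable_sum => n; apply: (measurableT_comp mu_).
      by apply: measurable_funD => //; exact: measurable_cst.
    move=> x; rewrite mulrC normrM (ger0_norm (S0 K x)).
    have i0 : 0 <= itv1 0 T^-1 x by rewrite itv1E ler0n.
    by rewrite (ger0_norm i0) ler_wpM2r.
  by move=> x; rewrite mulrC ler_wpM2r// itv1E ler0n.
split; first by apply/L2P; split=> //; exact: ft_cmeas cf.
have h := cvg_exhaust Ti0 iu u0.
have hc : (fun K => \int[mu]_x (itv1 (- (K%:R * T^-1)) (K.+1%:R * T^-1) x * u x)) =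
  (fun K => \int[mu]_x (itv1 0 T^-1 x * S K x)) by apply/funext => K; exact: tile.
by apply: (@cvg_unique _ (@Rhausdorff R) _ _ _ _ h); rewrite hc.
Qed.

End fourier_transform.

Section fourier_inversion.
Context {R : realType}.
Notation mu := (@lebesgue_measure R).
Implicit Types f g : R -> R[i].

Lemma ftZ N f (c : R[i]) xi : L2c N f -> ft (fun t => c * f t) xi = c * ft f xi.
Proof.
move=> cf; rewrite /ft -cintZ.
  by apply: eq_cint => t; rewrite mulrA.
apply: (@L2c_cintble _ N f _ 1 cf); last by move=> t; exact: cabs2_cexpi_le.
have := cmeas_expi (- (2 * pi * xi)).
by under eq_fun => t do rewrite mulNr.
Qed.

Lemma ftD N f g xi : L2c N f -> L2c N g -> ft (fun t => f t + g t) xi = ft f xi + ft g xi.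
Proof.
have me : cmeas (fun t => cexpi (- (2 * pi * xi * t))).
  have := cmeas_expi (- (2 * pi * xi)).
  by under eq_fun => t do rewrite mulNr.
move=> cf cg; rewrite /ft -cintD.
- by apply: eq_cint => t; rewrite mulrDl.
- by apply: (@L2c_cintble _ N f _ 1 cf) => // t; exact: cabs2_cexpi_le.
- by apply: (@L2c_cintble _ N g _ 1 cg) => // t; exact: cabs2_cexpi_le.
Qed.

Lemma L2cD N f g : L2c N f -> L2c N g -> L2c N (fun t => f t + g t).
Proof.
by move=> [lf f0] [lg g0]; split; [exact: L2D|move=> t h; rewrite f0// g0// addr0].
Qed.

Lemma L2cZ N f (c : R[i]) : L2c N f -> L2c N (fun t => c * f t).
Proof. by move=> [lf f0]; split; [exact: L2Z|move=> t h; rewrite f0// mulr0]. Qed.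

Lemma L2c_conj N f : L2c N f -> L2c N (fun t => (f t)^*).
Proof.
move=> [lf f0]; split; last by move=> t h; rewrite f0// rmorph0.
move/L2P : lf => [mf lf]; apply/L2P; split; first exact: cmeas_conj.
by under [X in rint X]eq_fun => t do rewrite cabs2_conj.
Qed.

Lemma L2c_le N N' f : N <= N' -> L2c N f -> L2c N' f.
Proof.
move=> NN [lf f0]; split=> // t h; apply: f0; apply: contra h => /andP[h1 h2].
by apply/andP; split; lra.
Qed.

(** Polarisation: the norm of a sum gives the real part, and replacing g by i g gives the imaginary
    part. *)
Lemma ip_plancherel N f g : 0 < N -> L2c N f -> L2c N g ->
  L2inner (ft f) (ft g) = L2inner f g.
Proof.
move=> N0 cf.
have re h : L2c N h -> complex.Re (L2inner (ft f) (ft h)) = complex.Re (L2inner f h).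
  move=> ch; have [lf nf] := plancherel N0 cf; have [lh nh] := plancherel N0 ch.
  have [_] := plancherel N0 (L2cD cf ch).
  have -> : ft (fun t => f t + h t) = (fun xi => ft f xi + ft h xi).
    by apply/funext => xi; rewrite (ftD _ cf ch).
  rewrite nrm2D// nf nh nrm2D; [|exact: cf.1|exact: ch.1].
  by move=> /addIr /addrI /mulfI; apply; rewrite pnatr_eq0.
move=> cg; apply: eqCP; first exact: re.
have := re _ (L2cZ 'i%C cg).
have -> : ft (fun t => 'i%C * g t) = (fun xi => 'i%C * ft g xi).
  by apply/funext => xi; rewrite (ftZ _ _ cg).
have lf := cf.1; have lg := cg.1.
have [lf' _] := plancherel N0 cf; have [lg' _] := plancherel N0 cg.
by rewrite !ipZr// !ReIm /= !mul0r !mulNr !opprK !mul1r !add0r.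
Qed.

(** Conjugation before and after changes the sign of the exponent, so the facts about [ft] carry
    over to the inverse transform. *)
Definition ift f (t : R) : R[i] := (ft (fun xi => (f xi)^*) t)^*.

Lemma iftE N f t : L2c N f -> ift f t = cint (fun xi => f xi * cexpi (2 * pi * t * xi)).
Proof.
move=> cf; rewrite /ift /ft -cint_conj.
  by apply: eq_cint => xi; rewrite rmorphM /= conjCK cexpi_conj opprK.
apply: (@L2c_cintble _ N _ _ 1 (L2c_conj cf)); last by move=> xi; exact: cabs2_cexpi_le.
have := cmeas_expi (- (2 * pi * t)).
by under eq_fun => s do rewrite mulNr.
Qed.

Lemma L2_conj f : L2 f -> L2 (fun t => (f t)^*).
Proof.
move=> /L2P[mf lf]; apply/L2P; split; first exact: cmeas_conj.
by under [X in rint X]eq_fun => t do rewrite cabs2_conj.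
Qed.

Lemma nrm2_conj f : nrm2 (fun t => (f t)^*) = nrm2 f.
Proof. by apply: eq_Rintegral => t _; rewrite cabs2_conj. Qed.

Lemma ip_conj f g : L2 f -> L2 g ->
  L2inner (fun t => (f t)^*) (fun t => (g t)^*) = (L2inner f g)^*.
Proof.
move=> lf lg; rewrite !L2innerE -cint_conj; last exact: cintbleM.
by apply: eq_cint => t; rewrite rmorphM.
Qed.

Lemma ift_plancherel N f : 0 < N -> L2c N f -> L2 (ift f) /\ nrm2 (ift f) = nrm2 f.
Proof.
move=> N0 cf; have [l n] := plancherel N0 (L2c_conj cf).
split; first exact: L2_conj.
by rewrite /ift nrm2_conj n nrm2_conj.
Qed.

Lemma ip_ift N f g : 0 < N -> L2c N f -> L2c N g -> L2inner (ift f) (ift g) = L2inner f g.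
Proof.
move=> N0 cf cg.
have [lf _] := plancherel N0 (L2c_conj cf); have [lg _] := plancherel N0 (L2c_conj cg).
rewrite /ift ip_conj// (ip_plancherel N0 (L2c_conj cf) (L2c_conj cg)).
by rewrite ip_conj ?conjCK//; [exact: cf.1|exact: cg.1].
Qed.

Lemma Rintegral_fubini (h : R -> R -> R) (p q : R -> R) :
  measurable_fun [set: R * R] (fun z => h z.1 z.2) ->
  (forall t, measurable_fun [set: R] (h t)) ->
  (forall x, measurable_fun [set: R] (h ^~ x)) ->
  rint p -> rint q -> (forall t, 0 <= p t) -> (forall t, 0 <= q t) ->
  (forall t x, `|h t x| <= p t * q x) ->
  \int[mu]_t \int[mu]_x h t x = \int[mu]_x \int[mu]_t h t x.
Proof.
move=> mh mt mx ip iq p0 q0 hpq.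
have i1 t : rint (h t) by apply: (rint_le _ (hpq t)) => //; exact: rintZ.
have i2 x : rint (h ^~ x).
  apply: (rint_le (v := fun t => q x * p t)) => [//|t|]; last exact: rintZ.
  by rewrite mulrC.
have mE : measurable_fun [set: R * R] (fun z => (h z.1 z.2)%:E) by exact/measurable_EFinP.
have ih : (mu \x mu)%E.-integrable [set: R * R] (fun z => (h z.1 z.2)%:E).
  apply/(integrable12ltyP mu mu mE) => /=.
  apply: (@le_lt_trans _ _ (\int[mu]_t (p t * \int[mu]_x q x)%:E)%E).
    apply: ge0_le_integral => //.
    - by move=> t _; apply: integral_ge0 => x _; rewrite lee_fin.
    - have := @measurable_fun_fubini_tonelli_F _ _ _ _ R mu (fun z => `|(h z.1 z.2)%:E|%E).
      by apply; [apply: measurableT_comp|].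
    - apply/measurable_EFinP; have := rint_meas (rintZ (\int[mu]_x q x) ip).
      by under eq_fun => t do rewrite mulrC.
    - move=> t _; rewrite -RintegralZl// -rint_fin; last exact: rintZ.
      apply: ge0_le_integral => //.
      + by apply/measurable_EFinP; apply: measurableT_comp => //; exact: mt.
      + by apply/measurable_EFinP; exact: rint_meas (rintZ _ iq).
      + by move=> x _; rewrite lee_fin.
  under eq_integral => t _ do rewrite mulrC.
  by rewrite rint_fin ?ltry//; exact: rintZ.
have := Fubini ih => /= H.
rewrite /Rintegral; congr fine; rewrite -[LHS]/(\int[mu]_t (\int[mu]_x h t x)%:E)%E.
rewrite -[RHS]/(\int[mu]_x (\int[mu]_t h t x)%:E)%E.
under eq_integral => t _ do rewrite -rint_fin//.
under [RHS]eq_integral => t _ do rewrite -rint_fin//.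
exact: H.
Qed.

(** Exchanging the two integrations moves the exponential from g to f. In [ift_dense] this duality
    takes the place of an inversion theorem. *)
Lemma ip_ift_fubini N M f g : L2c N f -> L2c M g -> L2inner f (ift g) = L2inner (ft f) g.
Proof.
move=> cf cg.
pose th (t x : R) := 2 * pi * t * x.
pose H t x := f t * (g x * cexpi (th t x))^*.
have me t : cmeas (fun x => cexpi (th t x)) by exact: cmeas_expi.
have me' x : cmeas (fun t => cexpi (th t x)).
  have := cmeas_expi (2 * pi * x); congr cmeas; apply/funext => t.
  by rewrite /th; congr cexpi; ring.
have mf := L2_meas cf.1; have mg := L2_meas cg.1.
have mHt t : cmeas (H t).
  by apply: cmeasM; [exact: cmeas_cst|apply: cmeas_conj; exact: cmeasM].
have mHx x : cmeas (H ^~ x).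
  apply: cmeasM => //; apply: cmeas_conj; apply: cmeasM; [exact: cmeas_cst|exact: me'].
have E1 : L2inner f (ift g) = cint (fun t => cint (H t)).
  apply: eq_cint => t; rewrite (iftE _ cg) -cint_conj.
    rewrite -cintZ//; have := @L2c_cintble _ M g (fun x => cexpi (th t x)) 1 cg (me t) (fun x => cabs2_cexpi_le _).
    move=> [ir ii]; split; first by under [X in rint X]eq_fun => x do rewrite Re_conj.
    by under [X in rint X]eq_fun => x do rewrite Im_conj -mulN1r; exact: rintZ.
  exact: (@L2c_cintble _ M g (fun x => cexpi (th t x)) 1 cg (me t) (fun x => cabs2_cexpi_le _)).
have E2 : L2inner (ft f) g = cint (fun x => cint (fun t => H t x)).
  apply: eq_cint => x; rewrite mulrC /ft -cintZ.
    apply: eq_cint => t; rewrite /H rmorphM /= cexpi_conj /th.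
    have -> : 2 * pi * t * x = 2 * pi * x * t by ring.
    by ring.
  apply: (@L2c_cintble _ N f _ 1 cf); last by move=> t; exact: cabs2_cexpi_le.
  have := cmeas_expi (- (2 * pi * x)).
  by under eq_fun => t do rewrite mulNr.
have [ifr ifi] := L2c_rint_Re cf; have [igr igi] := L2c_rint_Re cg.
pose p t := `|complex.Re (f t)| + `|complex.Im (f t)|.
pose q t := `|complex.Re (g t)| + `|complex.Im (g t)|.
have ia (u : R -> R) : rint u -> rint (fun t => `|u t|).
  by move=> iu; exact: (@integrable_norm _ _ _ mu setT u).
have ip : rint p by apply: rintD; exact: ia.
have iq : rint q by apply: rintD; exact: ia.
have mcos : measurable_fun [set: R * R] (fun z => cos (th z.1 z.2)).
  apply: (@measurableT_comp _ _ _ _ _ _ (@cos R)).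
    by apply: continuous_measurable_fun => x; exact: continuous_cos.
  apply: measurable_funM; last exact: measurable_snd.
  by apply: measurable_funM; [exact: measurable_cst|exact: measurable_fst].
have msin : measurable_fun [set: R * R] (fun z => sin (th z.1 z.2)).
  apply: (@measurableT_comp _ _ _ _ _ _ (@sin R)).
    by apply: continuous_measurable_fun => x; exact: continuous_sin.
  apply: measurable_funM; last exact: measurable_snd.
  by apply: measurable_funM; [exact: measurable_cst|exact: measurable_fst].
have m1 (u : R -> R) : measurable_fun [set: R] u -> measurable_fun [set: R * R] (fun z => u z.1).
  by move=> mu_; apply: measurableT_comp => //; exact: measurable_fst.
have m2 (u : R -> R) : measurable_fun [set: R] u -> measurable_fun [set: R * R] (fun z => u z.2).
  by move=> mu_; apply: measurableT_comp => //; exact: measurable_snd.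
have key (k a b : R) (x : R) y : `|a| <= 1 -> `|b| <= 1 -> `|x * a + y * b| <= `|x| + `|y| :> R.
  move=> a1 b1; apply: le_trans (ler_normD _ _) _.
  by rewrite !normrM lerD// ler_piMr.
have cabs_le (z : R[i]) : cabs z <= `|complex.Re z| + `|complex.Im z|.
  rewrite -(ler_pXn2r (n:=2))// ?nnegrE ?cabs_ge0 ?addr_ge0// sqr_cabs /cabs2.
  rewrite -[complex.Re z ^+ 2]real_normK ?num_real// -[complex.Im z ^+ 2]real_normK ?num_real//.
  by rewrite sqrrD addrAC lerDl mulrn_wge0// mulr_ge0.
have bnd t x : cabs (H t x) <= p t * q x.
  rewrite /H cabsM cabs_conj cabsM cabs_cexpi mulr1.
  by apply: ler_pM; rewrite ?cabs_ge0// cabs_le.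
(* Both parts of H have this shape, with (a, b) = (Re f, Im f) for the real part and (Im f, - Re f)
   for the imaginary part. *)
have mH (F : R[i] -> R) (a b : R -> R) : measurable_fun [set: R] a -> measurable_fun [set: R] b ->
    (forall t x, F (H t x) =
      a t * (complex.Re (g x) * cos (th t x) - complex.Im (g x) * sin (th t x)) +
      b t * (complex.Re (g x) * sin (th t x) + complex.Im (g x) * cos (th t x))) ->
    measurable_fun [set: R * R] (fun z => F (H z.1 z.2)).
  move=> ma mb FE; rewrite (_ : (fun z => _) = (fun z : R * R =>
     a z.1 * (complex.Re (g z.2) * cos (th z.1 z.2) - complex.Im (g z.2) * sin (th z.1 z.2)) +
     b z.1 * (complex.Re (g z.2) * sin (th z.1 z.2) + complex.Im (g z.2) * cos (th z.1 z.2)))).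
    have mr := m2 _ mg.1; have mi := m2 _ mg.2.
    apply: measurable_funD; apply: measurable_funM.
    + exact: m1.
    + by apply: measurable_funB; apply: measurable_funM.
    + exact: m1.
    + by apply: measurable_funD; apply: measurable_funM.
  by apply/funext => z; rewrite FE.
have p0 t : 0 <= p t by rewrite addr_ge0.
have q0 t : 0 <= q t by rewrite addr_ge0.
rewrite E1 E2; apply: eqCP; rewrite /cint /=.
- apply: (Rintegral_fubini _ _ _ ip iq p0 q0).
  + apply: (mH _ _ _ mf.1 mf.2) => t x.
    by rewrite /H !ReIm /=; ring.
  + by move=> t; exact: (mHt t).1.
  + by move=> x; exact: (mHx x).1.
  + by move=> t x; apply: le_trans (Re_le_cabs _) (bnd t x).
- apply: (Rintegral_fubini _ _ _ ip iq p0 q0).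
  + apply: (mH _ _ _ mf.2 (measurable_funN mf.1)) => t x.
    by rewrite /H !ReIm /=; ring.
  + by move=> t; exact: (mHt t).2.
  + by move=> x; exact: (mHx x).2.
  + by move=> t x; apply: le_trans (Im_le_cabs _) (bnd t x).
Qed.

End fourier_inversion.

(** * Density of inverse transforms of functions of bounded support *)

Section density.
Context {R : realType}.
Notation mu := (@lebesgue_measure R).
Implicit Types f g : R -> R[i].

Definition trunc (K : nat) f (t : R) : R[i] := (itv1 (- (K%:R * 1)) (K.+1%:R * 1) t)%:C%C * f t.

Lemma L2c_trunc K f : L2 f -> L2c K.+1%:R (trunc K f).
Proof.
move=> lf; split; first by apply: L2_indic => //; exact: measurable_itv.
move=> t h; rewrite /trunc itv1_out ?mul0r//; apply: contra h => /andP[h1 h2].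
have : K%:R <= K.+1%:R :> R by rewrite ler_nat.
by rewrite !mulr1 in h1 h2 => hK; apply/andP; split; lra.
Qed.

Lemma nrm2_trunc K f : nrm2 (trunc K f) =
  \int[mu]_x (itv1 (- (K%:R * 1)) (K.+1%:R * 1) x * cabs2 (f x)).
Proof. by apply: eq_Rintegral => x _; rewrite cabs2M cabs2_itv1. Qed.

Lemma cvg_nrm2_trunc f : L2 f -> nrm2 (trunc K f) @[K --> \oo] --> nrm2 f.
Proof.
move=> lf; under eq_fun => K do rewrite nrm2_trunc.
by apply: cvg_exhaust => //; [exact: L2_rint|move=> x; exact: cabs2_ge0].
Qed.

Lemma nrm2_trunc_sub K f : L2 f -> nrm2 (fun t => f t - trunc K f t) = nrm2 f - nrm2 (trunc K f).
Proof.
move=> lf; rewrite nrm2_trunc /nrm2 -RintegralB//; last 2 first.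
- exact: L2_rint.
- exact/rint_itv1M/L2_rint.
apply: eq_Rintegral => x _; rewrite /trunc itv1E; case: (_ && _); rewrite ?mul1r ?mul0r.
  by rewrite !subrr cabs2_0.
by rewrite !subr0.
Qed.

Lemma trunc_close f e : L2 f -> 0 < e ->
  exists2 K, nrm2 (fun t => f t - trunc K f t) < e & nrm2 f - e < nrm2 (trunc K f).
Proof.
move=> lf e0; have := cvg_nrm2_trunc lf => /(@cvgrPdist_lt _ R^o) /(_ _ e0) [K _ /(_ K (leqnn _))] /= h.
have {h} h : nrm2 f - nrm2 (trunc K f) < e by apply: le_lt_trans h; exact: ler_norm.
by exists K; rewrite ?nrm2_trunc_sub// ltrBlDr addrC -ltrBlDr.
Qed.

(** Truncate f to g, then truncate ft g to phi. Duality gives (g, ift phi) = (ft g, phi) =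
    ||phi||^2, hence ||g - ift phi||^2 = ||g||^2 - ||phi||^2, and by Plancherel this is ||ft g||^2 -
    ||phi||^2, the mass removed by the second truncation. *)
Lemma ift_dense f e : L2 f -> 0 < e ->
  exists (N : R) phi, [/\ 0 < N, L2c N phi & nrm2 (fun t => f t - ift phi t) < e].
Proof.
move=> lf e0; have e4 : 0 < e / 4 by rewrite divr_gt0.
have [K hK _] := trunc_close lf e4.
pose g := trunc K f; have cg : L2c K.+1%:R g by exact: L2c_trunc.
have K0 : 0 < K.+1%:R :> R by rewrite ltr0n.
have [lft nft] := plancherel K0 cg.
have [M _ hM] := trunc_close lft e4.
pose phi := trunc M (ft g); have cphi : L2c M.+1%:R phi by exact: L2c_trunc.
have M0 : 0 < M.+1%:R :> R by rewrite ltr0n.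
have [lif nif] := ift_plancherel M0 cphi.
exists M.+1%:R, phi; split=> //.
have hg : nrm2 (fun t => g t - ift phi t) < e / 4.
  rewrite nrm2B//; last exact: cg.1.
  rewrite (ip_ift_fubini cg cphi) nif.
  have -> : L2inner (ft g) phi = (nrm2 phi)%:C%C.
    rewrite -(ipff cphi.1).
    apply: eq_cint => x; rewrite /phi /trunc rmorphM /= mulrA [RHS]mulrA.
    have -> : ((itv1 (- (M%:R * 1)) (M.+1%:R * 1) x)%:C%C)^* = (itv1 (- (M%:R * 1)) (M.+1%:R * 1) x)%:C%C :> R[i].
      by apply: eqCP; rewrite !ReIm //= oppr0.
    by rewrite itv1E; case: (_ && _); rewrite ?mulr1 ?mul1r ?mulr0 ?mul0r.
  move: hM; rewrite -/phi nft /=.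
  by move: (nrm2 g) (nrm2 phi) => x y; lra.
have -> : (fun t => f t - ift phi t) = (fun t => (f t - g t) + (g t - ift phi t)).
  by apply/funext => t; rewrite addrA subrK.
apply: le_lt_trans (nrm2D_le _ _) _.
- by apply: L2B => //; exact: cg.1.
- by apply: L2B => //; exact: cg.1.
move: hK hg; rewrite -/g; move: (nrm2 _) (nrm2 _) => x y; lra.
Qed.

End density.

(** * The Fourier transform of the window *)

Section cauchy_kernel.
Context {R : realType}.
Notation mu := (@lebesgue_measure R).
Variable w : R.
Hypothesis w_lt0 : w < 0.

Definition ck (t : R) : R[i] := (t%:C - 'i * w%:C)%C^-1.

Lemma ck_den_neq0 t : (t%:C - 'i * w%:C)%C != 0 :> R[i].
Proof.
apply/eqP => /(congr1 (@complex.Im R)); rewrite ?ReIm /= !(mul0r, mul1r, add0r, addr0).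
by apply/eqP; rewrite oppr_eq0 lt_eqF.
Qed.

Lemma cabs2_ck t : cabs2 (ck t) = (t ^+ 2 + w ^+ 2)^-1.
Proof.
have h : cabs2 (ck t) * (t ^+ 2 + w ^+ 2) = 1.
  have -> : t ^+ 2 + w ^+ 2 = cabs2 (t%:C - 'i * w%:C)%C.
    by rewrite /cabs2 /=; ring.
  by rewrite -cabs2M mulVf ?ck_den_neq0// /cabs2 /= expr1n expr0n addr0.
have p : t ^+ 2 + w ^+ 2 != 0.
  by rewrite gt_eqF// ltr_wpDl ?sqr_ge0// exprn_even_gt0//= lt_eqF.
by apply: (mulIf p); rewrite h mulVf.
Qed.

Lemma ck_cmeas : cmeas ck.
Proof.
have ckE t : ck t = (t%:C + 'i * w%:C)%C * ((t ^+ 2 + w ^+ 2)^-1)%:C%C.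
  rewrite -cabs2_ck -mul_conjE; apply: (mulfI (ck_den_neq0 t)).
  have -> : (t%:C + 'i * w%:C)%C = ((t%:C - 'i * w%:C)%C)^* :> R[i].
    by apply: eqCP; rewrite ?ReIm /=; ring.
  have conj1 : ((t%:C - 'i * w%:C)%C)^* * (ck t)^* = 1 :> R[i].
    by rewrite -rmorphM /= mulfV ?ck_den_neq0// rmorph1.
  set d := (t%:C - 'i * w%:C)%C in conj1 *.
  have d1 : d * ck t = 1 by rewrite mulfV// ck_den_neq0.
  by rewrite d1 (_ : d * _ = (d * ck t) * (d^* * (ck t)^*)); [rewrite d1 conj1 mulr1|ring].
have -> : ck = fun t => (t%:C + 'i * w%:C)%C * ((t ^+ 2 + w ^+ 2)^-1)%:C%C by apply/funext.
apply: cmeasM.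
  apply: cmeasD; last exact: cmeas_cst.
  by apply: cmeas_real; exact: measurable_id.
have mc := @cmeas_cabs2 R (fun t => (t%:C - 'i * w%:C)%C).
apply: cmeas_real; apply: continuous_measurable_fun => t.
apply: cvgV.
  by rewrite gt_eqF// ltr_wpDl ?sqr_ge0// exprn_even_gt0//= lt_eqF.
by apply: cvgD; [exact: exprn_continuous|exact: cvg_cst].
Qed.

Lemma L2_ck : L2 ck.
Proof.
apply/L2P; split; first exact: ck_cmeas.
have W0 : 0 < w ^+ 2 by rewrite exprn_even_gt0//= lt_eqF.
have den t : 0 < t ^+ 2 + w ^+ 2 by rewrite ltr_wpDl ?sqr_ge0.
under [X in rint X]eq_fun => t do rewrite cabs2_ck.
have cu : continuous (fun t : R => (t ^+ 2 + w ^+ 2)^-1).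
  move=> t; apply: cvgV; first by rewrite gt_eqF.
  by apply: cvgD; [exact: exprn_continuous|exact: cvg_cst].
pose F t := w^-1 * atan (t / w).
have dF (t : R) : is_derive t (1:R) F ((t ^+ 2 + w ^+ 2)^-1).
  rewrite /F; apply: is_derive_eq; rewrite /GRing.scale /=.
  rewrite mulr0 add0r mulr1.
  have h1 : t ^+ 2 + w ^+ 2 != 0 by rewrite gt_eqF.
  by field; rewrite h1 lt_eqF.
(* Two values of the arctangent differ by less than pi, which bounds the increments of the primitive
   [F]. *)
apply: (@rint_exhaust R 1 _ (pi / `|w|)) => //.
- exact: continuous_measurable_fun.
- by move=> t; rewrite invr_ge0 ltW.
- by move=> K; exact: rint_itv1_continuous.
move=> K; rewrite (Rintegral_FTC _ cu dF); last first.
  have : 0 <= K%:R :> R by exact: ler0n.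
  by rewrite -natr1; lra.
rewrite /F -mulrBr (ltr0_norm w_lt0).
have := atan_gtNpi2 (K.+1%:R * 1 / w); have := atan_ltpi2 (- (K%:R * 1) / w).
move: (atan _) (atan _) => A B hB hA.
have -> : w^-1 * (A - B) = (B - A) / - w by rewrite invrN; ring.
by rewrite ler_pM2r ?invr_gt0 ?oppr_gt0//; lra.
Qed.

End cauchy_kernel.

Section kernel_transform.
Context {R : realType}.
Notation mu := (@lebesgue_measure R).
Variable w : R.
Hypothesis w_lt0 : w < 0.
Implicit Types f g phi : R -> R[i].
Notation ck := (ck w).

Lemma L2_tfshift x om f : L2 f -> L2 (tfshift x om f).
Proof.
move=> lf; apply: (@L2_bddM _ _ _ 1); last exact: L2_shift.
- exact: cmeas_expi.
- by move=> t; exact: cabs2_cexpi_le.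
Qed.

Lemma nrm2_tfshift x om f : L2 f -> nrm2 (tfshift x om f) = nrm2 f.
Proof.
move=> /L2_rint lf; rewrite -[RHS](Rintegral_shift x lf).
by apply: eq_Rintegral => t _; rewrite cabs2M cabs2_cexpi mul1r.
Qed.

(** The constant - 2 pi i makes 2 pi w + 2 pi i t equal to - kap (t - i w), so that kap times the
    integral of e^(2 pi w y) e^(2 pi i t y) over y >= 0 is [ck] at t. *)
Definition kap : R[i] := (0 -i* (2 * pi))%C.

(** The Fourier transform of the shifted kernel, cut off to the frequencies [om, om + M) so that
    [ift] applies to it. *)
Definition gam x om (M xi : R) : R[i] :=
  kap * ((itv1 om (om + M) xi * expR (2 * pi * w * (xi - om)))%:C%C *
         cexpi (- (2 * pi * x * (xi - om)))).

Lemma cmeas_gam x om M : cmeas (gam x om M).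
Proof.
apply: cmeasM; first exact: cmeas_cst.
apply: cmeasM.
  apply: cmeas_real; apply: measurable_funM; first exact: measurable_itv1.
  apply: measurableT_comp => //; apply: measurable_funM; first exact: measurable_cst.
  exact: measurable_funB.
apply: cmeas_cexpi; apply: measurable_funN; apply: measurable_funM; first exact: measurable_cst.
exact: measurable_funB.
Qed.

Lemma L2c_gam x om M N : - N <= om -> om + M <= N -> L2c N (gam x om M).
Proof.
move=> No MN; split.
  apply: (@L2_le _ _ (fun xi => cabs2 kap * itv1 om (om + M) xi)).
  - exact: cmeas_gam.
  - move=> xi; rewrite /gam !cabs2M cabs2_cexpi mulr1 ler_wpM2l ?cabs2_ge0//.
    rewrite cabs2_real exprMn expr2 itv1_sqr itv1E; case: (boolP (_ && _)) => [/andP[h _]|_].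
      rewrite mul1r expr_le1 ?expR_ge0// expR_le1.
      by rewrite mulr_le0_ge0 ?subr_ge0// mulr_ge0_le0 ?mulr_ge0 ?pi_ge0// ltW.
    by rewrite mul0r.
  - by apply: rintZ; exact: rint_itv1.
move=> t h; rewrite /gam itv1_out ?mul0r ?mulr0//; apply: contra h => /andP[h1 h2].
by apply/andP; split; lra.
Qed.

(** An exponential over an interval integrates in closed form. The lower endpoint yields the shifted
    kernel, the upper endpoint an error of relative size e^(2 pi w M), small for large M because w <
    0. *)
Lemma ift_gam x om M t : 0 < M -> ift (gam x om M) t =
  tfshift x om ck t - ((expR (2 * pi * w * M))%:C%C * cexpi (2 * pi * (t - x) * M)) * tfshift x om ck t.
Proof.
move=> M0; pose N := Num.max (- om) (om + M).
have cg : L2c N (gam x om M).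
  apply: L2c_gam; last by rewrite /N le_max lexx orbT.
  by rewrite lerNl /N le_max lexx.
rewrite (iftE _ cg).
have ig : cintble (fun xi => gam x om M xi * cexpi (2 * pi * t * xi)).
  by apply: (@L2c_cintble _ N _ _ 1 cg); [exact: cmeas_expi|move=> s; exact: cabs2_cexpi_le].
rewrite -(cint_shift (- om) ig).
pose h eta : R[i] := ((itv1 0 M eta * expR (2 * pi * w * eta))%:C * cexpi (2 * pi * (t - x) * eta))%C.
pose c : R[i] := kap * cexpi (2 * pi * om * t).
have gE : (fun eta => gam x om M (eta - - om) * cexpi (2 * pi * t * (eta - - om))) =
    (fun eta => c * h eta).
  apply/funext => eta; rewrite /gam opprK addrK /h /c.
  have -> : itv1 om (om + M) (eta + om) = itv1 0 M eta.
    by rewrite !itv1E [om + M]addrC ltrD2r lerDr.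
  rewrite -!mulrA; congr (_ * _); rewrite [RHS]mulrCA; congr (_ * _).
  by rewrite -!cexpiD; congr cexpi; ring.
have kne : kap != 0.
  apply/eqP => /(congr1 (@complex.Im R)) /= /eqP.
  by rewrite oppr_eq0 mulf_eq0 pnatr_eq0 /= gt_eqF// pi_gt0.
have cne : c != 0.
  rewrite mulf_neq0//; apply/eqP => h0; have := cabs2_cexpi (2 * pi * om * t).
  by rewrite h0 cabs2_0 => /esym/eqP; rewrite oner_eq0.
have ih : cintble h.
  have : cintble (fun eta => gam x om M (eta - - om) * cexpi (2 * pi * t * (eta - - om))).
    by case: ig => i1 i2; split; [exact: (rint_shift (- om) i1)|exact: (rint_shift (- om) i2)].
  rewrite gE => /(cintbleZ c^-1); congr cintble; apply/funext => eta.
  by rewrite mulrA mulVf// mul1r.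
transitivity (cint (fun eta => c * h eta)); first by rewrite -gE.
rewrite cintZ//.
have := cint_expi (2 * pi * w) (2 * pi * (t - x)) M0.
rewrite !mulr0 expR0 cexpi0 mulr1 -/h => e.
have d : ((2 * pi * w) +i* (2 * pi * (t - x)))%C = - kap * ((t - x)%:C - 'i * w%:C)%C.
  by apply: eqCP; rewrite !ReIm /=; ring.
have ci : kap * cint h = ck (t - x) * (1 - (expR (2 * pi * w * M))%:C%C * cexpi (2 * pi * (t - x) * M)).
  apply: (mulfI (ck_den_neq0 w_lt0 (t - x))); rewrite mulrA mulrA mulfV ?ck_den_neq0// mul1r.
  have := congr1 (fun z => - z) e; rewrite d opprB => <-.
  by ring.
by rewrite /c mulrAC ci /tfshift; ring.
Qed.

End kernel_transform.

Section inner_products.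
Context {R : realType}.
Notation mu := (@lebesgue_measure R).
Variable w : R.
Hypothesis w_lt0 : w < 0.
Implicit Types f g phi : R -> R[i].
Notation ck := (ck w).
Notation gam := (gam w).

Lemma expR_small (c C e : R) : 0 < c -> 0 <= C -> 0 < e ->
  exists2 M0, 0 < M0 & forall M, M0 <= M -> C * expR (- (c * M)) <= e.
Proof.
move=> c0 C0 e0; exists (C / (e * c) + 1).
  by rewrite ltr_wpDl// divr_ge0// mulr_ge0// ltW.
move=> M hM; rewrite expRN -ler_pdivlMr ?invr_gt0 ?expR_gt0// invrK.
have h : C <= e * (1 + c * M).
  have : C / (e * c) <= M by lra.
  rewrite ler_pdivrMr ?mulr_gt0// => h; nra.
by apply: (le_trans h); rewrite ler_pM2l// expR_ge1Dx.
Qed.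

Lemma conjM (x y : R[i]) : (x * y)^* = x^* * y^*.
Proof. by rewrite rmorphM. Qed.

(** The limit of [gam] as M grows. Its support is unbounded, so it is only paired with functions of
    bounded support. *)
Definition gami x om (xi : R) : R[i] :=
  kap * (((om <= xi)%R%:R * expR (2 * pi * w * (xi - om)))%:C%C *
         cexpi (- (2 * pi * x * (xi - om)))).

Lemma L2_tail (c : R[i]) (u : R) x om (f : R -> R[i]) : L2 f ->
  let h t := (c * cexpi (2 * pi * (t - x) * u)) * tfshift x om f t in
  L2 h /\ nrm2 h = cabs2 c * nrm2 f.
Proof.
move=> lf; have lt := L2_tfshift x om lf; split.
  apply: (@L2_bddM _ _ _ (cabs2 c)) => // [|t].
    apply: cmeasM; first exact: cmeas_cst.
    apply: cmeas_cexpi; apply: measurable_funM; last exact: measurable_cst.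
    by apply: measurable_funM; [exact: measurable_cst|exact: measurable_funB].
  by rewrite cabs2M cabs2_cexpi mulr1.
rewrite -(nrm2_tfshift x om lf) -nrm2Z//.
by apply: eq_Rintegral => t _; rewrite !cabs2M cabs2_cexpi mulr1.
Qed.

(** As soon as om + M >= N, the cut-off at om + M is invisible to phi, and [gam] may replace [gami].
    By [ift_gam] and Cauchy-Schwarz the remaining error decays exponentially in M. *)
Lemma ip_kernel N phi x om : 0 < N -> L2c N phi ->
  L2inner (ift phi) (tfshift x om ck) = cint (fun xi => phi xi * (gami x om xi)^*).
Proof.
move=> N0 cphi; set rhs := cint _.
have [lphi nphi] := ift_plancherel N0 cphi.
have lck := L2_ck w_lt0; have lk := L2_tfshift x om lck.
pose C := nrm2 phi * nrm2 ck.
have C0 : 0 <= C by rewrite mulr_ge0 ?nrm2_ge0.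
have bnd M : 0 < M -> N <= om + M ->
    cabs2 (L2inner (ift phi) (tfshift x om ck) - rhs) <= C * expR (- ((2 * pi * - w) * M)).
  move=> M0 NM; pose N' := Num.max N (Num.max (- om) (om + M)).
  have N'0 : 0 < N' by rewrite /N' lt_max N0.
  have cphi' : L2c N' phi by apply: L2c_le cphi; rewrite /N' le_max lexx.
  have cg : L2c N' (gam x om M).
    apply: L2c_gam => //; last by rewrite /N' !le_max lexx !orbT.
    by rewrite lerNl /N' !le_max lexx orbT.
  have -> : rhs = L2inner phi (gam x om M).
    apply: eq_cint => xi; have [h|h] := boolP (- N <= xi < N); last first.
      by rewrite (cphi.2 _ h) !mul0r.
    congr (_ * (_ * ((_ * _)%:C%C * _))^*); rewrite itv1E; congr ((nat_of_bool _)%:R).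
    move: h => /andP[h1 h2]; apply/idP/idP => [->|/andP[]//]; lra.
  rewrite -(ip_ift N'0 cphi' cg).
  pose E : R[i] := (expR (2 * pi * w * M))%:C%C.
  have [lt nt] := L2_tail E M x om lck.
  have -> : ift (gam x om M) = (fun t => tfshift x om ck t -
     (E * cexpi (2 * pi * (t - x) * M)) * tfshift x om ck t).
    by apply/funext => t; rewrite ift_gam.
  rewrite (ipDr lk (L2N lt) lphi) (ipNr lphi lt) opprD addrA subrr sub0r opprK.
  apply: le_trans (cauchy_schwarz _ _) _ => //.
  rewrite nphi nt /C -mulrA ler_wpM2l ?nrm2_ge0// mulrC ler_wpM2l ?nrm2_ge0//.
  rewrite cabs2_real mulrN mulNr opprK expr2 ler_piMr ?expR_ge0// expR_le1.
  by apply: mulr_le0_ge0; [apply: mulr_ge0_le0; [rewrite mulr_ge0 ?pi_ge0|exact: ltW]|exact: ltW].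
apply/eqP; rewrite -subr_eq0; apply/eqP/cabs2_eq0/eqP; rewrite eq_le cabs2_ge0 andbT.
apply/ler_addgt0Pl => e e0; rewrite addr0.
have c0 : 0 < 2 * pi * - w by rewrite !mulr_gt0 ?pi_gt0 ?oppr_gt0.
have [M0 M00 hM] := expR_small c0 C0 e0.
pose M := Num.max M0 (N - om).
have M0M : M0 <= M by rewrite /M le_max lexx.
apply: le_trans (bnd M _ _) (hM M M0M); first exact: lt_le_trans M0M.
by rewrite -lerBlDl /M le_max lexx orbT.
Qed.

(** Up to the factor conj(kap), the conjugate of the Fourier transform of [gfin]. *)
Definition Gfun (a : nat -> R[i]) (b : nat -> R) (s : seq nat) (y : R) : R[i] :=
  \sum_(k <- s) (a k)^* * ((b k <= y)%R%:R * expR (2 * pi * w * (y - b k)))%:C%C.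

(** The list s is arbitrary: initial segments give the approximations of the window, blocks
    [iota m d] their differences. *)
Definition gfin (a : nat -> R[i]) (b : nat -> R) (s : seq nat) (t : R) : R[i] :=
  (\sum_(k <- s) a k * cexpi (2 * pi * b k * t)) * ck t.

Lemma tfshift_gfin a b s x om t : tfshift x om (gfin a b s) t =
  \sum_(k <- s) (a k * cexpi (- (2 * pi * b k * x))) * tfshift x (om + b k) ck t.
Proof.
rewrite /tfshift /gfin mulrA mulr_sumr mulr_suml; apply: eq_bigr => k _.
have -> : cexpi (2 * pi * b k * (t - x)) = cexpi (2 * pi * b k * t) * cexpi (- (2 * pi * b k * x)).
  by rewrite -cexpiD; congr cexpi; ring.
have -> : cexpi (2 * pi * (om + b k) * t) = cexpi (2 * pi * om * t) * cexpi (2 * pi * b k * t).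
  by rewrite -cexpiD; congr cexpi; ring.
ring.
Qed.

Lemma cmeas_step (b0 : R) : cmeas (fun y => ((b0 <= y)%R%:R * expR (2 * pi * w * (y - b0)))%:C%C).
Proof.
apply: cmeas_real; apply: measurable_funM.
  have : measurable_fun [set: R] (\1_(`[b0, +oo[%classic) : R -> R) by exact: measurable_indic.
  congr measurable_fun; apply/funext => y.
  rewrite indicE; congr ((nat_of_bool _)%:R); apply/idP/idP => [/set_mem /=|h].
    by rewrite in_itv /= andbT.
  by apply/mem_set; rewrite /= in_itv /= andbT.
apply: measurableT_comp => //; apply: measurable_funM; first exact: measurable_cst.
exact: measurable_funB.
Qed.

Lemma step_le1 (b0 y : R) : 0 <= (b0 <= y)%R%:R * expR (2 * pi * w * (y - b0)) <= 1.
Proof.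
case: (boolP (b0 <= y)) => h; last by rewrite mul0r lexx ler01.
rewrite mul1r expR_ge0 expR_le1 mulr_le0_ge0 ?subr_ge0// mulr_ge0_le0 ?mulr_ge0 ?pi_ge0//.
exact: ltW.
Qed.

Lemma cmeas_sum (J : Type) (r : seq J) (F : J -> R -> R[i]) :
  (forall j, cmeas (F j)) -> cmeas (fun t => \sum_(j <- r) F j t).
Proof.
move=> mF; elim: r => [|j r ih].
  by under eq_fun => t do rewrite big_nil; exact: cmeas_cst.
by under eq_fun => t do rewrite big_cons; exact: cmeasD.
Qed.

Lemma cmeas_Gfun a b s om : cmeas (fun xi => Gfun a b s (xi - om)).
Proof.
apply: (@cmeas_comp _ (Gfun a b s)); first exact: measurable_funB.
by apply: cmeas_sum => k; apply: cmeasM; [exact: cmeas_cst|exact: cmeas_step].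
Qed.

Lemma cabs_Gfun_le a b s y : cabs (Gfun a b s y) <= \sum_(k <- s) cabs (a k).
Proof.
apply: le_trans (cabs_sum _ _ _) _; apply: ler_sum => k _.
rewrite cabsM cabs_conj cabs_real ler_piMr ?cabs_ge0//.
by have /andP[h0 h1] := step_le1 (b k) y; rewrite ger0_norm.
Qed.

Lemma L2c_Gfun N phi a b s om : L2c N phi -> L2c N (fun xi => phi xi * Gfun a b s (xi - om)).
Proof.
move=> [lp p0]; split; last by move=> t h; rewrite p0// mul0r.
under eq_fun => t do rewrite mulrC.
apply: (@L2_bddM _ _ _ ((\sum_(k <- s) cabs (a k)) ^+ 2)) => //; first exact: cmeas_Gfun.
move=> t; rewrite -sqr_cabs ler_pXn2r// ?nnegrE ?cabs_ge0 ?sumr_ge0// => [|k _].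
  exact: cabs_Gfun_le.
exact: cabs_ge0.
Qed.

Lemma cabs2_kap : cabs2 (kap : R[i]) = 4 * pi ^+ 2.
Proof. by rewrite /cabs2 /=; ring. Qed.

Lemma cint_sum (J : Type) (r : seq J) (F : J -> R -> R[i]) :
  (forall j, cintble (F j)) -> cint (fun t => \sum_(j <- r) F j t) = \sum_(j <- r) cint (F j).
Proof.
move=> iF.
have is_ : cintble (fun t => \sum_(j <- r) F j t).
  split.
    by under [X in rint X]eq_fun => t do rewrite Re_sum; apply: rint_sum => j _; exact: (iF j).1.
  by under [X in rint X]eq_fun => t do rewrite Im_sum; apply: rint_sum => j _; exact: (iF j).2.
apply: eqCP; rewrite ?Re_sum ?Im_sum /cint /=.
- rewrite -Rintegral_sum => [|j _]; last exact: (iF j).1.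
  by apply: eq_Rintegral => t _; rewrite Re_sum.
- rewrite -Rintegral_sum => [|j _]; last exact: (iF j).2.
  by apply: eq_Rintegral => t _; rewrite Im_sum.
Qed.

(** The phases in b_k x that come from shifting P and from moving the kernel to frequency om + b_k
    cancel, so k enters through [Gfun] only. The factor 4 pi^2 is |kap|^2. *)
Lemma cabs2_ip_gfin N phi a b s x om : 0 < N -> L2c N phi ->
  cabs2 (L2inner (ift phi) (tfshift x om (gfin a b s))) =
  4 * pi ^+ 2 * cabs2 (cint (fun xi => (phi xi * Gfun a b s (xi - om)) * cexpi (2 * pi * x * xi))).
Proof.
move=> N0 cphi; have [lphi _] := ift_plancherel N0 cphi.
have lk om' := L2_tfshift x om' (L2_ck w_lt0).
have -> : tfshift x om (gfin a b s) =
    (fun t => \sum_(k <- s) (a k * cexpi (- (2 * pi * b k * x))) * tfshift x (om + b k) ck t).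
  by apply/funext => t; exact: tfshift_gfin.
rewrite ip_sumr//; last by move=> k _; apply: L2Z; exact: lk.
pose m k xi : R[i] := (a k)^* * ((b k <= xi - om)%R%:R * expR (2 * pi * w * (xi - om - b k)))%:C%C
  * cexpi (2 * pi * x * xi).
have iphim k : cintble (fun xi => phi xi * m k xi).
  apply: (@L2c_cintble _ N phi (m k) (cabs2 (a k)) cphi).
    apply: cmeasM; last exact: cmeas_expi.
    apply: cmeasM; first exact: cmeas_cst.
    by apply: (@cmeas_comp _ (fun y => ((b k <= y)%R%:R * expR (2 * pi * w * (y - b k)))%:C%C)
      (fun xi => xi - om)); [exact: measurable_funB|exact: cmeas_step].
  move=> xi; rewrite !cabs2M cabs2_cexpi mulr1 cabs2_conj ler_piMr ?cabs2_ge0// cabs2_real.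
  by have /andP[h0 h1] := step_le1 (b k) (xi - om); rewrite expr_le1.
have -> : \sum_(k <- s) L2inner (ift phi) (fun t => (a k * cexpi (- (2 * pi * b k * x))) * tfshift x (om + b k) ck t) =
    \sum_(k <- s) (kap^* * cexpi (- (2 * pi * om * x))) * cint (fun xi => phi xi * m k xi).
  apply: eq_bigr => k _; rewrite (ipZr _ (lk _) lphi).
  rewrite (ip_kernel _ _ N0 cphi) -!cintZ.
  - apply: eq_cint => xi; rewrite /gami /m !conjM !cexpi_conj !opprK.
    have -> : (((om + b k <= xi)%R%:R * expR (2 * pi * w * (xi - (om + b k))))%:C%C)^* =
       ((b k <= xi - om)%R%:R * expR (2 * pi * w * (xi - om - b k)))%:C%C :> R[i].
      apply: eqCP; rewrite !ReIm /= ?oppr0// opprD addrA; congr ((nat_of_bool _)%:R * _).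
      by rewrite lerBrDl.
    have -> : cexpi (2 * pi * x * (xi - (om + b k))) =
        cexpi (- (2 * pi * om * x)) * cexpi (- (2 * pi * b k * x)) * cexpi (2 * pi * x * xi).
      by rewrite -!cexpiD; congr cexpi; ring.
    rewrite (_ : cexpi (- (2 * pi * b k * x)) = (cexpi (2 * pi * b k * x))^*); last by rewrite cexpi_conj.
    have hu : cexpi (2 * pi * b k * x) * (cexpi (2 * pi * b k * x))^* = 1.
      by rewrite mul_conjE cabs2_cexpi.
    move: hu; move: (cexpi (2 * pi * b k * x)) => u hu.
    rewrite -[RHS]mul1r -hu; ring.
  - exact: iphim.
  - apply: (@L2c_cintble _ N phi (fun xi => (gami x (om + b k) xi)^*) (cabs2 (kap : R[i])) cphi).
      apply: cmeas_conj; apply: cmeasM; first exact: cmeas_cst.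
      apply: cmeasM; first exact: cmeas_step.
      apply: cmeas_cexpi; apply: measurable_funN; apply: measurable_funM; first exact: measurable_cst.
      exact: measurable_funB.
    move=> xi; rewrite cabs2_conj !cabs2M cabs2_cexpi mulr1 ler_piMr ?cabs2_ge0// cabs2_real.
    by have /andP[h0 h1] := step_le1 (om + b k) xi; rewrite expr_le1.
rewrite -mulr_sumr cabs2M cabs2M cabs2_conj cabs2_cexpi cabs2_kap mulr1 -cint_sum.
  congr (_ * cabs2 _); apply: eq_cint => xi.
  by rewrite -mulr_sumr -mulrA; congr (_ * _); rewrite /Gfun mulr_suml.
exact: iphim.
Qed.

End inner_products.

(** * Frame bounds on fibers *)

Section samples.
Context {R : realType}.
Notation mu := (@lebesgue_measure R).
Variables (T : R) (J : nat).
Hypothesis T_gt0 : 0 < T.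
Implicit Types Phi : R -> R[i].

Definition periodize Phi (t : R) : R[i] :=
  (itv1 0 T t)%:C%C * \sum_(j <- zrange J) Phi (t + j%:~R * T).

Lemma L2_periodize Phi : L2 Phi -> L2 (periodize Phi).
Proof.
move=> lP; apply: L2_indic; first exact: measurable_itv.
apply: L2_sum => j _; have := L2_shift (- (j%:~R * T)) lP.
by under eq_fun => t do rewrite opprK.
Qed.

Lemma L2c_wide Phi (t : R) : L2c (J%:R * T) Phi ->
  (itv1 (- (J%:R * T)) (J.+1%:R * T) t)%:C%C * Phi t = Phi t.
Proof.
move=> [_ h]; have [h1|h1] := boolP (- (J%:R * T) <= t < J%:R * T).
  rewrite itv1_in ?mul1r//; move: h1 => /andP[-> h1] /=.
  by apply: lt_le_trans h1 _; rewrite ler_pM2r// ler_nat.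
by rewrite (h _ h1) mulr0.
Qed.

(** Sampling at the points n/T sees only the periodisation with period T, because e^(2 pi i n j) =
    1. The sign of n comes from the conjugate in the inner product. *)
Lemma sampleE Phi (n : int) : L2c (J%:R * T) Phi ->
  cint (fun xi => Phi xi * cexpi (2 * pi * (n%:~R / T) * xi)) =
  L2inner (periodize Phi) (em 0 T (- n)).
Proof.
move=> cP; pose h xi := Phi xi * cexpi (2 * pi * (n%:~R / T) * xi).
have ih : cintble h.
  apply: (@L2c_cintble _ _ Phi _ 1 cP); first exact: cmeas_expi.
  by move=> t; exact: cabs2_cexpi_le.
transitivity (cint (fun xi => (itv1 (- (J%:R * T)) (J.+1%:R * T) xi)%:C%C * h xi)).
  by apply: eq_cint => xi; rewrite /h mulrA L2c_wide.
rewrite cint_tile// L2innerE; apply: eq_cint => t.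
rewrite em_conj opprK /em add0r /periodize /h.
rewrite [RHS]mulrACA -rmorphM /= itv1_sqr; congr (_ * _).
rewrite mulr_suml; apply: eq_bigr => j _; congr (_ * _).
have -> : 2 * pi * (n%:~R / T) * (t + j%:~R * T) =
    2 * pi * (n%:~R / T) * t + 2 * pi * (n * j)%:~R :> R.
  by rewrite intrM; field; rewrite gt_eqF.
by rewrite cexpi_period.
Qed.

Lemma samples_le Phi (s : seq int) : L2c (J%:R * T) Phi -> uniq s ->
  \sum_(n <- s) cabs2 (cint (fun xi => Phi xi * cexpi (2 * pi * (n%:~R / T) * xi)))
    <= T * nrm2 (periodize Phi).
Proof.
move=> cP us; under eq_bigr => n _ do rewrite (sampleE _ cP).
rewrite -(big_map (fun n => - n) xpredT (fun n => cabs2 (L2inner (periodize Phi) (em 0 T n)))).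
apply: bessel => //; first exact: L2_periodize cP.1.
by rewrite (map_inj_uniq (@oppr_inj _)).
Qed.

Lemma sum_zrangeN (K : nat) (F : int -> R) :
  \sum_(n <- zrange K) F (- n) = \sum_(n <- zrange K) F n.
Proof.
rewrite -(big_map (fun n => - n) xpredT F); apply: perm_big.
apply: uniq_perm; [|exact: zrange_uniq|].
  by rewrite (map_inj_uniq (@oppr_inj _)) zrange_uniq.
move=> n; rewrite -{1}(opprK n) mem_map; last exact: oppr_inj.
by rewrite !mem_zrange normrN.
Qed.

Lemma samples_ge Phi (e : R) : L2c (J%:R * T) Phi -> 0 < e ->
  exists K, T * nrm2 (periodize Phi) <=
  \sum_(n <- zrange K) cabs2 (cint (fun xi => Phi xi * cexpi (2 * pi * (n%:~R / T) * xi))) + e.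
Proof.
move=> cP e0; have lp := L2_periodize cP.1.
have vp t : ~~ (0 <= t < 0 + T) -> periodize Phi t = 0.
  by rewrite add0r => h; rewrite /periodize itv1_out// mul0r.
have := parseval T_gt0 lp vp => /(@cvgrPdist_le _ R^o) /(_ _ e0) [K _ /(_ K (leqnn _))] /= h.
exists K; under eq_bigr => n _ do rewrite (sampleE _ cP).
rewrite (sum_zrangeN K (fun n => cabs2 (L2inner (periodize Phi) (em 0 T n)))).
by rewrite -lerBlDl; apply: le_trans h; exact: ler_norm.
Qed.

Lemma nrm2_tile Phi : L2c (J%:R * T) Phi ->
  nrm2 Phi = \int[mu]_t (itv1 0 T t * \sum_(j <- zrange J) cabs2 (Phi (t + j%:~R * T))).
Proof.
move=> cP; rewrite -(@Rintegral_tile _ T J (fun t => cabs2 (Phi t)))//; last exact: L2_rint cP.1.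
by apply: eq_Rintegral => t _; rewrite -{1}(L2c_wide t cP) cabs2M cabs2_itv1.
Qed.

Lemma nrm2_periodize Phi : nrm2 (periodize Phi) =
  \int[mu]_t (itv1 0 T t * cabs2 (\sum_(j <- zrange J) Phi (t + j%:~R * T))).
Proof. by apply: eq_Rintegral => t _; rewrite cabs2M cabs2_itv1. Qed.

Lemma rint_tile_cabs2 Phi : L2 Phi ->
  rint (fun t => itv1 0 T t * \sum_(j <- zrange J) cabs2 (Phi (t + j%:~R * T))).
Proof.
move=> lP; apply: rint_itv1M; apply: rint_sum => j _.
have := rint_shift (- (j%:~R * T)) (L2_rint lP).
by under eq_fun => t do rewrite opprK.
Qed.

Lemma rint_periodize Phi : L2 Phi ->
  rint (fun t => itv1 0 T t * cabs2 (\sum_(j <- zrange J) Phi (t + j%:~R * T))).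
Proof.
move=> lP; have := L2_rint (L2_periodize lP); congr rint; apply/funext => t.
by rewrite cabs2M cabs2_itv1.
Qed.

End samples.

Section schur.
Context {R : realType}.
Variable th : R.
Hypothesis th_gt0 : 0 < th.

Lemma geo_gt0 (d : R) : 0 < d -> 0 < 1 - expR (- (th * d)).
Proof. by move=> d0; rewrite subr_gt0 expR_lt1 oppr_lt0 mulr_gt0. Qed.

(** Telescoping: for psi(y) = e^(- th max(y, 0)), each term multiplied by 1 - e^(- th d) is at most
    psi(y) - psi(y + d), and psi takes values in [0, 1]. The bound depends on neither x nor K. *)
Lemma geo_sum (d x : R) (K : nat) : 0 < d ->
  \sum_(j <- zrange K) (0 <= x + j%:~R * d)%R%:R * expR (- (th * (x + j%:~R * d)))
    <= (1 - expR (- (th * d)))^-1.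
Proof.
move=> d0; have q0 := geo_gt0 d0.
rewrite -[leRHS]mul1r ler_pdivlMr// mulr_suml.
pose psi (y : R) := expR (- (th * Num.max y 0)).
have step y : (0 <= y)%R%:R * expR (- (th * y)) * (1 - expR (- (th * d))) <= psi y - psi (y + d).
  rewrite /psi; case: (lerP 0 y) => y0.
    rewrite !max_l//; last by rewrite addr_ge0// ltW.
    by rewrite mul1r mulrBr mulr1 -expRD mulrDr opprD.
  rewrite !mul0r subr_ge0 ler_expR lerN2 ler_pM2l//.
  by rewrite le_max lexx orbT.
apply: (@le_trans _ _ (\sum_(j <- zrange K) (psi (x + j%:~R * d) - psi (x + j%:~R * d + d)))).
  by apply: ler_sum => j _; exact: step.
rewrite /zrange big_map -[iota 0 _]/(index_iota 0 (2 * K).+1).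
rewrite (eq_bigr (fun i => psi (x + (i%:R - K%:R) * d) - psi (x + (i.+1%:R - K%:R) * d))); last first.
  move=> i _; rewrite intrD intrN /=; congr (_ - psi _).
  by rewrite -natr1; ring.
rewrite -[leLHS]opprK -sumrN.
rewrite (eq_bigr (fun i => psi (x + (i.+1%:R - K%:R) * d) - psi (x + (i%:R - K%:R) * d))); last first.
  by move=> i _; rewrite opprB.
rewrite telescope_sumr// opprB.
have p1 y : psi y <= 1 by rewrite /psi expR_le1 oppr_le0 mulr_ge0 ?(ltW th_gt0)// le_max lexx orbT.
have p0 y : 0 <= psi y by exact: expR_ge0.
by have := p1 (x + (0%:R - K%:R) * d); have := p0 (x + ((2 * K).+1%:R - K%:R) * d); lra.
Qed.

(* Schur's test for the kernel [1_(x_j >= beta m) e^(- th (x_j - beta m))] *)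
Lemma schur_upper (be T x A : R) (G : R -> R[i]) (phi : int -> R[i]) (J K : nat) :
  0 < be -> 0 < T -> 0 <= A ->
  (forall y, cabs (G y) <= A * ((0 <= y)%R%:R * expR (- (th * y)))) ->
  \sum_(m <- zrange K) cabs2 (\sum_(j <- zrange J) phi j * G (x + j%:~R * T - be * m%:~R)) <=
  A ^+ 2 * ((1 - expR (- (th * T)))^-1 * (1 - expR (- (th * be)))^-1) *
    \sum_(j <- zrange J) cabs2 (phi j).
Proof.
move=> be0 T0 A0 GA.
set C1 := (1 - expR (- (th * T)))^-1; set C2 := (1 - expR (- (th * be)))^-1.
have C10 : 0 <= C1 by rewrite invr_ge0 ltW// geo_gt0.
pose k m j : R := (0 <= x + j%:~R * T - be * m%:~R)%R%:R *
   expR (- (th * (x + j%:~R * T - be * m%:~R))).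
have k0 m j : 0 <= k m j by rewrite mulr_ge0 ?ler0n ?expR_ge0.
have row m : \sum_(j <- zrange J) k m j <= C1.
  have := @geo_sum T (x - be * m%:~R) J T0; congr (_ <= _).
  by apply: eq_bigr => j _; rewrite /k addrAC.
have col j : \sum_(m <- zrange K) k m j <= C2.
  rewrite -sum_zrangeN; have := @geo_sum be (x + j%:~R * T) K be0; congr (_ <= _).
  by apply: eq_bigr => m _; rewrite /k mulrNz mulrN opprK [m%:~R * be]mulrC.
have cs m : cabs2 (\sum_(j <- zrange J) phi j * G (x + j%:~R * T - be * m%:~R)) <=
    A ^+ 2 * C1 * \sum_(j <- zrange J) k m j * cabs2 (phi j).
  (* Cauchy-Schwarz with weights u, by induction on the list. *)
  have sq (I : eqType) (r : seq I) (u v : I -> R) : (forall i, 0 <= u i) ->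
      (\sum_(i <- r) u i * v i) ^+ 2 <= (\sum_(i <- r) u i) * \sum_(i <- r) u i * v i ^+ 2.
    move=> u0; elim: r => [|i r ih]; first by rewrite !big_nil mulr0 expr0n.
    rewrite !big_cons; set a := \sum_(_ <- r) u _ in ih *.
    set b := \sum_(_ <- r) _ * _ in ih *; set c := \sum_(_ <- r) _ * _ ^+ 2 in ih *.
    have a0 : 0 <= a by apply: sumr_ge0.
    (* If the total weight a vanishes, so does b. Otherwise multiply by a and combine b^2 <= a c
       with (b - a v)^2 >= 0. *)
    have key : 2 * (v i * b) <= c + a * v i ^+ 2.
      have [az|an] := eqVneq a 0.
        have -> : b = 0.
          by move: ih; rewrite az mul0r => h; apply/eqP; rewrite -sqrf_eq0 eq_le h sqr_ge0.
        rewrite az mul0r mulr0 mulr0 addr0; apply: sumr_ge0 => j' _.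
        by rewrite mulr_ge0 ?sqr_ge0.
      have ap : 0 < a by rewrite lt_neqAle eq_sym an.
      rewrite -(ler_pM2l ap); have := sqr_ge0 (b - a * v i); nra.
    have := u0 i; nra.
  have ga : cabs (\sum_(j <- zrange J) phi j * G (x + j%:~R * T - be * m%:~R)) <=
      A * \sum_(j <- zrange J) k m j * cabs (phi j).
    apply: le_trans (cabs_sum _ _ _) _; rewrite mulr_sumr; apply: ler_sum => j _.
    by rewrite cabsM mulrC mulrA ler_wpM2r ?cabs_ge0.
  rewrite -sqr_cabs; apply: (@le_trans _ _ ((A * \sum_(j <- zrange J) k m j * cabs (phi j)) ^+ 2)).
    rewrite ler_pXn2r// nnegrE ?cabs_ge0// mulr_ge0// sumr_ge0// => j _.
    by rewrite mulr_ge0// cabs_ge0.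
  rewrite exprMn -mulrA ler_wpM2l ?sqr_ge0//.
  apply: le_trans (sq _ _ _ _ (k0 m)) _; have -> : \sum_(j <- zrange J) k m j * cabs (phi j) ^+ 2 = \sum_(j <- zrange J) k m j * cabs2 (phi j).
    by apply: eq_bigr => j _; rewrite sqr_cabs.
  rewrite ler_wpM2r// sumr_ge0// => j _.
  by rewrite mulr_ge0// cabs2_ge0.
apply: le_trans (ler_sum _ (fun m _ => cs m)) _.
rewrite -mulr_sumr exchange_big /= mulrA -[leRHS]mulrA ler_wpM2l//.
  by rewrite mulr_ge0// sqr_ge0.
rewrite mulr_sumr; apply: ler_sum => j _; rewrite -mulr_suml.
by rewrite ler_wpM2r// cabs2_ge0.
Qed.

End schur.

Section int_order.
Implicit Types i j m : int.

Lemma lez_pred i j : i < j -> i <= j - 1. Proof. lia. Qed.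

Lemma normz_le j (J : nat) : `|j| <= J%:Z -> - J%:Z <= j /\ j <= J%:Z. Proof. lia. Qed.

Lemma normz_leP m (K : nat) : - K%:Z <= m -> m <= K%:Z -> `|m| <= K%:Z. Proof. lia. Qed.

Lemma addz1_le j : (j + 1 <= j) = false. Proof. lia. Qed.

Lemma addz1_le_neq i j : i != j -> (j + 1 <= i) = (j <= i). Proof. lia. Qed.

Lemma lez_add1 j : j <= j + 1. Proof. lia. Qed.

End int_order.

Section lower_fiber.
Context {R : realType}.
Variables (w : R) (a : nat -> R[i]) (b : nat -> R) (n : nat) (rho : R).
Hypothesis w_lt0 : w < 0.
Hypothesis a0 : a 0%N = 1.
Hypothesis b0 : b 0%N = 0.
Hypothesis b_gt0 : forall k, (1 <= k)%N -> 0 < b k.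
Let th : R := 2 * pi * - w.
Hypothesis rho_lt1 : rho < 1.
Hypothesis sum_rho : \sum_(1 <= k < n.+1) cabs (a k) * expR (th * b k) <= rho.

Variables (T be x : R) (J K : nat) (phi : int -> R[i]).
Hypothesis be_gt0 : 0 < be.
Hypothesis beT : be <= T.
Hypothesis x_itv : 0 <= x < T.
Hypothesis JK : J.+1%:R * T <= K%:R * be.

Let th0 : 0 < th. Proof. by rewrite !mulr_gt0 ?pi_gt0 ?oppr_gt0. Qed.
Let T0 : 0 < T. Proof. exact: lt_le_trans be_gt0 beT. Qed.

Let xs (j : int) : R := x + j%:~R * T.
Let F j : R[i] := phi j * (expR (- (th * xs j)))%:C%C.
Let S (y : R) : R[i] := \sum_(j <- zrange J) (y <= xs j)%R%:R%:C%C * F j.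
Let v (m : int) : R[i] := \sum_(j <- zrange J) phi j * Gfun w a b (iota 0 n.+1) (xs j - be * m%:~R).
Let u (m : int) : R[i] := v m * (expR (- (th * (be * m%:~R))))%:C%C.

Let xs_le i j : (xs i <= xs j) = (i <= j).
Proof. by rewrite lerD2l ler_pM2r// ler_int. Qed.

(** The exponential splits into factors in x_j, beta m and b_k. The first enters [F], the second
    cancels against the weight in [u], and the third is left beside a_k. *)
Let uE m : u m = \sum_(k <- iota 0 n.+1) ((a k)^* * (expR (th * b k))%:C%C) * S (be * m%:~R + b k).
Proof.
rewrite /u /v mulr_suml.
under [RHS]eq_bigr => k _ do rewrite mulr_sumr.
rewrite [RHS]exchange_big /=; apply: eq_bigr => j _.
rewrite /Gfun mulrAC mulr_sumr; apply: eq_bigr => k _.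
have -> : (b k <= xs j - be * m%:~R) = (be * m%:~R + b k <= xs j).
  by rewrite lerBrDl.
case: (_ <= _); last by rewrite !mul0r !mulr0 ?mul0r.
rewrite !mul1r /F.
have -> : 2 * pi * w * (xs j - be * m%:~R - b k) = - (th * xs j) + th * (be * m%:~R) + th * b k.
  by rewrite /th; ring.
have : expR (th * (be * m%:~R)) * expR (- (th * (be * m%:~R))) = 1 by rewrite expRN mulfV// gt_eqF// expR_gt0.
rewrite !expRD; move: (expR (th * (be * m%:~R))) (expR (- (th * (be * m%:~R)))) (expR (th * b k)) (expR (- (th * xs j))) => p q r s pq.
have -> : (s * p * r)%:C%C = s%:C%C * p%:C%C * r%:C%C :> R[i] by rewrite !rmorphM.
have pqC : p%:C%C * q%:C%C = 1 :> R[i] by rewrite -rmorphM /= pq.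
have -> : phi j * q%:C%C * ((a k)^* * (s%:C%C * p%:C%C * r%:C%C)) =
  (p%:C%C * q%:C%C) * (phi j * (a k)^* * s%:C%C * r%:C%C) by ring.
rewrite pqC; ring.
Qed.

Let uS m : u m = S (be * m%:~R) +
  \sum_(1 <= k < n.+1) ((a k)^* * (expR (th * b k))%:C%C) * S (be * m%:~R + b k).
Proof.
rewrite uE -[iota 0 n.+1]/(index_iota 0 n.+1) big_ltn//.
by rewrite a0 b0 mulr0 expR0 addr0 rmorph1 !mul1r.
Qed.

Let eqS y y' : (forall j, (y <= xs j) = (y' <= xs j)) -> S y = S y'.
Proof. by move=> h; apply: eq_bigr => j _; rewrite h. Qed.

Let S_tail y : xs J%:Z < y -> S y = 0.
Proof.
move=> h; rewrite /S big_seq big1// => j; rewrite mem_zrange => jJ.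
rewrite (_ : (y <= xs j) = false) ?mul0r//; apply/negbTE; rewrite -ltNge.
by apply: le_lt_trans h; rewrite xs_le; have [] := normz_le jJ.
Qed.

(** [S] is constant on each interval ]x_(j-1), x_j]. Its length T is at least beta, so it contains a
    multiple of beta: this is where alpha beta <= 1 enters. If beta m0 lies beyond x_(j-1), m0
    itself serves; otherwise the first multiple beyond x_(j-1) does, and it has m >= m0. *)
Let pick y (m0 : int) : be * m0%:~R <= y -> y <= xs J%:Z ->
  exists m : int, [/\ m0 <= m, be * m%:~R <= xs J%:Z & S (be * m%:~R) = S y].
Proof.
move=> my yJ; pose j : int := Num.ceil ((y - x) / T).
have /andP[j1 j2] := ceil_itv ((y - x) / T); rewrite -/j in j1 j2.
have yj : y <= xs j by rewrite /xs -lerBlDl -ler_pdivrMr.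
have jy : xs (j - 1) < y by rewrite /xs -ltrBrDl -ltr_pdivlMr.
have jJ : j <= J.
  by rewrite -ltzD1 -ltrBlDr -(ltr_int R) -(ltr_pM2r T0) -(ltrD2l x); exact: lt_le_trans jy yJ.
have const y' : xs (j - 1) < y' -> y' <= xs j -> S y' = S y.
  move=> h1 h2; apply: eqS => i; have [ij|ji] := leP j i.
    by rewrite (le_trans h2) ?xs_le// (le_trans yj) ?xs_le.
  have ij : xs i <= xs (j - 1) by rewrite xs_le; exact: lez_pred.
  by rewrite !leNgt (le_lt_trans ij h1) (le_lt_trans ij jy).
have [h|h] := ltP (xs (j - 1)) (be * m0%:~R).
  exists m0; split=> //; first exact: le_trans my yJ.
  by apply: const => //; exact: le_trans my yj.
pose m : int := Num.floor (xs (j - 1) / be) + 1.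
have /andP[m1 m2] := floor_itv (xs (j - 1) / be); rewrite -/m in m2.
have m3 : xs (j - 1) < be * m%:~R by rewrite mulrC -ltr_pdivrMr.
have m4 : be * m%:~R <= xs j.
  have : be * (Num.floor (xs (j - 1) / be))%:~R <= xs (j - 1) by rewrite mulrC -ler_pdivlMr.
  rewrite /m intrD mulrDr mulr1.
  have -> : xs j = xs (j - 1) + T by rewrite /xs intrB; ring.
  by move=> h'; have := lerD h' beT.
exists m; split; last exact: const.
  by rewrite -(ler_int R) -(ler_pM2l be_gt0) ltW// (le_lt_trans h m3).
by apply: le_trans m4 _; rewrite xs_le.
Qed.

(** Absorption in the supremum E of |S| over y >= beta m0, finite because [S] is a finite sum. Since
    b_k > 0, the points beta m + b_k stay in this half-line, so sup E <= U + rho sup E, and only the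
    u_m with m >= m0 are needed. *)
Let S_bound (m0 : int) (U : R) : 0 <= U ->
  (forall m, m0 <= m -> be * m%:~R <= xs J%:Z -> cabs (u m) <= U) ->
  forall y, be * m0%:~R <= y -> cabs (S y) <= U / (1 - rho).
Proof.
move=> U0 hU.
have rho1 : 0 < 1 - rho by rewrite subr_gt0.
pose E := [set cabs (S y) | y in [set y | be * m0%:~R <= y]].
have supE : has_sup E.
  split; first by exists (cabs (S (be * m0%:~R))), (be * m0%:~R) => //=.
  exists (\sum_(j <- zrange J) cabs (F j)) => _ [y _ <-].
  apply: le_trans (cabs_sum _ _ _) _; apply: ler_sum => j _.
  rewrite cabsM; case: (y <= xs j); first by rewrite cabs_real normr1 mul1r.
  by rewrite cabs0 mul0r cabs_ge0.
have S_sup y : be * m0%:~R <= y -> cabs (S y) <= sup E.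
  by move=> hy; apply: ub_le_sup; [exact: supE.2|exists y].
have sup0 : 0 <= sup E by apply: le_trans (S_sup _ (lexx _)); exact: cabs_ge0.
have sup_le : sup E <= U + rho * sup E.
  apply: ge_sup; first exact: supE.1.
  move=> _ [y /= hy <-]; have rs : 0 <= rho * sup E.
    rewrite mulr_ge0//; apply: le_trans sum_rho; apply: sumr_ge0 => k _.
    by rewrite mulr_ge0 ?cabs_ge0 ?expR_ge0.
  have [yJ|Jy] := leP y (xs J%:Z); last by rewrite S_tail// cabs0 addr_ge0.
  have [m [m0m mJ <-]] := pick hy yJ.
  have -> : S (be * m%:~R) = u m -
     \sum_(1 <= k < n.+1) ((a k)^* * (expR (th * b k))%:C%C) * S (be * m%:~R + b k).
    by rewrite uS addrK.
  apply: le_trans (cabsD _ _) _; rewrite cabsN; apply: lerD; first exact: hU.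
  apply: le_trans (cabs_sum _ _ _) _; apply: le_trans (ler_wpM2r sup0 sum_rho).
  rewrite mulr_suml big_nat [leRHS]big_nat; apply: ler_sum => k /andP[k1 _].
  rewrite !cabsM cabs_conj cabs_real ger0_norm ?expR_ge0//.
  apply: ler_wpM2l; first by rewrite mulr_ge0 ?cabs_ge0 ?expR_ge0.
  apply: S_sup; apply: (@le_trans _ _ (be * m%:~R)); first by rewrite ler_pM2l// ler_int.
  by rewrite lerDl ltW// b_gt0.
move=> y hy; apply: le_trans (S_sup y hy) _.
by rewrite ler_pdivlMr//; lra.
Qed.

Let FS j : j \in zrange J -> F j = S (xs j) - S (xs (j + 1)).
Proof.
move=> jJ; rewrite /S -sumrB (bigD1_seq j) ?zrange_uniq//= big1 => [|i ij].
  by rewrite !xs_le lexx addz1_le mul1r mul0r subr0 addr0.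
by rewrite !xs_le addz1_le_neq// subrr.
Qed.

(** In the constant, 4 / (1 - rho)^2 comes from writing F_j as a difference of two values of [S],
    e^(2 th be) from rounding x_j down to a multiple of beta, and the last factor from the geometric
    sum over j. *)
Lemma lower_fiber : \sum_(j <- zrange J) cabs2 (phi j) <=
  (4 / (1 - rho) ^+ 2 * expR (2 * th * be) / (1 - expR (- (2 * th * T)))) *
  \sum_(m <- zrange K) cabs2 (v m).
Proof.
have rho1 : 0 < 1 - rho by rewrite subr_gt0.
pose m0 j : int := Num.floor (xs j / be).
pose U2 j := \sum_(m <- zrange K | m0 j <= m) cabs2 (u m).
have /andP[x0 xT] := x_itv.
have phi_le j : j \in zrange J -> cabs2 (phi j) <=
    expR (2 * th * xs j) * (4 / (1 - rho) ^+ 2 * U2 j).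
  move=> jJ; have jJ' := jJ; rewrite mem_zrange in jJ'.
  have /andP[f1 f2] := floor_itv (xs j / be); rewrite -/(m0 j) in f1 f2.
  have bm : be * (m0 j)%:~R <= xs j by rewrite mulrC -ler_pdivlMr.
  have mb : xs j < be * (m0 j + 1)%:~R by rewrite mulrC -ltr_pdivrMr.
  have U20 : 0 <= U2 j by apply: sumr_ge0 => m _; exact: cabs2_ge0.
  (* The l^2 tail dominates each of its entries and so serves as the bound U in [S_bound]. *)
  have hU m : m0 j <= m -> be * m%:~R <= xs J%:Z -> cabs (u m) <= Num.sqrt (U2 j).
    move=> m0m mJ; rewrite -(ler_pXn2r (n:=2))// ?nnegrE ?cabs_ge0 ?sqrtr_ge0//.
    rewrite sqr_cabs sqr_sqrtr// /U2 big_mkcond (bigD1_seq m) ?zrange_uniq//=.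
    - by rewrite m0m lerDl sumr_ge0// => i _; case: ifP => // _; exact: cabs2_ge0.
    - rewrite mem_zrange.
      (* [JK] makes the box K wide enough for every index m that meets a point of the fiber. *)
      have h1 : m <= K.
        rewrite -(ler_int R) -(ler_pM2l be_gt0); apply: (le_trans mJ).
        rewrite [leRHS]mulrC; apply: le_trans JK; rewrite /xs -natr1 mulrDl mul1r addrC.
        by rewrite lerD2l ltW.
      have h2 : - K%:Z <= m0 j.
        rewrite -ltzD1 -(ltr_int R) -(ltr_pM2l be_gt0); apply: le_lt_trans mb.
        rewrite intrN mulrN [be * _]mulrC; apply: (@le_trans _ _ (- (J.+1%:R * T))); first by rewrite lerN2.
        have : - (J%:R * T) <= j%:~R * T by rewrite -mulNr ler_pM2r// -[J%:R]/(J%:Z%:~R) -intrN ler_int; have [] := normz_le jJ'.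
        by rewrite /xs -natr1 mulrDl; lra.
      by apply: normz_leP h1; exact: le_trans h2 m0m.
  have SU y : be * (m0 j)%:~R <= y -> cabs2 (S y) <= U2 j / (1 - rho) ^+ 2.
    move=> hy; rewrite -sqr_cabs -[U2 j]sqr_sqrtr// -expr_div_n.
    rewrite ler_pXn2r// ?nnegrE ?cabs_ge0 ?divr_ge0 ?sqrtr_ge0 ?(ltW rho1)//.
    exact: (S_bound (sqrtr_ge0 _) hU).
  have FU : cabs2 (F j) <= 4 / (1 - rho) ^+ 2 * U2 j.
    rewrite FS//; apply: le_trans (cabs2D_le _ _) _; rewrite cabs2N.
    have h1 := SU _ bm.
    have h2 : cabs2 (S (xs (j + 1))) <= U2 j / (1 - rho) ^+ 2.
      by apply: SU; apply: (le_trans bm); rewrite xs_le lez_add1.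
    rewrite (_ : 4 / (1 - rho) ^+ 2 * U2 j = 2 * (U2 j / (1 - rho) ^+ 2) + 2 * (U2 j / (1 - rho) ^+ 2)); last by ring.
    by lra.
  have -> : cabs2 (phi j) = expR (2 * th * xs j) * cabs2 (F j).
    rewrite /F cabs2M cabs2_real -expRM_natl mulrCA -expRD.
    by rewrite (_ : _ + _ = 0) ?expR0 ?mulr1//; ring.
  by rewrite ler_wpM2l// expR_ge0.
set q := (1 - expR _)^-1.
rewrite big_seq; apply: le_trans (ler_sum _ phi_le) _; rewrite -big_seq.
rewrite (eq_bigr (fun j => \sum_(m <- zrange K) 4 / (1 - rho) ^+ 2 *
   ((m0 j <= m)%R%:R * expR (2 * th * (xs j - be * m%:~R))) * cabs2 (v m))); last first.
  move=> j _; rewrite /U2 !mulr_sumr big_mkcond /=; apply: eq_bigr => m _.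
  case: (m0 j <= m); last by rewrite mul0r mulr0 mul0r.
  rewrite /u cabs2M cabs2_real -expRM_natl mul1r.
  have -> : expR (2 * th * (xs j - be * m%:~R)) = expR (2 * th * xs j) * expR (2%:R * - (th * (be * m%:~R))).
    by rewrite -expRD; congr expR; ring.
  by ring.
rewrite exchange_big /= mulr_sumr; apply: ler_sum => m _.
rewrite -mulr_suml; apply: ler_wpM2r; first exact: cabs2_ge0.
rewrite -mulr_sumr -[leRHS]mulrA; apply: ler_wpM2l; first by rewrite divr_ge0 ?sqr_ge0.
have th2 : 0 < 2 * th by rewrite mulr_gt0.
(* The condition m0 j <= m implies x_j < beta (m + 1), so for fixed m the weights form a one-sided
   geometric sum in - j with base point beta m + beta - x. *)
have := @geo_sum R (2 * th) th2 T (be * m%:~R + be - x) J T0.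
rewrite -sum_zrangeN => geo.
apply: le_trans (ler_wpM2l (expR_ge0 (2 * th * be)) geo).
rewrite mulr_sumr; apply: ler_sum => j _.
have mm : (m0 j <= m) -> 0 <= be * m%:~R + be - x + (- j)%:~R * T.
  move=> mj; have /andP[_ f2] := floor_itv (xs j / be); rewrite -/(m0 j) in f2.
  have : xs j < be * (m + 1)%:~R.
    rewrite mulrC -ltr_pdivrMr//; apply: (lt_le_trans f2); by rewrite ler_int lerD2r.
  by rewrite intrD mulrDr mulr1 /xs mulrNz mulNr; lra.
case: (boolP (m0 j <= m)) => [/mm ->|_]; last first.
  by rewrite mul0r mulr_ge0 ?expR_ge0// mulr_ge0 ?ler0n ?expR_ge0.
by rewrite !mul1r -expRD ler_expR /xs mulrNz; lra.
Qed.

End lower_fiber.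

Section bounds_on_ift.
Context {R : realType}.
Notation mu := (@lebesgue_measure R).
Variables (w : R) (a : nat -> R[i]) (b : nat -> R).
Hypothesis w_lt0 : w < 0.
Variables (al be : R).
Hypothesis al_gt0 : 0 < al.
Hypothesis be_gt0 : 0 < be.

Definition gsum (K : nat) (f h : R -> R[i]) : R :=
  \sum_(m <- zrange K) \sum_(n <- zrange K) cabs2 (L2inner f (tfshift (al * n%:~R) (be * m%:~R) h)).

Definition theta : R := 2 * pi * - w.

Lemma theta_gt0 : 0 < theta.
Proof. by rewrite !mulr_gt0 ?pi_gt0 ?oppr_gt0. Qed.

Definition wsum (s : seq nat) : R := \sum_(k <- s) cabs (a k) * expR (theta * b k).

Lemma wsum_ge0 s : 0 <= wsum s.
Proof. by apply: sumr_ge0 => k _; rewrite mulr_ge0 ?cabs_ge0 ?expR_ge0. Qed.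

(** Because b_k >= 0, each term is supported in y >= 0, and e^(- theta (y - b_k)) = e^(theta b_k)
    e^(- theta y): this produces the weights of the hypothesis. *)
Lemma Gfun_bound s y : (forall k, 0 <= b k) ->
  cabs (Gfun w a b s y) <= wsum s * ((0 <= y)%R%:R * expR (- (theta * y))).
Proof.
move=> bge; apply: le_trans (cabs_sum _ _ _) _; rewrite mulr_suml; apply: ler_sum => k _.
rewrite cabsM cabs_conj cabs_real -[leRHS]mulrA; apply: ler_wpM2l; first exact: cabs_ge0.
case: (boolP (b k <= y)) => h; last first.
  by rewrite mul0r normr0 !mulr_ge0 ?ler0n ?expR_ge0.
rewrite (le_trans (bge k) h) !mul1r ger0_norm ?expR_ge0// -expRD ler_expR.
by rewrite /theta; lra.
Qed.

(** 4 pi^2 is |kap|^2, al^-1 is the period in Bessel's inequality, and the two inverses are the row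
    and column sums in Schur's test. *)
Definition upper_cst : R :=
  4 * pi ^+ 2 * al^-1 * ((1 - expR (- (theta * al^-1)))^-1 * (1 - expR (- (theta * be)))^-1).

Lemma upper_cst_ge0 : 0 <= upper_cst.
Proof.
have ai : 0 < al^-1 by rewrite invr_gt0.
have h1 := ltW (geo_gt0 theta_gt0 ai); have h2 := ltW (geo_gt0 theta_gt0 be_gt0).
apply: mulr_ge0; last by rewrite mulr_ge0 ?invr_ge0.
by rewrite mulr_ge0 ?(ltW ai)// mulr_ge0 ?sqr_ge0.
Qed.

Lemma wide_enough (N T : R) : 0 < T -> exists J : nat, N <= J%:R * T.
Proof.
move=> T0; exists (Num.bound (`|N| / T)); rewrite -ler_pdivrMr//.
apply: (@le_trans _ _ (`|N| / T)); first by rewrite ler_pM2r ?invr_gt0// ler_norm.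
by rewrite ltW// archi_boundP// divr_ge0// ltW.
Qed.

Definition fiber (s : seq nat) (phi : R -> R[i]) (m : int) (xi : R) : R[i] :=
  phi xi * Gfun w a b s (xi - be * m%:~R).

Lemma ip_fiber N s phi (n m : int) : 0 < N -> L2c N phi ->
  cabs2 (L2inner (ift phi) (tfshift (al * n%:~R) (be * m%:~R) (gfin w a b s))) =
  4 * pi ^+ 2 * cabs2 (cint (fun xi => fiber s phi m xi * cexpi (2 * pi * (n%:~R / al^-1) * xi))).
Proof.
move=> N0 cphi; rewrite (cabs2_ip_gfin w_lt0 _ _ _ _ _ N0 cphi); congr (_ * cabs2 _).
by apply: eq_cint => xi; rewrite invrK [al * _]mulrC.
Qed.

Lemma gsum_le_fiber N J s phi K : 0 < N -> L2c N phi -> N <= J%:R * al^-1 ->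
  gsum K (ift phi) (gfin w a b s) <=
  4 * pi ^+ 2 * al^-1 * \sum_(m <- zrange K) nrm2 (periodize al^-1 J (fiber s phi m)).
Proof.
move=> N0 cphi NJ; rewrite mulr_sumr; apply: ler_sum => m _.
under eq_bigr => n _ do rewrite (ip_fiber s n m N0 cphi).
rewrite -mulr_sumr -[leRHS]mulrA; apply: ler_wpM2l; first by rewrite mulr_ge0 ?sqr_ge0.
apply: samples_le; [by rewrite invr_gt0| |exact: zrange_uniq].
by apply: L2c_Gfun => //; exact: L2c_le cphi.
Qed.

Lemma upper_ift N s phi K : (forall k, 0 <= b k) -> 0 < N -> L2c N phi ->
  gsum K (ift phi) (gfin w a b s) <= upper_cst * wsum s ^+ 2 * nrm2 phi.
Proof.
move=> bge N0 cphi; have T0 : 0 < al^-1 by rewrite invr_gt0.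
have [J NJ] := wide_enough N T0.
apply: le_trans (gsum_le_fiber s K N0 cphi NJ) _.
rewrite /upper_cst -[leRHS]mulrA -[leRHS]mulrA; apply: ler_wpM2l.
  by rewrite mulr_ge0 ?(ltW T0)// mulr_ge0 ?sqr_ge0.
have cphi' := L2c_le NJ cphi.
have cf m : L2c (J%:R * al^-1) (fiber s phi m) by exact: L2c_Gfun.
set C := _ * (1 - _)^-1.
under eq_bigr => m _ do rewrite nrm2_periodize.
rewrite (nrm2_tile T0 cphi') -Rintegral_sum => [|m _]; last exact: rint_periodize (cf m).1.
rewrite [leRHS]mulrA -(@RintegralZl _ _ _ mu setT _ (C * wsum s ^+ 2))//; last exact: rint_tile_cabs2 cphi'.1.
apply: le_RintegralT.
- by apply: rint_sum => m _; exact: rint_periodize (cf m).1.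
- by apply: rintZ; exact: rint_tile_cabs2 cphi'.1.
move=> t; rewrite -mulr_sumr mulrCA; apply: ler_wpM2l; first by rewrite itv1E ler0n.
have := @schur_upper R theta theta_gt0 be al^-1 t (wsum s) (Gfun w a b s)
  (fun j => phi (t + j%:~R * al^-1)) J K be_gt0 T0 (wsum_ge0 s) (fun y => Gfun_bound s y bge).
rewrite -/C [wsum s ^+ 2 * C]mulrC => h; exact: h.
Qed.

Definition fiber_cst (rho : R) : R :=
  4 / (1 - rho) ^+ 2 * expR (2 * theta * be) / (1 - expR (- (2 * theta * al^-1))).

Lemma fiber_cst_gt0 rho : rho < 1 -> 0 < fiber_cst rho.
Proof.
move=> r1; have ai : 0 < al^-1 by rewrite invr_gt0.
have th2 : 0 < 2 * theta by rewrite mulr_gt0 ?theta_gt0.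
apply: divr_gt0; last exact: geo_gt0.
by rewrite mulr_gt0 ?expR_gt0// divr_gt0// exprn_gt0// subr_gt0.
Qed.

Definition lower_cst (rho : R) : R := 4 * pi ^+ 2 * al^-1 * (fiber_cst rho)^-1.

Lemma lower_cst_gt0 rho : rho < 1 -> 0 < lower_cst rho.
Proof.
move=> r1; have ai : 0 < al^-1 by rewrite invr_gt0.
apply: mulr_gt0; last by rewrite invr_gt0 fiber_cst_gt0.
by rewrite mulr_gt0// mulr_gt0// exprn_gt0// pi_gt0.
Qed.

(** The fiber estimate needs only the indices |m| <= K0, so one box in n can make the Parseval error
    small for all of them at once. *)
Lemma lower_ift N n rho phi e :
  a 0%N = 1 -> b 0%N = 0 -> (forall k, (1 <= k)%N -> 0 < b k) ->
  rho < 1 -> \sum_(1 <= k < n.+1) cabs (a k) * expR (theta * b k) <= rho ->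
  al * be <= 1 -> 0 < N -> L2c N phi -> 0 < e ->
  exists K, lower_cst rho * nrm2 phi <= gsum K (ift phi) (gfin w a b (iota 0 n.+1)) + e.
Proof.
move=> a0 b0 bpos rho1 hrho albe N0 cphi e0; have T0 : 0 < al^-1 by rewrite invr_gt0.
have beT : be <= al^-1 by rewrite -[al^-1]mul1r ler_pdivlMr// mulrC.
have [J NJ] := wide_enough N T0; have cphi' := L2c_le NJ cphi.
have [K0 JK] := wide_enough (J.+1%:R * al^-1) be_gt0.
set s := iota 0 n.+1.
have cf m : L2c (J%:R * al^-1) (fiber s phi m) by exact: L2c_Gfun.
set C := fiber_cst rho; have C0 : 0 < C by exact: fiber_cst_gt0.
have hfib : nrm2 phi <= C * \sum_(m <- zrange K0) nrm2 (periodize al^-1 J (fiber s phi m)).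
  under eq_bigr => m _ do rewrite nrm2_periodize.
  rewrite (nrm2_tile T0 cphi') -Rintegral_sum => [|m _]; last exact: rint_periodize (cf m).1.
  rewrite -(@RintegralZl _ _ _ mu setT _ C)//; last first.
    by apply: rint_sum => m _; exact: rint_periodize (cf m).1.
  apply: le_RintegralT.
  - exact: rint_tile_cabs2 cphi'.1.
  - by apply: rintZ; apply: rint_sum => m _; exact: rint_periodize (cf m).1.
  move=> t; rewrite -mulr_sumr mulrCA itv1E; case: (boolP (_ && _)) => [tI|_]; last by rewrite !mul0r.
  rewrite !mul1r.
  exact: (@lower_fiber R w a b n rho w_lt0 a0 b0 bpos rho1 hrho al^-1 be t J K0
    (fun j => phi (t + j%:~R * al^-1)) be_gt0 beT tI JK).
(* An error e / D for each of the 2 K0 + 1 values of m, multiplied by 4 pi^2, adds up to e. *)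
pose D := 4 * pi ^+ 2 * (size (zrange K0))%:R : R.
have D0 : 0 < D by rewrite !mulr_gt0 ?exprn_gt0 ?pi_gt0// ltr0n size_map size_iota.
have eD : 0 < e / D by rewrite divr_gt0.
have exL : exists L, forall m, m \in zrange K0 ->
    al^-1 * nrm2 (periodize al^-1 J (fiber s phi m)) <=
    \sum_(n <- zrange L) cabs2 (cint (fun xi => fiber s phi m xi * cexpi (2 * pi * (n%:~R / al^-1) * xi))) + e / D.
  elim: (zrange K0) => [|m r [L ihL]]; first by exists 0%N.
  have [L' hL'] := samples_ge T0 (cf m) eD.
  have mono L1 L2 m' : (L1 <= L2)%N ->
      \sum_(n <- zrange L1) cabs2 (cint (fun xi => fiber s phi m' xi * cexpi (2 * pi * (n%:~R / al^-1) * xi)))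
      <= \sum_(n <- zrange L2) cabs2 (cint (fun xi => fiber s phi m' xi * cexpi (2 * pi * (n%:~R / al^-1) * xi))).
    move=> LL; exact: (@le_zrange R L1 L2 (fun n => cabs2 (cint (fun xi => fiber s phi m' xi * cexpi (2 * pi * (n%:~R / al^-1) * xi)))) LL (fun n => cabs2_ge0 _)).
  exists (maxn L L') => m'; rewrite inE => /predU1P[->|/ihL h].
    by apply: (le_trans hL'); rewrite lerD2r; apply: mono; exact: leq_maxr.
  by apply: (le_trans h); rewrite lerD2r; apply: mono; exact: leq_maxl.
have [L hL] := exL; pose K := maxn K0 L; exists K.
rewrite /lower_cst -/C.
apply: (@le_trans _ _ (4 * pi ^+ 2 * \sum_(m <- zrange K0) al^-1 * nrm2 (periodize al^-1 J (fiber s phi m)))).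
  rewrite -mulr_sumr [leRHS]mulrA -[leLHS]mulrA; apply: ler_wpM2l.
    by rewrite mulr_ge0 ?(ltW T0)// mulr_ge0 ?sqr_ge0.
  by rewrite ler_pdivrMl.
apply: (@le_trans _ _ (\sum_(m <- zrange K0) (\sum_(n <- zrange L)
    cabs2 (L2inner (ift phi) (tfshift (al * n%:~R) (be * m%:~R) (gfin w a b s))) + e / (size (zrange K0))%:R))).
  rewrite mulr_sumr big_seq [leRHS]big_seq; apply: ler_sum => m mK.
  under eq_bigr => n' _ do rewrite (ip_fiber s n' m N0 cphi).
  rewrite -mulr_sumr; have := ler_wpM2l (_ : 0 <= 4 * pi ^+ 2) (hL m mK).
  rewrite mulrDr (_ : 4 * pi ^+ 2 * (e / D) = e / (size (zrange K0))%:R).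
    by apply; rewrite mulr_ge0 ?sqr_ge0.
  have pn : pi != 0 :> R by rewrite gt_eqF ?pi_gt0.
  have aux (p z : R) : p != 0 -> z != 0 -> 4 * p ^+ 2 * (e / (4 * p ^+ 2 * z)) = e / z.
    by move=> hp hz; field; rewrite hz hp.
  by rewrite /D aux// size_map size_iota pnatr_eq0.
have se : \sum_(m <- zrange K0) e / (size (zrange K0))%:R = e.
  rewrite big_const_seq count_predT iter_addr_0 -[LHS]mulr_natr divfK//.
  by rewrite size_map size_iota pnatr_eq0.
rewrite big_split /= se lerD2r.
apply: (@le_trans _ _ (\sum_(m <- zrange K0) \sum_(n <- zrange K)
    cabs2 (L2inner (ift phi) (tfshift (al * n%:~R) (be * m%:~R) (gfin w a b s))))).
  apply: ler_sum => m _; apply: (@le_zrange R L K (fun n => cabs2 (L2inner (ift phi) (tfshift (al * n%:~R) (be * m%:~R) (gfin w a b s))))).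
    exact: leq_maxr.
  by move=> n'; exact: cabs2_ge0.
apply: (@le_zrange R K0 K (fun m => \sum_(n <- zrange K) _)); first exact: leq_maxl.
by move=> m; apply: sumr_ge0 => n' _; exact: cabs2_ge0.
Qed.

End bounds_on_ift.

(** * Extension to all of L^2 and to infinite series *)

Section gabor_sums.
Context {R : realType}.
Variables (al be : R).
Implicit Types f g h : R -> R[i].
Notation gsum := (gsum al be).

Lemma le_gsum2 K f h f1 h1 f2 h2 :
  (forall x om, L2inner f (tfshift x om h) = L2inner f1 (tfshift x om h1) + L2inner f2 (tfshift x om h2)) ->
  gsum K f h <= 2 * gsum K f1 h1 + 2 * gsum K f2 h2.
Proof.
move=> H; rewrite /gsum !mulr_sumr -big_split /=; apply: ler_sum => m _.
rewrite !mulr_sumr -big_split /=; apply: ler_sum => n _.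
by rewrite H; exact: cabs2D_le.
Qed.

Lemma le_gsum_l K f f' h : L2 f -> L2 f' -> L2 h ->
  gsum K f h <= 2 * gsum K f' h + 2 * gsum K (fun t => f t - f' t) h.
Proof.
move=> lf lf' lh; apply: le_gsum2 => x om; have lt := L2_tfshift x om lh.
rewrite -(ipDl lf' (L2B lf lf') lt); congr (L2inner _ _).
by apply/funext => t; rewrite addrC subrK.
Qed.

Lemma le_gsum_r K f h h' : L2 f -> L2 h -> L2 h' ->
  gsum K f h <= 2 * gsum K f h' + 2 * gsum K f (fun t => h t - h' t).
Proof.
move=> lf lh lh'; apply: le_gsum2 => x om.
rewrite -(ipDr (L2_tfshift x om lh') (L2_tfshift x om (L2B lh lh')) lf); congr (L2inner _ _).
by apply/funext => t; rewrite /tfshift -mulrDr; congr (_ * _); rewrite [RHS]addrC subrK.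
Qed.

Definition nbox (K : nat) : R := \sum_(m <- zrange K) \sum_(n <- zrange K) 1.

Lemma nbox_ge0 K : 0 <= nbox K.
Proof. by apply: sumr_ge0 => m _; apply: sumr_ge0 => n _. Qed.

(** Cauchy-Schwarz term by term. The bound grows with the box, but it suffices for limits in f or in
    the window taken at fixed K. *)
Lemma gsum_crude K f h : L2 f -> L2 h -> gsum K f h <= nbox K * (nrm2 f * nrm2 h).
Proof.
move=> lf lh; rewrite /nbox mulr_suml; apply: ler_sum => m _.
rewrite mulr_suml; apply: ler_sum => n _; rewrite mul1r.
rewrite -(nrm2_tfshift (al * n%:~R) (be * m%:~R) lh).
by apply: cauchy_schwarz => //; exact: L2_tfshift.
Qed.

Lemma le_eps (x y C : R) : 0 <= C -> (forall e, 0 < e -> x <= y + C * e) -> x <= y.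
Proof.
move=> C0 H; apply/ler_addgt0Pl => e e0; rewrite addrC.
have C1 : 0 < C + 1 by lra.
apply: (le_trans (H (e / (C + 1)) _)); first by rewrite divr_gt0.
by rewrite lerD2l mulrCA ger_pMr// ler_pdivrMr// mul1r; lra.
Qed.

Lemma nrm2_close f f' : L2 f -> L2 f' -> nrm2 f <= 2 * nrm2 f' + 2 * nrm2 (fun t => f t - f' t).
Proof.
move=> lf lf'; have := nrm2D_le lf' (L2B lf lf').
by under [X in nrm2 X <= _]eq_fun => t do rewrite addrC subrK.
Qed.

Lemma nrm2_subC f f' : nrm2 (fun t => f t - f' t) = nrm2 (fun t => f' t - f t).
Proof. by apply: eq_Rintegral => t _; rewrite -cabs2N opprB. Qed.

End gabor_sums.

Section extension.
Context {R : realType}.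
Variables (w : R) (a : nat -> R[i]) (b : nat -> R) (al be : R).
Hypothesis w_lt0 : w < 0.
Hypothesis al_gt0 : 0 < al.
Hypothesis be_gt0 : 0 < be.
Hypothesis b_ge0 : forall k, 0 <= b k.
Implicit Types f h : R -> R[i].
Notation gsum := (gsum al be).
Notation ck := (ck w).
Notation gfin := (gfin w a b).
Notation wsum := (wsum w a b).
Let Bc := upper_cst w al be.

Let Bc0 : 0 <= Bc. Proof. exact: upper_cst_ge0. Qed.

Lemma L2_gfin s : L2 (gfin s).
Proof.
apply: (@L2_bddM _ _ _ ((\sum_(k <- s) cabs (a k)) ^+ 2)); last exact: L2_ck.
- by apply: cmeas_sum => k; apply: cmeasM; [exact: cmeas_cst|exact: cmeas_expi].
- move=> t; rewrite -sqr_cabs ler_pXn2r// ?nnegrE ?cabs_ge0 ?sumr_ge0// => [|k _].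
    apply: le_trans (cabs_sum _ _ _) _; apply: ler_sum => k _.
    by rewrite cabsM cabs_cexpi mulr1.
  exact: cabs_ge0.
Qed.

(** K stays fixed while f is approximated by inverse transforms, so [gsum_crude] controls the error.
    The factor 4 comes from two uses of |x + y|^2 <= 2 |x|^2 + 2 |y|^2. *)
Lemma upper_all s f K : L2 f -> gsum K f (gfin s) <= 4 * (Bc * wsum s ^+ 2) * nrm2 f.
Proof.
move=> lf; have lh := L2_gfin s.
have W0 : 0 <= Bc * wsum s ^+ 2 by rewrite mulr_ge0 ?sqr_ge0.
apply: (@le_eps R _ _ (4 * (Bc * wsum s ^+ 2) + 2 * (nbox K * nrm2 (gfin s)))).
  apply: addr_ge0; first by apply: mulr_ge0.
  by apply: mulr_ge0 => //; apply: mulr_ge0; [exact: nbox_ge0|exact: nrm2_ge0].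
move=> e e0; have [N [phi [N0 cphi hphi]]] := ift_dense lf e0.
have [li ni] := ift_plancherel N0 cphi.
have h1 := le_gsum_l al be K lf li lh.
have h2 := upper_ift a w_lt0 al_gt0 be_gt0 s K b_ge0 N0 cphi.
have h3 := gsum_crude al be K (L2B lf li) lh.
have h4 := nrm2_close li lf; rewrite nrm2_subC ni in h4.
have h5 : nbox K * (nrm2 (fun t => f t - ift phi t) * nrm2 (gfin s)) <= nbox K * nrm2 (gfin s) * e.
  by rewrite mulrCA mulrC; apply: ler_wpM2l; [by apply: mulr_ge0; [exact: nbox_ge0|exact: nrm2_ge0]|exact: ltW].
move: h1 h2 h3 h4 h5 hphi W0; rewrite -/Bc.
move: (nbox K * (nrm2 _ * _)) => u1.
move: (nbox K * nrm2 (gfin s)) => u2.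
move: (gsum K f (gfin s)) => g1.
move: (gsum K (ift phi) (gfin s)) => g2.
move: (gsum K _ _) => g3.
move: (Bc * wsum s ^+ 2) => W.
move: (nrm2 f) => x.
move: (nrm2 phi) => y.
move: (nrm2 _) => z.
move=> h1 h2 h3 h4 h5 h6 W0.
have : W * y <= W * (2 * x + 2 * z) by apply: ler_wpM2l.
have : W * z <= W * e by apply: ler_wpM2l => //; exact: ltW.
by lra.
Qed.

(** [g] stands for the full window and [eps m] for the weighted tail of its coefficients from index
    m on. *)
Variables (g : R -> R[i]) (eps : nat -> R).
Hypothesis L2_g : L2 g.
Hypothesis eps_ge0 : forall m, 0 <= eps m.
Hypothesis eps_cvg : forall e, 0 < e -> exists2 m0 : nat, (0 < m0)%N & forall m, (m0 <= m)%N -> eps m <= e.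
Hypothesis wsum_tail : forall m d, (0 < m)%N -> wsum (iota m d) <= eps m.
Hypothesis g_tail : forall m, (0 < m)%N ->
  nrm2 (fun t => g t - gfin (iota 0 m) t) <= 2 * eps m ^+ 2 * nrm2 ck.

Let eps_sqr e : 0 < e -> exists2 m0 : nat, (0 < m0)%N & forall m, (m0 <= m)%N -> eps m ^+ 2 <= e.
Proof.
move=> e0; pose d := Num.min 1 e; have d0 : 0 < d by rewrite /d lt_min ltr01.
have [m0 m00 h] := eps_cvg d0; exists m0 => // m mm; have := h m mm.
rewrite /d le_min => /andP[h1 h2]; apply: le_trans h2; by rewrite expr2 ler_piMr.
Qed.

(** The tail is split at m + n0. The finite block falls under [upper_all] with weight at most eps m,
    uniformly in K; the rest is handled by [gsum_crude], with n0 chosen large in terms of the error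
    e. *)
Lemma upper_tail m f K : (0 < m)%N -> L2 f ->
  gsum K f (fun t => g t - gfin (iota 0 m) t) <= 8 * (Bc * eps m ^+ 2) * nrm2 f.
Proof.
move=> m0 lf; have lt : L2 (fun t => g t - gfin (iota 0 m) t) by apply: L2B => //; exact: L2_gfin.
apply: (@le_eps R _ _ (4 * (nbox K * (nrm2 f * nrm2 ck)))).
  by rewrite mulr_ge0// mulr_ge0 ?nbox_ge0// mulr_ge0 ?nrm2_ge0.
move=> e e0; have [n0 n00 hn] := eps_sqr e0.
pose n := (m + n0)%N.
have hr := le_gsum_r al be K lf lt (L2_gfin (iota m n0)).
have eqt : (fun t => g t - gfin (iota 0 m) t - gfin (iota m n0) t) = (fun t => g t - gfin (iota 0 n) t).
  apply/funext => t; rewrite -addrA -opprD; congr (_ - _).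
  by rewrite -[in LHS]mulrDl -big_cat /= /n iotaD add0n.
rewrite eqt in hr; apply: (le_trans hr).
have h1 := upper_all (iota m n0) K lf.
have nn : (0 < n)%N by rewrite /n addn_gt0 m0.
have h2 := gsum_crude al be K lf (L2B L2_g (L2_gfin (iota 0 n))).
have h3 := g_tail nn.
have h4 : Bc * wsum (iota m n0) ^+ 2 <= Bc * eps m ^+ 2.
  apply: ler_wpM2l => //; rewrite ler_pXn2r ?nnegrE ?wsum_ge0 ?eps_ge0//.
  exact: wsum_tail.
have h5 := hn n (leq_addl _ _).
have h6 : nbox K * (nrm2 f * nrm2 (fun t => g t - gfin (iota 0 n) t)) <=
    nbox K * (nrm2 f * (2 * e * nrm2 ck)).
  apply: ler_wpM2l; first exact: nbox_ge0.
  apply: ler_wpM2l; first exact: nrm2_ge0.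
  apply: (le_trans h3); apply: ler_wpM2r; first exact: nrm2_ge0.
  by apply: ler_wpM2l.
have h7 : Bc * wsum (iota m n0) ^+ 2 * nrm2 f <= Bc * eps m ^+ 2 * nrm2 f.
  by apply: ler_wpM2r; first exact: nrm2_ge0.
have e1 : nbox K * (nrm2 f * (2 * e * nrm2 ck)) = 2 * (nbox K * (nrm2 f * nrm2 ck) * e) by ring.
rewrite e1 in h6; have h8 := le_trans h2 h6.
move: h1 h8 h7.
move: (nbox K * (nrm2 f * nrm2 ck)) => z.
move: (gsum K f (gfin _)) => x1.
move: (gsum K f _) => x2.
move: (Bc * wsum _ ^+ 2) => p.
move: (Bc * eps m ^+ 2) => q.
move: (nrm2 f) => y.
lra.
Qed.

Lemma upper_g : exists2 B, 0 < B & forall f K, L2 f -> gsum K f g <= B * nrm2 f.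
Proof.
(* The window is split into its term k = 0 and the tail; 8 and 16 are twice the constants of
   [upper_all] and [upper_tail]. *)
pose B := 8 * (Bc * wsum (iota 0 1) ^+ 2) + 16 * (Bc * eps 1%N ^+ 2) + 1.
have B1 : 0 <= Bc * wsum (iota 0 1) ^+ 2 by rewrite mulr_ge0 ?sqr_ge0.
have B2 : 0 <= Bc * eps 1%N ^+ 2 by rewrite mulr_ge0 ?sqr_ge0.
exists B; first by rewrite /B; lra.
move=> f K lf; have h1 := le_gsum_r al be K lf L2_g (L2_gfin (iota 0 1)).
have h2 := upper_all (iota 0 1) K lf; have h3 := upper_tail K (ltn0Sn 0) lf.
have n0 := nrm2_ge0 f.
move: h1 h2 h3 n0; rewrite /B -/(iota 0 1).
move: (gsum K f g) => x1.
move: (gsum K f (gfin _)) => x2.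
move: (gsum K f _) => x3.
move: (Bc * _) => x4.
move: (Bc * _) => x5.
move: (nrm2 f) => x6.
lra.
Qed.

(** A perturbation argument: the lower bound for truncated windows does not depend on the number of
    terms, since rho bounds every partial sum, while the upper bound for the tail tends to zero. One
    truncation with a small enough tail decides. *)
Lemma lower_g rho : a 0%N = 1 -> b 0%N = 0 -> (forall k, (1 <= k)%N -> 0 < b k) ->
  rho < 1 -> (forall n, \sum_(1 <= k < n.+1) cabs (a k) * expR (theta w * b k) <= rho) ->
  al * be <= 1 ->
  exists2 A, 0 < A & forall f e, L2 f -> 0 < e -> exists K, A * nrm2 f <= gsum K f g + e.
Proof.
move=> a0 b0 bpos rho1 hrho albe; set Cl := lower_cst w al be rho.
have Cl0 : 0 < Cl by exact: lower_cst_gt0.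
have lower_fin n f e : L2 f -> 0 < e ->
    exists K, Cl / 4 * nrm2 f <= gsum K f (gfin (iota 0 n.+1)) + e.
  move=> lf e0; set h := gfin (iota 0 n.+1).
  set W := 8 * (Bc * wsum (iota 0 n.+1) ^+ 2).
  have W0 : 0 <= W by rewrite mulr_ge0// mulr_ge0 ?sqr_ge0.
  (* The approximation error is multiplied by W for the part f - ift phi, by Cl for the norm, and by
     a constant for the Parseval error; this choice keeps the total below e. *)
  pose e1 := e / (W + 1 + Cl); have e10 : 0 < e1 by rewrite divr_gt0//; lra.
  have [N [phi [N0 cphi hphi]]] := ift_dense lf e10.
  have [li ni] := ift_plancherel N0 cphi.
  have [K hK] := lower_ift w_lt0 al_gt0 be_gt0 a0 b0 bpos rho1 (hrho n) albe N0 cphi e10.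
  exists K; have h1 := le_gsum_l al be K li lf (L2_gfin (iota 0 n.+1)).
  have h2 := upper_all (iota 0 n.+1) K (L2B li lf); rewrite nrm2_subC in h2.
  have h3 := nrm2_close lf li; rewrite ni in h3.
  have e1E : e1 * (W + 1 + Cl) = e by rewrite /e1 divfK// gt_eqF//; lra.
  move: hK h1 h2 h3 hphi e1E W0; rewrite -/Cl -/h /W.
  move: (gsum K (ift phi) h) => g1.
  move: (gsum K f h) => g2.
  move: (gsum K _ h) => g3.
  move: (Bc * _) => V.
  move: (nrm2 f) => x.
  move: (nrm2 phi) => y.
  move: (nrm2 _) => z.
  move=> hK h1 h2 h3 h4 h5 V0.
  have : 4 * V * z <= 4 * V * e1 by apply: ler_wpM2l; [lra|exact: ltW].
  have : Cl * x <= Cl * (2 * y + 2 * z) by apply: ler_wpM2l => //; exact: ltW.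
  have : Cl * z <= Cl * e1 by apply: ler_wpM2l; [exact: ltW|exact: ltW].
  by lra.
(* With Bc eps^2 <= Cl / 128 the tail contributes at most 2 * 8 / 128 = 1/8 of Cl, half of the
   available Cl / 4. The factor 2 in [le_gsum_r] then leaves Cl / 16. *)
have [m0 m00 hm] : exists2 m0 : nat, (0 < m0)%N & forall m, (m0 <= m)%N -> eps m ^+ 2 <= Cl / (128 * (Bc + 1)).
  by apply: eps_sqr; rewrite divr_gt0// mulr_gt0// ltr_wpDl.
exists (Cl / 16); first by rewrite divr_gt0.
move=> f e lf e0; case: m0 m00 hm => [//|n] _ hm.
have [K hK] := lower_fin n f e lf e0; exists K.
have h1 := le_gsum_r al be K lf (L2_gfin (iota 0 n.+1)) L2_g.
have h2 := upper_tail K (ltn0Sn n) lf.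
have hs : gsum K f (fun t => gfin (iota 0 n.+1) t - g t) = gsum K f (fun t => g t - gfin (iota 0 n.+1) t).
  apply: eq_bigr => m _; apply: eq_bigr => k _; rewrite -cabs2N -ipNr//.
    by congr (cabs2 (L2inner _ _)); apply/funext => t; rewrite /tfshift -mulrN opprB.
  by apply: L2_tfshift; apply: L2B => //; exact: L2_gfin.
rewrite hs in h1.
have h3 : Bc * eps n.+1 ^+ 2 <= Cl / 128.
  have := hm n.+1 (leqnn _); rewrite ler_pdivlMr; last by rewrite mulr_gt0// ltr_wpDl.
  have := sqr_ge0 (eps n.+1); move: (eps n.+1 ^+ 2) Bc0 => x Bc0' x0 hx.
  rewrite ler_pdivlMr//; nra.
have n0 := nrm2_ge0 f.
have h4 : Bc * eps n.+1 ^+ 2 * nrm2 f <= Cl / 128 * nrm2 f by apply: ler_wpM2r.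
move: hK h1 h2 h4 n0.
move: (gsum K f (gfin _)) => x1.
move: (gsum K f g) => x2.
move: (gsum K f _) => x3.
move: (Bc * _) => x4.
move: (nrm2 f) => x5.
lra.
Qed.

End extension.

(** * Failure above the critical density *)

Section int_offsets.
Implicit Types (m : int) (p M K : nat).

Lemma int_offset m p M : - p%:Z < m -> m < M%:Z ->
  exists2 l, (l < p + M)%N & m = l%:Z - p%:Z.
Proof. by move=> h1 h2; exists (absz (m + p%:Z)); lia. Qed.

Lemma addz_le0 m p : m <= - p%:Z -> m + p%:Z <= 0. Proof. lia. Qed.

Lemma zrange_shift m p K : `|m| <= K%:Z -> `|m + p%:Z| <= (K + p)%N%:Z. Proof. lia. Qed.

End int_offsets.

Section density_obstruction.
Context {R : realType}.
Notation mu := (@lebesgue_measure R).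

(** It provides the width d of the bumps: starting from finitely many points, a move to the right by
    less than d passes none of the finitely many jumps of [Gfun]. *)
Lemma min_pos_gap (l : seq R) (T : R) : 0 < T ->
  exists d, [/\ 0 < d, d <= T & forall y, y \in l -> 0 < y -> d <= y].
Proof.
move=> T0; elim: l => [|y l [d [d0 dT hd]]]; first by exists T.
have [y0|y0] := ltP 0 y; last first.
  by exists d; split=> // z; rewrite inE => /predU1P[->|/hd//]; rewrite ltNge y0.
exists (Num.min d y); split; first by rewrite lt_min d0.
  by rewrite ge_min dT.
move=> z; rewrite inE => /predU1P[-> _|zl z0]; first by rewrite ge_min lexx orbT.
by rewrite ge_min hd.
Qed.

Lemma nontrivial_kernel (F : fieldType) (n r : nat) (A : 'M[F]_(n, r)) : (r < n)%N ->
  exists2 c : 'rV[F]_n, c != 0 & c *m A = 0.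
Proof.
move=> rn; have : kermx A != 0.
  rewrite kermx_eq0 /row_free neq_ltn; apply/orP; left.
  exact: leq_ltn_trans (rank_leq_col A) rn.
by case/rowV0Pn => c /sub_kermxP cA c0; exists c.
Qed.

Lemma nat_ceil (x : R) : 0 <= x -> exists m : nat, x <= m%:R /\ m%:R <= x + 1.
Proof.
move=> x0; have /andP[h1 h2] := ceil_itv x.
have c0 : 0 <= Num.ceil x by rewrite -(ler_int R); exact: le_trans h2.
exists `|Num.ceil x|%N; rewrite -[_%:R]/((Posz `|Num.ceil x|)%:~R) gez0_abs//; split=> //.
by move: h1; rewrite intrB => h1; apply: ltW; rewrite -ltrBlDr.
Qed.

Lemma itv1_shift0 (d T t : R) (z : int) : d <= T -> 0 < T -> 0 <= t < T -> z != 0 ->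
  itv1 0 d (t + z%:~R * T) = 0.
Proof.
move=> dT T0 /andP[t0 tT] z0; apply: itv1_out; apply/negP => /andP[h1 h2].
have [zp|zn|ze] := ltrgtP z 0; last by rewrite ze eqxx in z0.
  have z1 : z%:~R <= -1 :> R by rewrite -[-1]/((-1)%:~R) ler_int; lia.
  have := ler_wpM2r (ltW T0) z1; lra.
have z1 : 1 <= z%:~R :> R by rewrite -[1]/(1%:~R) ler_int; lia.
have := ler_wpM2r (ltW T0) z1; lra.
Qed.

Variables (n J : nat) (c : 'rV[R[i]]_n) (d T : R).
Hypothesis nJ : (n <= J)%N.
Hypothesis d0 : 0 < d.
Hypothesis dT : d <= T.

(** The vector c extended by zero to all integers; as a sum over the ordinals it needs no proof that
    z is in range. *)
Definition cext (z : int) : R[i] :=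
  \sum_(i < n) (if z == i%:Z then c ord0 i else 0).

(** Equal to c_i on [iT, iT + d): the fiber over each x in [0, d) carries the same vector c, the
    other fibers vanish. *)
Definition bumps (xi : R) : R[i] := \sum_(i < n) c ord0 i * (itv1 0 d (xi - i%:R * T))%:C%C.

Let T0 : 0 < T. Proof. exact: lt_le_trans d0 dT. Qed.

Lemma bumps_shift t (z : int) : 0 <= t < T -> bumps (t + z%:~R * T) = cext z * (itv1 0 d t)%:C%C.
Proof.
move=> tT; rewrite /cext mulr_suml; apply: eq_bigr => i _.
have -> : t + z%:~R * T - i%:R * T = t + (z - i%:Z)%:~R * T by rewrite intrB /=; ring.
case: eqP => [->|/eqP zi]; first by rewrite subrr mul0r addr0.
by rewrite itv1_shift0 ?subr_eq0// rmorph0 mulr0 mul0r.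
Qed.

Lemma sum_cext (X : int -> R[i]) :
  \sum_(z <- zrange J) cext z * X z = \sum_(i < n) c ord0 i * X i%:Z.
Proof.
rewrite /cext; under eq_bigr => z _ do rewrite mulr_suml.
rewrite exchange_big /=; apply: eq_bigr => i _.
rewrite (bigD1_seq i%:Z) ?zrange_uniq//=; last first.
  rewrite mem_zrange /= lez_nat; apply: leq_trans nJ; exact/ltnW/ltn_ord.
rewrite eqxx big1 ?addr0// => z zi.
by rewrite (negbTE zi) mul0r.
Qed.

Lemma cext_out z : ~~ (0 <= z < n%:Z) -> cext z = 0.
Proof.
move=> h; rewrite /cext big1// => i _; case: eqP => // e.
by move: h; rewrite e ltz_nat ltn_ord.
Qed.

Lemma cext_neq0 : c != 0 -> 0 < \sum_(z <- zrange J) cabs2 (cext z).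
Proof.
move=> cn; have [i ci] : exists i, c ord0 i != 0.
  by apply/existsP; apply: contraNT cn => /existsPn h; apply/eqP/rowP => i; rewrite mxE; apply/eqP; rewrite -[_ == _]negbK h.
have iJ : i%:Z \in zrange J.
  rewrite mem_zrange /= lez_nat; apply: leq_trans nJ; exact/ltnW/ltn_ord.
rewrite (bigD1_seq i%:Z) ?zrange_uniq//=; apply: ltr_pwDl; last first.
  by apply: sumr_ge0 => z _; exact: cabs2_ge0.
have -> : cext i%:Z = c ord0 i.
  rewrite /cext (bigD1 i)//= eqxx big1 ?addr0// => i' ii'.
  by case: eqP => // -[] e; rewrite (_ : i = i') ?eqxx in ii'; last exact: val_inj.
rewrite lt_neqAle cabs2_ge0 andbT eq_sym; apply: contra ci => /eqP/cabs2_eq0 ->; exact: eqxx.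
Qed.

Lemma L2c_bumps : L2c (J.+1%:R * T) bumps.
Proof.
split.
  apply: L2_sum => i _; apply: L2Z.
  apply: (@L2_le _ _ (fun xi => itv1 0 d (xi - i%:R * T))).
  - apply: cmeas_real; apply: (measurableT_comp (measurable_itv1 0 d)).
    exact: measurable_funB.
  - by move=> t; rewrite cabs2_itv1.
  - exact: (rint_shift (i%:R * T) (rint_itv1 0 d)).
move=> t h; rewrite /bumps big1// => i _; rewrite itv1_out ?rmorph0 ?mulr0//.
apply: contra h => /andP[h1 h2].
have i0 : 0 <= i%:R * T by rewrite mulr_ge0 ?ler0n ?(ltW T0).
have iJ : (i.+1)%:R * T <= J.+1%:R * T.
  by rewrite ler_pM2r// ler_nat ltnS; apply: leq_trans nJ; exact/ltnW/ltn_ord.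
have J0 : 0 <= J.+1%:R * T by rewrite mulr_ge0 ?ler0n ?(ltW T0).
move: iJ; rewrite -natr1 mulrDl mul1r => iJ.
have dT' := dT; apply/andP; split; lra.
Qed.

Lemma nrm2_bumps : nrm2 bumps = d * \sum_(z <- zrange J.+1) cabs2 (cext z).
Proof.
rewrite (nrm2_tile T0 L2c_bumps).
have -> : \int[mu]_t (itv1 0 T t * \sum_(j <- zrange J.+1) cabs2 (bumps (t + j%:~R * T))) =
   \int[mu]_t ((\sum_(j <- zrange J.+1) cabs2 (cext j)) * itv1 0 d t).
  apply: eq_Rintegral => t _; rewrite itv1E; case: (boolP (_ && _)) => tT; last first.
    rewrite mul0r itv1_out ?mulr0//; apply: contra tT => /andP[-> h] /=.
    exact: lt_le_trans h dT.
  rewrite mul1r mulr_suml; apply: eq_bigr => j _.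
  by rewrite bumps_shift// cabs2M cabs2_itv1.
rewrite RintegralZl//; last exact: rint_itv1.
by rewrite (Rintegral_itv1 (ltW d0)) subr0 mulrC.
Qed.

End density_obstruction.

Section obstruction.
Context {R : realType}.
Notation mu := (@lebesgue_measure R).
Variables (w : R) (a : nat -> R[i]) (b : nat -> R) (al be : R).
Hypothesis w_lt0 : w < 0.
Hypothesis al_gt0 : 0 < al.
Hypothesis be_gt0 : 0 < be.
Hypothesis b_ge0 : forall k, 0 <= b k.

Lemma Gfun_neg s y : y < 0 -> Gfun w a b s y = 0.
Proof.
move=> y0; rewrite /Gfun big1// => k _.
by rewrite (_ : (b k <= y) = false) ?mul0r ?rmorph0 ?mulr0//; apply/negbTE; rewrite -ltNge (lt_le_trans y0).
Qed.

(** Between two jumps [Gfun] is a pure exponential. An orthogonality relation at the left ends of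
    the bumps therefore holds across their whole width. *)
Lemma Gfun_shift s y t : 0 <= t -> (forall k, k \in s -> (b k <= y + t) = (b k <= y)) ->
  Gfun w a b s (y + t) = (expR (2 * pi * w * t))%:C%C * Gfun w a b s y.
Proof.
move=> t0 h; rewrite /Gfun mulr_sumr big_seq [RHS]big_seq; apply: eq_bigr => k ks.
rewrite h// mulrCA; congr (_ * _); rewrite -rmorphM /=; congr (_%:C%C).
rewrite mulrCA; congr (_ * _); rewrite -expRD; congr expR; ring.
Qed.

Lemma obstruction s e : 1 < al * be -> 0 < e ->
  exists (N : R) phi, [/\ 0 < N, L2c N phi, 0 < nrm2 phi &
    forall K, gsum al be K (ift phi) (gfin w a b s) <= e * nrm2 phi].
Proof.
move=> albe e0; set T := al^-1; have T0 : 0 < T by rewrite invr_gt0.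
have Tbe : T < be by rewrite -[T]mul1r ltr_pdivrMr// mulrC.
have th0 : 0 < theta w by exact: theta_gt0.
set th := theta w in th0 *.
have U0 : 0 <= upper_cst w al be * wsum w a b s ^+ 2.
  by rewrite mulr_ge0 ?sqr_ge0 ?upper_cst_ge0.
have c0 : 0 < 2 * (th * be) by rewrite mulr_gt0// mulr_gt0.
have [M0 _ hM0] := expR_small c0 U0 e0.
pose m0 := Num.bound `|M0|.
(* The surviving indices m <= - m0 contribute at most upper_cst W^2 e^(- 2 th be m0), which m0 makes
   at most e. *)
have Mm0 : M0 <= m0%:R.
  by apply: le_trans (ler_norm _) _; apply: ltW; exact: archi_boundP.
have {}hM0 := hM0 _ Mm0.
have q0 : 0 < 1 - T / be by rewrite subr_gt0 ltr_pdivrMr// mul1r.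
(* From n (1 - T / be) > m0 + 1 and M1 <= n T / be + 1 follows m0 + M1 < n: more unknowns than
   equations. *)
pose n := Num.bound ((m0%:R + 1) / (1 - T / be)).
have hn : (m0%:R + 1) / (1 - T / be) < n%:R.
  by apply: archi_boundP; rewrite divr_ge0 ?(ltW q0)// addr_ge0.
rewrite ltr_pdivrMr// in hn.
have [|M1 [M1a M1b]] := @nat_ceil R (n%:R * (T / be)).
  by rewrite mulr_ge0// divr_ge0 ?(ltW T0) ?(ltW be_gt0).
have rn : (m0 + M1 < n)%N.
  rewrite -(ltr_nat R) natrD; move: hn; rewrite mulrBr mulr1; lra.
(* Column l stands for the index m = l - m0. *)
pose A : 'M[R[i]]_(n, m0 + M1) := \matrix_(i < n, l < m0 + M1)
  Gfun w a b s (i%:R * T - be * (l%:Z - m0%:Z)%:~R).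
have [c cne cA] := nontrivial_kernel A rn.
(* The signed distances from the points iT - be m to the jumps b_k of [Gfun]. *)
pose L := [seq b kil.1 - (kil.2.1%:R * T - be * (kil.2.2%:Z - m0%:Z)%:~R) |
  kil <- [seq (k, il) | k <- s, il <- [seq (i, l) | i <- iota 0 n, l <- iota 0 (m0 + M1)]]].
have [d [d0 dT hd]] := min_pos_gap L T0.
pose phi := bumps c d T.
have cphi : L2c (n.+1%:R * T) phi by exact: L2c_bumps.
pose J := n.+1; pose S := \sum_(z <- zrange J) cabs2 (cext c z).
have nphi : nrm2 phi = d * S by exact: nrm2_bumps.
have S0 : 0 < S by exact: (@cext_neq0 R n J c (leqnSn n)).
have N0 : 0 < n.+1%:R * T by rewrite mulr_gt0.
exists (n.+1%:R * T), phi; split=> //; first by rewrite nphi mulr_gt0.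
move=> K; apply: le_trans (gsum_le_fiber a b w_lt0 be al_gt0 s K N0 cphi (lexx _)) _.
rewrite -/T -/J.
set W := wsum w a b s.
set C := (1 - expR (- (th * T)))^-1 * (1 - expR (- (th * be)))^-1.
pose E := expR (- (th * (be * m0%:R))).
have key t : 0 <= t < d -> \sum_(m <- zrange K)
    cabs2 (\sum_(j <- zrange J) fiber w a b be s phi m (t + j%:~R * T)) <= (W * E) ^+ 2 * C * S.
  move=> /andP[t0 td]; have tT : 0 <= t < T by rewrite t0 (lt_le_trans td dT).
  have fibE m : \sum_(j <- zrange J) fiber w a b be s phi m (t + j%:~R * T) =
      \sum_(j <- zrange J) cext c j * Gfun w a b s (t + j%:~R * T - be * m%:~R).
    apply: eq_bigr => j _; rewrite /fiber /phi bumps_shift//.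
    by rewrite itv1_in ?t0//= rmorph1 mulr1.
  (* After m is replaced by m + m0, the surviving terms have this kernel; the shift by be m0 gains
     the factor [E] in Schur's test. *)
  pose G' y : R[i] := if 0 <= y then Gfun w a b s (y + be * m0%:R) else 0.
  have G'b y : cabs (G' y) <= (W * E) * ((0 <= y)%R%:R * expR (- (th * y))).
    rewrite /G'; case: (boolP (0 <= y)) => y0; last by rewrite cabs0 mul0r mulr0.
    apply: le_trans (Gfun_bound w a s _ b_ge0) _.
    rewrite -/W -/th addr_ge0 ?mulr_ge0 ?ler0n ?(ltW be_gt0)// !mul1r -mulrA.
    apply: ler_wpM2l; first exact: wsum_ge0.
    by rewrite /E -expRD ler_expR; lra.
  (* For m >= M1 all points of the support lie to the left of be m, where [Gfun] vanishes; for - m0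
     < m < M1 the relation c A = 0 is carried from t = 0 to t by [Gfun_shift]. *)
  have zero m : - m0%:Z < m -> \sum_(j <- zrange J) cext c j * Gfun w a b s (t + j%:~R * T - be * m%:~R) = 0.
    move=> m0m; have [mM|Mm] := ltP m M1%:Z; last first.
      rewrite big1// => j _; have [jn|jn] := boolP (0 <= j < n%:Z); last by rewrite cext_out// mul0r.
      rewrite Gfun_neg ?mulr0//.
      have h1 : (j + 1)%:~R * T <= n%:R * T.
        by rewrite ler_pM2r// -[n%:R]/(n%:Z%:~R) ler_int lezD1; case/andP: jn.
      have h2 : be * M1%:R <= be * m%:~R by rewrite ler_pM2l// -[M1%:R]/(M1%:Z%:~R) ler_int.
      have h3 : n%:R * T <= be * M1%:R.
        by move: M1a; rewrite mulrA ler_pdivrMr// mulrC [M1%:R * _]mulrC.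
      move: h1; rewrite intrD mulrDl mul1r => h1; move: tT => /andP[_ tT]; lra.
    rewrite (sum_cext c (leqnSn n) (fun z => Gfun w a b s (t + z%:~R * T - be * m%:~R))).
    have [l' lm mE] := int_offset m0m mM.
    pose l := Ordinal lm.
    have cl : \sum_(i < n) c ord0 i * Gfun w a b s (i%:R * T - be * m%:~R) = 0.
      have := congr1 (fun B : 'rV[R[i]]_(m0 + M1) => B ord0 l) cA.
      by rewrite !mxE => h; rewrite -[RHS]h; apply: eq_bigr => i _; rewrite mxE /= -mE.
    transitivity ((expR (2 * pi * w * t))%:C%C *
        \sum_(i < n) c ord0 i * Gfun w a b s (i%:R * T - be * m%:~R)); last by rewrite cl mulr0.
    rewrite mulr_sumr; apply: eq_bigr => i _; rewrite mulrCA; congr (_ * _).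
    rewrite -Gfun_shift//; first by congr Gfun; rewrite -[i%:R]/(i%:Z%:~R); ring.
    move=> k ks; apply/idP/idP => [h|h]; last by apply: (le_trans h); rewrite lerDl.
    rewrite leNgt; apply/negP => h'.
    have : d <= b k - (i%:R * T - be * m%:~R).
      apply: hd; last by rewrite subr_gt0.
      apply/mapP; exists (k, (val i, val l)); last by rewrite /= -mE.
      apply: allpairs_f => //; apply: allpairs_f; rewrite mem_iota add0n; first exact: ltn_ord.
      exact: lm.
    move: td; lra.
  apply: (@le_trans _ _ (\sum_(m <- zrange (K + m0)) cabs2 (\sum_(j <- zrange J) cext c j * G' (t + j%:~R * T - be * m%:~R)))); last first.
    apply: schur_upper => //.
    by rewrite mulr_ge0 ?wsum_ge0 ?expR_ge0.
  apply: (@le_trans _ _ (\sum_(m <- zrange K | m <= - m0%:Z) cabs2 (\sum_(j <- zrange J) cext c j * G' (t + j%:~R * T - be * (m + m0%:Z)%:~R)))).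
    rewrite [leRHS]big_mkcond /=; apply: ler_sum => m _; rewrite fibE.
    case: ifP => mm; last by rewrite zero ?cabs2_0// ltNge mm.
    rewrite le_eqVlt; apply/orP; left; apply/eqP; congr cabs2; apply: eq_bigr => j _.
    have [jn|jn] := boolP (0 <= j < n%:Z); last by rewrite cext_out// !mul0r.
    rewrite /G'.
    have y0 : 0 <= t + j%:~R * T - be * (m + m0%:Z)%:~R.
      have h1 : 0 <= j%:~R * T by rewrite mulr_ge0 ?(ltW T0)// ler0z; case/andP: jn.
      have h2 : be * (m + m0%:Z)%:~R <= 0.
        by rewrite mulr_ge0_le0 ?(ltW be_gt0)// lerz0; exact: addz_le0.
      by lra.
    by rewrite y0; congr (_ * Gfun _ _ _ _ _); rewrite intrD /=; ring.
  rewrite -big_filter -(big_map (fun m => m + m0%:Z) xpredT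
     (fun m => cabs2 (\sum_(j <- zrange J) cext c j * G' (t + j%:~R * T - be * m%:~R)))).
  apply: ler_sum_subset.
  - by rewrite (map_inj_uniq (addIr _)) filter_uniq// zrange_uniq.
  - exact: zrange_uniq.
  - move=> z /mapP[m]; rewrite mem_filter mem_zrange => /andP[m1 m2] ->.
    by rewrite mem_zrange; exact: zrange_shift.
  - by move=> m; exact: cabs2_ge0.
have cf m : L2 (fiber w a b be s phi m) by have [] := L2c_Gfun w_lt0 a b s (be * m%:~R) cphi.
have hsum : \sum_(m <- zrange K) nrm2 (periodize T J (fiber w a b be s phi m)) <=
    ((W * E) ^+ 2 * C * S) * d.
  under eq_bigr => m _ do rewrite nrm2_periodize.
  rewrite -Rintegral_sum => [|m _]; last exact: rint_periodize (cf m).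
  have <- : \int[mu]_t (((W * E) ^+ 2 * C * S) * itv1 0 d t) = ((W * E) ^+ 2 * C * S) * d.
    by rewrite RintegralZl//; [rewrite (Rintegral_itv1 (ltW d0)) subr0|exact: rint_itv1].
  apply: le_RintegralT.
  - by apply: rint_sum => m _; exact: rint_periodize (cf m).
  - by apply: rintZ; exact: rint_itv1.
  move=> t; have [td|td] := boolP (0 <= t < d).
    rewrite (itv1_in td) mulr1; apply: le_trans (key t td).
    apply: ler_sum => m _; rewrite itv1_in ?mul1r//.
    by case/andP: td => -> /lt_le_trans ->.
  rewrite (itv1_out td) mulr0 big1// => m _.
  rewrite itv1E; case: (boolP (_ && _)) => tT; last by rewrite mul0r.
  rewrite mul1r big1 ?cabs2_0// => j _.
  by rewrite /fiber /phi bumps_shift// (itv1_out td) rmorph0 mulr0 mul0r.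
have P0 : 0 <= 4 * pi ^+ 2 * T by rewrite mulr_ge0 ?(ltW T0)// mulr_ge0 ?sqr_ge0.
apply: le_trans (ler_wpM2l P0 hsum) _; rewrite nphi.
have E2 : E ^+ 2 = expR (- (2 * (th * be) * m0%:R)).
  by rewrite /E expr2 -expRD; congr expR; ring.
rewrite (_ : 4 * pi ^+ 2 * T * _ = upper_cst w al be * W ^+ 2 * E ^+ 2 * (d * S)).
  rewrite E2; apply: ler_wpM2r; last exact: hM0.
  by rewrite mulr_ge0 ?(ltW d0) ?(ltW S0).
by rewrite /upper_cst -/T -/th -/C; ring.
Qed.

End obstruction.

(** * Tails of the series P, and the window as an element of L^2 *)

Section series_symbol.
Context {R : realType}.
Variables (w : R) (a : nat -> R[i]) (b : nat -> R).
Hypothesis w_lt0 : w < 0.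
Hypothesis a0 : a 0%N = 1.
Hypothesis b0 : b 0%N = 0.
Hypothesis b_gt0 : forall k, (1 <= k)%N -> 0 < b k.
Hypothesis sum_lt1 :
  (\sum_(1 <= k <oo) (cabs (a k) * expR (2 * pi * `|w| * b k))%:E < 1)%E.

Let A k := cabs (a k) * expR (theta w * b k).
Let u n := \sum_(1 <= k < n) A k.
Let rho := fine (\sum_(1 <= k <oo) (A k)%:E)%E.

Lemma b_ge0 k : 0 <= b k.
Proof. by case: k => [|k]; [rewrite b0|rewrite ltW// b_gt0]. Qed.

Let A0 k : 0 <= A k. Proof. by rewrite mulr_ge0 ?cabs_ge0 ?expR_ge0. Qed.

Let cabs_le k : cabs (a k) <= A k.
Proof.
rewrite -[leLHS]mulr1; apply: ler_wpM2l; first exact: cabs_ge0.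
by rewrite -expR0 ler_expR mulr_ge0 ?b_ge0// ltW// theta_gt0.
Qed.

Let AE : (\sum_(1 <= k <oo) (A k)%:E = \sum_(1 <= k <oo) (cabs (a k) * expR (2 * pi * `|w| * b k))%:E)%E.
Proof. by congr (limn _); apply/funext => n; apply: eq_bigr => k _; rewrite ltr0_norm. Qed.

Let A0E n : (1 <= n)%N -> true -> (0 <= (A n)%:E)%E.
Proof. by move=> _ _; rewrite lee_fin. Qed.

Let rhoE : (\sum_(1 <= k <oo) (A k)%:E)%E = rho%:E.
Proof.
rewrite fineK// ge0_fin_numE; first by rewrite AE; apply: lt_trans sum_lt1 _; rewrite ltry.
by apply: nneseries_ge0 => n n1 _; exact: A0E.
Qed.

Lemma rho_lt1 : rho < 1.
Proof. by rewrite -lte_fin -rhoE AE. Qed.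

Lemma partial_le_rho n : u n <= rho.
Proof.
rewrite -lee_fin -rhoE /u -sumEFin.
exact: (nneseries_lim_ge n (P := xpredT) A0E).
Qed.

Lemma cvg_partial : u n @[n --> \oo] --> rho.
Proof.
have := is_cvg_nneseries A0E; rewrite -/(cvgn _) => /cvg_ex[l hl].
have hr : (\sum_(1 <= k < n) (A k)%:E)%E @[n --> \oo] --> rho%:E.
  by rewrite -rhoE (cvg_lim _ hl)//; exact: ereal_hausdorff.
suff -> : u = fine \o (fun n => (\sum_(1 <= k < n) (A k)%:E)%E) by exact: fine_cvg hr.
by apply/funext => n /=; rewrite sumEFin.
Qed.

(** This is the sequence used for [eps] in the extension to infinite series. *)
Definition tail m : R := rho - u m.

Lemma tail_ge0 m : 0 <= tail m.
Proof. by rewrite subr_ge0 partial_le_rho. Qed.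

Lemma tail_cvg e : 0 < e -> exists2 m0 : nat, (0 < m0)%N & forall m, (m0 <= m)%N -> tail m <= e.
Proof.
move=> e0; have := cvg_partial => /(@cvgrPdist_le _ R^o) /(_ _ e0) [N _ hN].
exists N.+1 => // m mN; apply: le_trans (hN m _); first exact: ler_norm.
exact: ltnW.
Qed.

Lemma partial_split m n : (1 <= m)%N -> (m <= n)%N -> \sum_(m <= k < n) A k <= tail m.
Proof.
move=> m1 mn; rewrite /tail lerBrDl; apply: le_trans (partial_le_rho n).
by rewrite /u (big_cat_nat m1 mn).
Qed.

Lemma wsum_tail m d : (0 < m)%N -> wsum w a b (iota m d) <= tail m.
Proof.
move=> m1; have := @partial_split m (m + d) m1 (leq_addr _ _).
by rewrite /index_iota addKn.
Qed.

Let c k (t : R) : R[i] := a k * cexpi (2 * pi * b k * t).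

(** [F] is the real or the imaginary part; the estimates below use only |F z| <= |z|, so both are
    treated at once. *)
Let part (F : R[i] -> R) n t := \sum_(0 <= k < n) F (c k t).

Let part_tail (F : R[i] -> R) : (forall z, `|F z| <= cabs z) ->
  forall m n t, (1 <= m)%N -> (m <= n)%N -> `|part F n t - part F m t| <= tail m.
Proof.
move=> hF m n t m1 mn; apply: le_trans (partial_split m1 mn).
rewrite /part (big_cat_nat (leq0n m) mn) /= addrAC subrr add0r.
apply: le_trans (ler_norm_sum _ _ _) _; apply: ler_sum => k _.
by apply: le_trans (hF _) _; rewrite cabsM cabs_cexpi mulr1.
Qed.

Let part_cvg (F : R[i] -> R) : (forall z, `|F z| <= cabs z) ->
  forall t, cvgn (fun n => part F n t).
Proof.
move=> hF t.
have hA : cvgn (series A).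
  apply/cvg_ex; exists (A 0%N + rho).
  rewrite -(cvg_shiftS (series A)).
  have -> : (fun n => series A n.+1) = (fun n => A 0%N + u n.+1).
    by apply/funext => n; rewrite /series /= big_ltn.
  apply: cvgD; first exact: cvg_cst.
  by have := cvg_partial; rewrite -(cvg_shiftS u).
apply: (@normed_cvg _ R^o); apply: series_le_cvg hA => [k|k|k] /=; rewrite ?A0 ?normr_ge0//.
by apply: le_trans (hF _) _; rewrite cabsM cabs_cexpi mulr1.
Qed.

Let lim_tail (F : R[i] -> R) : (forall z, `|F z| <= cabs z) ->
  forall m t, (1 <= m)%N -> `|limn (fun n => part F n t) - part F m t| <= tail m.
Proof.
move=> hF m t m1; have cv := @part_cvg F hF t.
have h : `|part F n t - part F m t| @[n --> \oo] --> `|limn (fun n => part F n t) - part F m t|.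
  by apply: cvg_norm; apply: cvgB; [exact: cv|exact: cvg_cst].
rewrite -(cvg_lim (@Rhausdorff R) h); apply: limr_le; first by apply/cvg_ex; eexists; exact: h.
by exists m => // n /= mn; exact: part_tail.
Qed.

Let S m t : R[i] := \sum_(k <- iota 0 m) c k t.

(** Real and imaginary part are each within [tail m] of their partial sums, whence the factor 2. *)
Let P_tail m t : (1 <= m)%N -> cabs2 (Pser a b t - S m t) <= 2 * tail m ^+ 2.
Proof.
move=> m1; rewrite /cabs2 !ReIm /Pser /= /S Re_sum Im_sum.
have := lim_tail Re_le_cabs t m1; have := lim_tail Im_le_cabs t m1.
rewrite /part /c (_ : iota 0 m = index_iota 0 m); last by rewrite /index_iota subn0.
move: (limn _ - _) (limn _ - _) => x y hx hy.
have sq z : `|z| <= tail m -> z ^+ 2 <= tail m ^+ 2.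
  by move=> hz; rewrite -[z ^+ 2]real_normK ?num_real// ler_pXn2r// ?nnegrE ?tail_ge0.
by have := sq _ hx; have := sq _ hy; lra.
Qed.

Let g t : R[i] := Pser a b t / (t%:C - 'i * w%:C)%C.

Lemma cmeas_Pser : cmeas (Pser a b).
Proof.
have mc k : cmeas (c k) by apply: cmeasM; [exact: cmeas_cst|exact: cmeas_expi].
split.
- apply: (@measurable_fun_cvg _ _ _ setT (fun n t => part (@complex.Re R) n t)) => [n|t _].
    by apply: measurable_sum => k; exact: (mc k).1.
  exact: (@part_cvg _ Re_le_cabs t).
- apply: (@measurable_fun_cvg _ _ _ setT (fun n t => part (@complex.Im R) n t)) => [n|t _].
    by apply: measurable_sum => k; exact: (mc k).2.
  exact: (@part_cvg _ Im_le_cabs t).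
Qed.

Lemma L2_g : L2 g.
Proof.
apply: (@L2_bddM _ _ _ (2 * (2 * tail 1 ^+ 2) + 2)); [exact: cmeas_Pser| |exact: L2_ck].
move=> t; have -> : Pser a b t = (Pser a b t - S 1 t) + S 1 t by rewrite subrK.
apply: le_trans (cabs2D_le _ _) _.
have h := P_tail t (leqnn 1).
have -> : cabs2 (S 1 t) = 1.
  by rewrite /S /= big_seq1 /c cabs2M cabs2_cexpi a0 /cabs2 /= expr1n expr0n addr0 mulr1.
by move: h; lra.
Qed.

Lemma g_tail m : (0 < m)%N ->
  nrm2 (fun t => g t - gfin w a b (iota 0 m) t) <= 2 * tail m ^+ 2 * nrm2 (ck w).
Proof.
move=> m0; rewrite /nrm2 -RintegralZl//; last exact: L2_rint (L2_ck w_lt0).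
apply: le_RintegralT.
- by apply: L2_rint; apply: L2B; [exact: L2_g|exact: L2_gfin].
- by apply: rintZ; exact: L2_rint (L2_ck w_lt0).
move=> t; rewrite /g /gfin -mulrBl cabs2M; apply: ler_wpM2r; first exact: cabs2_ge0.
exact: P_tail.
Qed.

End series_symbol.

(** * Sums over pairs of integers as limits over boxes, and the frame set *)

Section esum_boxes.
Context {R : realType}.
Variables (al be : R) (f h : R -> R[i]).
Let F (mn : int * int) := cabs2 (L2inner f (tfshift (al * mn.2%:~R) (be * mn.1%:~R) h)).

Let box K := [seq (m, n) | m <- zrange K, n <- zrange K].

Let box_uniq K : uniq (box K).
Proof. by apply: allpairs_uniq; rewrite ?zrange_uniq// => -[x y] [z t] _ _ /= [-> ->]. Qed.

Let gsumE K : gsum al be K f h = \sum_(mn <- box K) F mn.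
Proof. by rewrite /gsum /box big_allpairs. Qed.

Lemma gsum_le_esum K : ((gsum al be K f h)%:E <= \esum_(mn in [set: int * int]) (F mn)%:E)%E.
Proof.
apply: esum_ge; exists [set` box K]; first by split=> //; exact: finite_seq.
by rewrite -fsbig_seq// sumEFin -gsumE.
Qed.

Lemma esum_le_gsum B : (forall K, gsum al be K f h <= B) ->
  (\esum_(mn in [set: int * int]) (F mn)%:E <= B%:E)%E.
Proof.
move=> hB; apply: ge_ereal_sup => _ [X [finX _] <-].
rewrite fsbig_finite// sumEFin lee_fin.
set s := finmap.enum_fset _.
have [K1 h1] := sub_zrange (map fst s); have [K2 h2] := sub_zrange (map snd s).
apply: le_trans (hB (maxn K1 K2)); rewrite gsumE; apply: ler_sum_subset => //.
- exact: finmap.fset_uniq.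
- move=> [m n] mns; apply: allpairs_f.
  + have := h1 m (map_f fst mns); rewrite !mem_zrange => /le_trans; apply.
    by rewrite lez_nat leq_maxl.
  + have := h2 n (map_f snd mns); rewrite !mem_zrange => /le_trans; apply.
    by rewrite lez_nat leq_maxr.
- by move=> mn; exact: cabs2_ge0.
Qed.

End esum_boxes.

Theorem theorem1 (R : realType) (w : R) (a : nat -> R[i]) (b : nat -> R) :
  w < 0 ->
  a 0%N = 1 ->
  b 0%N = 0 ->
  (forall k : nat, (1 <= k)%N -> 0 < b k) ->
  (\sum_(1 <= k <oo) (cabs (a k) * expR (2 * pi * `|w| * b k))%:E < 1)%E ->
  frame_set (fun t : R => Pser a b t / (t%:C - 'i * w%:C)%C)
  = [set ab : R * R | 0 < ab.1 /\ 0 < ab.2 /\ ab.1 * ab.2 <= 1].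
Proof.
move=> w0 a0 b0 bpos sum1; set g := fun t : R => _.
have bge := b_ge0 b0 bpos.
have lg : L2 g by exact: L2_g.
have t0 := tail_ge0 w0 sum1; have tc := tail_cvg w0 sum1; have wt := wsum_tail w0 sum1.
have gt := g_tail w0 a0 b0 bpos sum1.
apply/seteqP; split=> -[al be] /= [al0 [be0]].
  case=> A [B [A0 [B0 frameAB]]]; split=> //; split=> //.
  rewrite leNgt; apply/negP => albe.
  have U0 := upper_cst_ge0 w0 al0 be0; set U := upper_cst w al be in U0.
  (* With U tail^2 <= A / 64 and an obstruction at level A / 8, the Gabor sum is at most (2 / 8 + 2
     * 8 / 64) A = A / 2 times the norm, against the lower frame bound A. *)
  pose d := Num.min 1 (A / (64 * (U + 1))).
  have U1 : 0 < 64 * (U + 1) by lra.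
  have d0 : 0 < d by rewrite lt_min ltr01 divr_gt0.
  have [m m0 hm] := tc _ d0.
  have hmm := hm m (leqnn m).
  have Ud : U * tail w a b m ^+ 2 <= A / 64.
    have [d1 d2] : d <= 1 /\ d <= A / (64 * (U + 1)) by rewrite /d; split; rewrite ge_min lexx ?orbT.
    have t2 : tail w a b m ^+ 2 <= d.
      rewrite expr2 -[leRHS]mul1r; apply: ler_pM => //; exact: le_trans hmm d1.
    have : tail w a b m ^+ 2 <= A / (64 * (U + 1)) by exact: le_trans t2 d2.
    rewrite ler_pdivlMr// => h; have := sqr_ge0 (tail w a b m).
    move: (tail w a b m ^+ 2) h => x h x0; rewrite ler_pdivlMr//; nra.
  have A8 : 0 < A / 8 by rewrite divr_gt0.
  (* The cut m is already fixed here: the tail bound holds for all f, so the bad function may depend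
     on m. *)
  have [N [phi [N0 cphi phi0 hphi]]] := obstruction a w0 al0 be0 bge (iota 0 m) albe A8.
  have [li ni] := ift_plancherel N0 cphi.
  have [low _] := frameAB _ li.
  have : (A%:E * L2norm2 (ift phi) <= (A / 2 * nrm2 phi)%:E)%E.
    apply: (le_trans low); apply: esum_le_gsum => K.
    have h1 := le_gsum_r al be K li lg (L2_gfin a b w0 (iota 0 m)).
    have h2 := upper_tail w0 al0 be0 bge lg t0 tc wt gt K m0 li.
    rewrite ni -/U in h2.
    have h3 := hphi K.
    have h4 : U * tail w a b m ^+ 2 * nrm2 phi <= A / 64 * nrm2 phi by apply: ler_wpM2r => //; exact: ltW.
    move: h1 h2 h3 h4.
    move: (gsum al be K _ g) => x1.
    move: (gsum al be K _ (gfin _ _ _ _)) => x2.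
    move: (gsum al be K _ _) => x3.
    move: (U * _) (nrm2 phi) => x4 x5.
    by lra.
  rewrite L2norm2E// ni -EFinM lee_fin ler_pM2r//; lra.
move=> albe; split=> //; split=> //.
have [B B0 hB] := upper_g w0 al0 be0 bge lg t0 tc wt gt.
have hr n : \sum_(1 <= k < n.+1) cabs (a k) * expR (theta w * b k) <= fine (\sum_(1 <= k <oo) (cabs (a k) * expR (theta w * b k))%:E)%E.
  exact: partial_le_rho w0 sum1 n.+1.
have [A A0 hA] := lower_g w0 al0 be0 bge lg t0 tc wt gt a0 b0 bpos (rho_lt1 w0 sum1) hr albe.
exists A, B; split=> //; split=> // f lf; rewrite L2norm2E//; split.
  (* [lower_g] reaches the bound only up to e on a finite box; comparing with the full sum first
     makes e removable. *)
  apply/lee_addgt0Pr => e e0; have [K hK] := hA f e lf e0.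
  apply: (@le_trans _ _ ((gsum al be K f g)%:E + e%:E)%E); first by rewrite -EFinM -EFinD lee_fin.
  by rewrite leeD2r// gsum_le_esum.
by rewrite -EFinM; apply: esum_le_gsum => K; exact: hB.
Qed.
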